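(* Let $d\in\mathbb{N}$, $1\le p\le\infty$, $1<r<\infty$, $0\le\kappa<\infty$, and let $\lambda:\mathbb{R}\to\mathbb{R}\setminus\{0\}$ be a bounded function which is a mask of type $(r,\kappa)$. Then there is a constant $C$ such that for every $m\in\mathbb{N}$ and every $f\in\mathcal{H}_{\lambda,p}(\mathbb{T}^d)$, $$\|f-P_m(f)\|_p\le C\,2^{-rm}\,m^{d-1-\kappa}\,\|f\|_{\mathcal{H}_{\lambda,p}(\mathbb{T}^d)}.$$
   Context: $\mathbb{T}^d$ is the $d$-dimensional torus ($2\pi$-periodic in each variable, $\mathbb{T}=\mathbb{T}^1$); $L^p(\mathbb{T}^d)$ has norm $\|f\|_p=\big((2\pi)^{-d}\int_{\mathbb{T}^d}|f|^p\big)^{1/p}$ for $p<\infty$ and the essential supremum norm for $p=\infty$. Convolution is normalized, $(f_1*f_2)(x)=(2\pi)^{-d}\int_{\mathbb{T}^d}f_1(x-t)f_2(t)\,dt$, so that Fourier coefficients $\widehat f(\boldsymbol j)=(2\pi)^{-d}\int f(\boldsymbol x)e^{-i(\boldsymbol j,\boldsymbol x)}d\boldsymbol x$ multiply. For a bounded $\lambda:\mathbb{R}\to\mathbb{R}\setminus\{0\}$, $\varphi_{\lambda,d}(\boldsymbol x):=\sum_{\boldsymbol j\in\mathbb{Z}^d}\prod_{l=1}^d\lambda(j_l)\,e^{i(\boldsymbol j,\boldsymbol x)}$, $\varphi_\lambda=\varphi_{\lambda,1}$, and $\mathcal{H}_{\lambda,p}(\mathbb{T}^d):=\{f=\varphi_{\lambda,d}*g:\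 g\in L^p(\mathbb{T}^d)\}$ with norm $\|f\|_{\mathcal{H}_{\lambda,p}(\mathbb{T}^d)}:=\|g\|_p$. A function $f:\mathbb{R}\to\mathbb{R}$ is a mask of type $(r,\kappa)$ if $f$ is even, 2-times continuously differentiable, and for $t\ge1$, $f(t)=|t|^{-r}(\log(|t|+1))^{-\kappa}F(\log|t|)$ for some (twice differentiable) $F:\mathbb{R}\to\mathbb{R}$ such that, for a constant $a_1$, $|F^{(k)}(t)|\le a_1$ for all $t\ge1$, $k=0,1,2$. Univariate operators: fix a 2-times continuously differentiable $\vartheta:\mathbb{R}\to\mathbb{R}$ with $\vartheta=1$ on $[-\frac12,\frac12]$ and $\vartheta=0$ outside $(-1,1)$; put $V_m(g):=H_m*g$, $H_m(x):=\sum_{k\in\mathbb{Z}}\vartheta(k/m)e^{ikx}$, and for $f=\varphi_\lambda*g\in\mathcal{H}_{\lambda,p}(\mathbb{T})$, $$Q_{m,\lambda}(f):=\frac1{2m+1}\sum_{k=0}^{2m}V_m(g)\Big(\frac{2\pi k}{2m+1}\Big)\,\varphi_\lambda\Big(\cdot-\frac{2\pi k}{2m+1}\Big).$$ Put $q_0:=Q_{1,\lambda}$ and $q_k:=Q_{2^k,\lambda}-Q_{2^{k-1},\lambda}$ for $k>0$. For $\boldsymbol k\in\mathbb{Z}^d_+$ (vectors with nonnegative integer coordinates), $q_{\boldsymbol k}:=\prod_{j=1}^dq_{k_j}$, where the univariate operator $q_{k_j}$ is applied to $f$ as a function of the variable $x_j$ with the other variables held fixed. Write $|\boldsymbol k|=\sum_j|k_j|$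 and $$P_m(f):=\sum_{\boldsymbol k\in\mathbb{Z}^d_+,\ |\boldsymbol k|\le m}q_{\boldsymbol k}(f).$$ *)

(* Defs.v *)
From HB Require Import structures.
From mathcomp Require Import all_boot all_order all_algebra.
From mathcomp Require Import all_classical all_reals all_analysis.
From mathcomp Require Import complex.

Set Implicit Arguments.
Unset Strict Implicit.
Unset Printing Implicit Defensive.

Import Order.TTheory GRing.Theory Num.Theory.
Import numFieldNormedType.Exports.

Local Open Scope classical_set_scope.
Local Open Scope ring_scope.
Local Open Scope complex_scope.

(* Functions on the torus T^d are represented by functions on R^d which are
   2 pi-periodic in each variable; they are complex-valued.  A point of R^d is
   a [d.-tuple R], which carries the product Borel sigma-algebra. *)

Section Points.
Context {R : realType}.

Definition vsub d (x t : d.-tuple R) : d.-tuple R :=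
  [tuple tnth x l - tnth t l | l < d].

Definition vset d (x : d.-tuple R) (i : 'I_d) (s : R) : d.-tuple R :=
  [tuple if l == i then s else tnth x l | l < d].

Definition torus_periodic d (g : d.-tuple R -> R[i]) :=
  forall (x : d.-tuple R) (i : 'I_d), g (vset x i (tnth x i + 2 * pi)) = g x.

End Points.

(* Normalized Lebesgue measure on the cube [0, 2 pi]^d, as an iterated product
   of uniform probabilities; integrals and Lebesgue norms with respect to it
   thus contain the normalizing factor (2 pi)^(-d). *)
Section TorusMeasure.
Context {R : realType}.

Lemma twopi_gt0 : (0 : R) < 2 * pi.
Proof. by rewrite mulr_gt0// pi_gt0. Qed.

(* [uniform_prob] lives on [measurableTypeR R], an alias of R with the same
   Borel sets but another display. *)
Definition vcons d (z : measurableTypeR R * d.-tuple R) : d.+1.-tuple R :=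
  [the d.+1.-tuple R of (z.1 : R) :: z.2].

Lemma measurable_vcons d :
  measurable_fun [set: measurableTypeR R * d.-tuple R] (@vcons d).
Proof.
apply: (@measurable_cons _ _ _ R (fun z : measurableTypeR R * d.-tuple R =>
  z.1 : R) d snd).
- exact: (@measurable_fst _ _ (measurableTypeR R) (d.-tuple R)).
- exact: measurable_snd.
Qed.

HB.instance Definition _ d :=
  @isMeasurableFun.Build _ _ (measurableTypeR R * d.-tuple R)%type
    (d.+1.-tuple R) (@vcons d) (@measurable_vcons d).

Fixpoint torus d : probability (d.-tuple R) R :=
  match d return probability (d.-tuple R) R with
  | 0 => \d_([tuple] : 0.-tuple R)
  | d'.+1 => distribution (uniform_prob twopi_gt0 \x torus d')%E (@vcons d')
  end.

End TorusMeasure.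

Section ComplexValued.
Context {R : realType}.

Definition cexp (t : R) : R[i] := cos t +i* sin t.

Definition climn (u : nat -> R[i]) : R[i] :=
  limn (fun n => complex.Re (u n)) +i* limn (fun n => complex.Im (u n)).

Definition cmeasurable dsp (T : measurableType dsp) (g : T -> R[i]) :=
  measurable_fun [set: T] (fun x => complex.Re (g x)) /\
  measurable_fun [set: T] (fun x => complex.Im (g x)).

Definition cintegral dsp (T : measurableType dsp)
    (mu : {measure set T -> \bar R}) (g : T -> R[i]) : R[i] :=
  (\int[mu]_t complex.Re (g t)) +i* (\int[mu]_t complex.Im (g t)).

Definition cnorm d (p : \bar R) (g : d.-tuple R -> R[i]) : \bar R :=
  Lnorm (torus d) p (fun x => (Normc.normc (g x))%:E).

Definition in_Lp d (p : \bar R) (g : d.-tuple R -> R[i]) :=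
  [/\ torus_periodic g, cmeasurable g & (cnorm p g < +oo)%E].

Definition convolution d (f1 f2 : d.-tuple R -> R[i]) (x : d.-tuple R) : R[i] :=
  cintegral (torus d) (fun t => f1 (vsub x t) * f2 t).

(* The frequency vector (k_1 - n, ..., k_d - n); for k in {0, ..., 2n}^d it
   ranges over {-n, ..., n}^d. *)
Definition freq d n (k : d.-tuple 'I_(n.*2.+1)) : d.-tuple int :=
  [tuple (tnth k l)%:Z - n%:Z | l < d].

(* \sum_(j in Z^d) c(j) exp(i (j, x)), as the limit of its cubic partial sums.
   It is only used for absolutely convergent series, for which the order of
   summation is irrelevant: a mask of type (r, kappa) with r > 1 and kappa >= 0
   is summable over the integers, and a cut-off has bounded support. *)
Definition trig_series d (c : d.-tuple int -> R) (x : d.-tuple R) : R[i] :=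
  climn (fun n => \sum_(k : d.-tuple 'I_(n.*2.+1))
    (c (freq k))%:C * cexp (\sum_(l < d) (tnth (freq k) l)%:~R * tnth x l)).

End ComplexValued.

Section Spaces.
Context {R : realType}.
Variable lam : R -> R.

Definition phi d : d.-tuple R -> R[i] :=
  trig_series (fun j => \prod_(l < d) lam (tnth j l)%:~R).

(* [is_source p f g]: g is in L^p(T^d) and f = phi_{lambda,d} * g.  The
   equality is pointwise: as the kernel is continuous, the convolution is
   defined everywhere, which makes sense of restricting f to lines. *)
Definition is_source d (p : \bar R) (f g : d.-tuple R -> R[i]) :=
  in_Lp p g /\ f = convolution (@phi d) g.

Definition in_H d (p : \bar R) (f : d.-tuple R -> R[i]) :=
  exists g, is_source p f g.

(* Since lambda does not vanish, g is determined by f almost everywhere, so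
   that norms and convolutions of [source p f] do not depend on the choice. *)
Definition source d (p : \bar R) (f : d.-tuple R -> R[i]) :
    d.-tuple R -> R[i] :=
  xget (fun=> 0) [set g | is_source p f g].

Definition Hnorm d (p : \bar R) (f : d.-tuple R -> R[i]) : \bar R :=
  cnorm p (source p f).

End Spaces.

Section Smolyak.
Context {R : realType}.
Variables (lam theta : R -> R) (p : \bar R).

Definition Hker (m : nat) : 1.-tuple R -> R[i] :=
  trig_series (fun j => theta ((tnth j ord0)%:~R / m%:R)).

Definition Vop (m : nat) (g : 1.-tuple R -> R[i]) : 1.-tuple R -> R[i] :=
  convolution (Hker m) g.

Definition node (m k : nat) : R := 2 * pi * k%:R / (2 * m + 1)%N%:R.

Definition Qop (m : nat) (f : R -> R[i]) (x : R) : R[i] :=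
  let g := source lam p (fun y : 1.-tuple R => f (tnth y ord0)) in
  (2 * m + 1)%N%:R^-1 *
  \sum_(0 <= k < (2 * m).+1)
    Vop m g [tuple node m k] * phi lam [tuple x - node m k].

Definition q1 (k : nat) (f : R -> R[i]) (x : R) : R[i] :=
  if k is k'.+1 then Qop (2 ^ k'.+1) f x - Qop (2 ^ k') f x else Qop 1 f x.

Definition on_var d (i : 'I_d) (A : (R -> R[i]) -> (R -> R[i]))
    (f : d.-tuple R -> R[i]) (x : d.-tuple R) : R[i] :=
  A (fun s => f (vset x i s)) (tnth x i).

(* The factors act on different variables, so their order is irrelevant on
   H_{lambda,p}(T^d). *)
Definition qop d (k : 'I_d -> nat) :
    (d.-tuple R -> R[i]) -> (d.-tuple R -> R[i]) :=
  \big[comp/id]_(j < d) on_var j (q1 (k j)).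

(* Every k with |k| <= m has all its coordinates in {0, ..., m}. *)
Definition Pop d (m : nat) (f : d.-tuple R -> R[i]) (x : d.-tuple R) : R[i] :=
  \sum_(k : {ffun 'I_d -> 'I_m.+1} | (\sum_(j < d) k j <= m)%N)
    qop (fun j => k j : nat) f x.

End Smolyak.

Section Masks.
Context {R : realType}.

Definition C2 (f : R -> R) :=
  [/\ forall t : R, derivable f t 1, forall t : R, derivable (derive1 f) t 1
    & continuous (derive1n 2 f)].

Definition twice_derivable (f : R -> R) :=
  (forall t : R, derivable f t 1) /\ (forall t : R, derivable (derive1 f) t 1).

Definition is_mask (r kappa : R) (f : R -> R) :=
  [/\ forall t : R, f (- t) = f t, C2 f
    & exists F : R -> R,
      [/\ twice_derivable F,
          exists a1 : R, forall (t : R) (k : nat), 1 <= t -> (k <= 2)%N ->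
            `|derive1n k F t| <= a1
        & forall t : R, 1 <= t ->
            f t = `|t| `^ (- r) * ln (`|t| + 1) `^ (- kappa) * F (ln `|t|)]].

Definition is_cutoff (theta : R -> R) :=
  [/\ C2 theta, forall t : R, - 2^-1 <= t <= 2^-1 -> theta t = 1
    & forall t : R, ~~ (-1 < t < 1) -> theta t = 0].

End Masks.

(* Main.v *)
Require Import Defs.
From mathcomp Require Import all_boot all_order all_algebra.
From mathcomp Require Import all_classical all_reals all_analysis.
From mathcomp Require Import measurable_realfun ess_sup_inf.
From mathcomp Require Import complex ring lra zify.

(* All operators involved are integral operators on the torus.  If f is the
   convolution of phi with g, then Q_m f has the kernel K_m(x,t) =
   (2m+1)^-1 sum_k H_m(x_k - t) phi(x - x_k) over the nodes x_k, applied to g.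
   Aliasing expresses phi(x-t) - K_m(x,t) through trigonometric sums whose
   coefficients are products of the mask and the cut-off; two summations by
   parts, together with the bounds on the first two differences of the mask,
   give for m = 2^k the pointwise estimate
     |phi(x-t) - K_m(x,t)| <= C 2^(-rk) (k+1)^(-kappa) P(x-t),
   with P the Poisson kernel of radius m/(m+1), whose integral is at most 2
   here.  Hence the kernels E_k of I - Q_{2^k} and q_k of the differences have
   row and column integrals O(2^(-rk) (k+1)^(-kappa)).  The kernel R_{d,m} of
   the error of P_m satisfies
     R_{d+1,m} = E_m (x) Phi_d + sum_{k <= m} q_k (x) R_{d,m-k},
   and (k+1)(m-k+1) >= m+1 yields by induction on d row and column integrals
   O(2^(-rm) (m+1)^(d-1-kappa)); such a kernel is bounded on every L^p.
   To iterate the q_k one needs a source of every section of a function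
   f = int prod_l kappa_l(x_l,t_l) g(t) dt.  Averaging over all variables but
   one provides a source, and all sources have the same Fourier coefficients
   since lambda never vanishes; as V_m only depends on finitely many of them,
   q_k merely replaces one of the factors phi(x_l - t_l) by the kernel q_k. *)

Set Implicit Arguments.
Unset Strict Implicit.
Unset Printing Implicit Defensive.

Import Order.TTheory GRing.Theory Num.Theory.
Import numFieldNormedType.Exports.

Local Open Scope classical_set_scope.
Local Open Scope ring_scope.
Local Open Scope complex_scope.

(** * Complex-valued functions *)

(** The kernel of [Qop] is in general not a function of x - t, so the error is not a Fourier
    multiplier, and p may be 1 or infinite. Hence the proof uses absolute integrals of kernels over
    rows and columns, which multiply under tensor products. The decay needed for them comes from one
    weight: the trivial bound of a trigonometric sum S, plus m(m+1) times its bound after two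
    summations by parts, controls (1 + m(m+1)(2 - 2 cos y)) |S(y)|, and this weight is 2m+1 divided
    by the Poisson kernel of radius m/(m+1). So the circle is never split at distance 1/m; only the
    mean of a Poisson kernel is needed. Aliasing is exact for partial sums made of 2L+1 blocks of
    2m+1 frequencies. Summation by parts leaves boundary terms at the end of the last block; they
    survive the factor m(m+1) because L >= m puts this end beyond m^2 and r > 1. On the operator
    side the obstacle is that [source] is an arbitrary choice, known only through its Fourier
    coefficients, and that a section of an integrable function is integrable only almost
    everywhere. *)

Section ComplexNumbers.
Context {R : realType}.
Implicit Types x y z : R[i].
Local Notation normc := (@Normc.normc R).
Local Notation Re := (@complex.Re R).
Local Notation Im := (@complex.Im R).

Lemma ReD x y : Re (x + y) = Re x + Re y. Proof. by case: x y => ? ? [? ?]. Qed.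
Lemma ImD x y : Im (x + y) = Im x + Im y. Proof. by case: x y => ? ? [? ?]. Qed.
Lemma ReN x : Re (- x) = - Re x. Proof. by case: x. Qed.
Lemma ImN x : Im (- x) = - Im x. Proof. by case: x. Qed.
Lemma ReM x y : Re (x * y) = Re x * Re y - Im x * Im y.
Proof. by case: x y => ? ? [? ?]. Qed.
Lemma ImM x y : Im (x * y) = Re x * Im y + Im x * Re y.
Proof. by case: x y => ? ? [? ?]. Qed.

Lemma Re_sum I (r : seq I) (P : pred I) (F : I -> R[i]) :
  Re (\sum_(i <- r | P i) F i) = \sum_(i <- r | P i) Re (F i).
Proof. exact: (big_morph Re ReD). Qed.

Lemma complex_ext x y : Re x = Re y -> Im x = Im y -> x = y.
Proof. by case: x y => a b [a' b'] /= -> ->. Qed.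

Lemma normc_ge0 x : 0 <= normc x.
Proof. by case: x => a b; rewrite /Normc.normc sqrtr_ge0. Qed.

Lemma normcD x y : normc (x + y) <= normc x + normc y.
Proof. exact: le_normcD. Qed.

Lemma normcNE x : normc (- x) = normc x.
Proof. exact: normcN. Qed.

Lemma normcB x y : normc (x - y) <= normc x + normc y.
Proof. by rewrite (le_trans (normcD _ _))// normcNE. Qed.

Lemma normcR (a : R) : normc a%:C = `|a|.
Proof. by rewrite /Normc.normc/= expr0n addr0 sqrtr_sqr. Qed.

Lemma normc_sum I (r : seq I) (P : pred I) (F : I -> R[i]) :
  normc (\sum_(i <- r | P i) F i) <= \sum_(i <- r | P i) normc (F i).
Proof.
elim/big_rec2 : _ => [|i u v _ uv]; first by rewrite Normc.normc0.
by rewrite (le_trans (normcD _ _))// lerD2l.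
Qed.

Lemma normc_prod I (r : seq I) (P : pred I) (F : I -> R[i]) :
  normc (\prod_(i <- r | P i) F i) = \prod_(i <- r | P i) normc (F i).
Proof. exact: (big_morph _ (@Normc.normcM _) (@Normc.normc1 _)). Qed.

Lemma Re_le_normc x : `|Re x| <= normc x.
Proof.
case: x => a b /=; rewrite -sqrtr_sqr ler_sqrt ?lerDl ?sqr_ge0//.
by rewrite addr_ge0 ?sqr_ge0.
Qed.

Lemma Im_le_normc x : `|Im x| <= normc x.
Proof.
case: x => a b /=; rewrite -sqrtr_sqr ler_sqrt ?lerDr ?sqr_ge0//.
by rewrite addr_ge0 ?sqr_ge0.
Qed.

Lemma normc_le_ReIm x : normc x <= `|Re x| + `|Im x|.
Proof.
case: x => a b /=; rewrite -(@ger0_norm _ (`|a| + `|b|)) ?addr_ge0//.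
rewrite -sqrtr_sqr ler_sqrt ?sqr_ge0// sqrrD !real_normK ?num_real//.
by rewrite addrAC lerDl mulrn_wge0// mulr_ge0.
Qed.

Lemma cexpD (s t : R) : cexp (s + t) = cexp s * cexp t.
Proof. by apply: complex_ext; rewrite /= ?cosD ?sinD//; ring. Qed.

Lemma cexp0 : cexp (0 : R) = 1.
Proof. by rewrite /cexp cos0 sin0. Qed.

Lemma normc_cexp (t : R) : normc (cexp t) = 1.
Proof. by rewrite /Normc.normc/= cos2Dsin2 sqrtr1. Qed.

Lemma cexp_sum I (r : seq I) (P : pred I) (F : I -> R) :
  cexp (\sum_(i <- r | P i) F i) = \prod_(i <- r | P i) cexp (F i).
Proof. exact: (big_morph _ cexpD cexp0). Qed.

Lemma cexp_twopi (n : nat) : cexp (2 * pi *+ n : R) = 1.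
Proof.
elim: n => [|n IH]; first by rewrite mulr0n cexp0.
by rewrite mulrS cexpD IH mulr1 /cexp mulr_natl cos2pi sin2pi.
Qed.

Lemma cexp_twopi_int (k : int) : cexp (2 * pi * k%:~R : R) = 1.
Proof.
case: k => n; first by rewrite mulr_natr cexp_twopi.
rewrite NegzE mulrNz mulrN; apply: (@mulIr _ (cexp (2 * pi *+ n.+1))).
  by rewrite cexp_twopi unitr1.
by rewrite -cexpD mulr_natr addNr cexp0 cexp_twopi mulr1.
Qed.

End ComplexNumbers.

(* Convergence in [R[i]], matching the componentwise limit [climn]. *)
Section ComplexLimits.
Context {R : realType}.
Local Notation normc := (@Normc.normc R).

Definition ccvg (u : nat -> R[i]) (l : R[i]) :=
  ((fun n => complex.Re (u n)) @ \oo --> complex.Re l) /\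
  ((fun n => complex.Im (u n)) @ \oo --> complex.Im l).

Lemma ccvg_climn u l : ccvg u l -> climn u = l.
Proof.
by move=> [u1 u2]; apply: complex_ext; rewrite /climn/=; apply: cvg_lim.
Qed.

Lemma ccvg_cst l : ccvg (fun=> l) l.
Proof. by split; exact: cvg_cst. Qed.

Lemma ccvgD u v l l' : ccvg u l -> ccvg v l' -> ccvg (fun n => u n + v n) (l + l').
Proof.
move=> [u1 u2] [v1 v2]; split.
  by rewrite ReD; under eq_fun do rewrite ReD; apply: cvgD.
by rewrite ImD; under eq_fun do rewrite ImD; apply: cvgD.
Qed.

Lemma ccvgM u v l l' : ccvg u l -> ccvg v l' -> ccvg (fun n => u n * v n) (l * l').
Proof.
move=> [u1 u2] [v1 v2]; split.
  by rewrite ReM; under eq_fun do rewrite ReM; apply: cvgB; exact: cvgM.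
by rewrite ImM; under eq_fun do rewrite ImM; apply: cvgD; exact: cvgM.
Qed.

Lemma ccvgN u l : ccvg u l -> ccvg (fun n => - u n) (- l).
Proof.
move=> [u1 u2]; split.
  by rewrite ReN; under eq_fun do rewrite ReN; apply: cvgN.
by rewrite ImN; under eq_fun do rewrite ImN; apply: cvgN.
Qed.

Lemma ccvgB u v l l' : ccvg u l -> ccvg v l' -> ccvg (fun n => u n - v n) (l - l').
Proof. by move=> ul vl; apply: ccvgD => //; exact: ccvgN. Qed.

Lemma ccvg_sum I (r : seq I) (P : pred I) (F : I -> nat -> R[i]) (l : I -> R[i]) :
  (forall i, P i -> ccvg (F i) (l i)) ->
  ccvg (fun n => \sum_(i <- r | P i) F i n) (\sum_(i <- r | P i) l i).
Proof.
move=> Fl; elim: r => [|i r IH].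
  by rewrite big_nil; under eq_fun do rewrite big_nil; exact: ccvg_cst.
rewrite big_cons; under eq_fun do rewrite big_cons.
by case: ifPn => // Pi; apply: ccvgD => //; exact: Fl.
Qed.

Lemma ccvg_prod I (r : seq I) (P : pred I) (F : I -> nat -> R[i]) (l : I -> R[i]) :
  (forall i, P i -> ccvg (F i) (l i)) ->
  ccvg (fun n => \prod_(i <- r | P i) F i n) (\prod_(i <- r | P i) l i).
Proof.
move=> Fl; elim: r => [|i r IH].
  by rewrite big_nil; under eq_fun do rewrite big_nil; exact: ccvg_cst.
rewrite big_cons; under eq_fun do rewrite big_cons.
by case: ifPn => // Pi; apply: ccvgM => //; exact: Fl.
Qed.

Lemma ccvg_subseq u l (h : nat -> nat) :
  (forall n, (n <= h n)%N) -> ccvg u l -> ccvg (u \o h) l.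
Proof.
move=> hn; have hoo : h @ \oo --> \oo.
  move=> A [N _ NA]; exists N => //= n /= Nn; apply: NA => /=.
  exact: leq_trans (hn n).
by move=> [u1 u2]; split; [exact: (cvg_comp h _ hoo u1)|exact: (cvg_comp h _ hoo u2)].
Qed.

Lemma ccvg_eventually_cst u l (N : nat) :
  (forall n, (N <= n)%N -> u n = l) -> ccvg u l.
Proof.
by move=> ul; split; apply: cvg_near_cst; exists N => //= n /ul ->.
Qed.

Lemma ccvg_normc_le u l (B : R) (N : nat) :
  ccvg u l -> (forall n, (N <= n)%N -> normc (u n) <= B) -> normc l <= B.
Proof.
move=> [u1 u2] uB; apply: (cvgr_to_le (F := \oo) (f := normc \o u)); last first.
  by exists N => //= n /uB.
have -> : normc \o u = fun n =>
    Num.sqrt (complex.Re (u n) * complex.Re (u n) +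
              complex.Im (u n) * complex.Im (u n)).
  by apply/funext => n /=; case: (u n) => a b /=; rewrite -!expr2.
have -> : normc l = Num.sqrt (complex.Re l * complex.Re l +
                              complex.Im l * complex.Im l).
  by case: l {u1 u2} => a b /=; rewrite -!expr2.
by apply: continuous_cvg; [exact: sqrt_continuous|apply: cvgD; apply: cvgM].
Qed.

End ComplexLimits.

Section ComplexMeasurable.
Context {R : realType} dsp (T : measurableType dsp).
Local Notation normc := (@Normc.normc R).
Implicit Types f g : T -> R[i].

Lemma cmeasurable_cst (c : R[i]) : cmeasurable (fun _ : T => c).
Proof. by split; exact: measurable_cst. Qed.

Lemma cmeasurableD f g : cmeasurable f -> cmeasurable g ->
  cmeasurable (fun x => f x + g x).
Proof.
move=> [f1 f2] [g1 g2]; split.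
  by under eq_fun do rewrite ReD; exact: measurable_funD.
by under eq_fun do rewrite ImD; exact: measurable_funD.
Qed.

Lemma cmeasurableM f g : cmeasurable f -> cmeasurable g ->
  cmeasurable (fun x => f x * g x).
Proof.
move=> [f1 f2] [g1 g2]; split.
  under eq_fun do rewrite ReM.
  by apply: measurable_funB; exact: measurable_funM.
under eq_fun do rewrite ImM.
by apply: measurable_funD; exact: measurable_funM.
Qed.

Lemma cmeasurableN f : cmeasurable f -> cmeasurable (fun x => - f x).
Proof.
move=> [f1 f2]; split.
  by under eq_fun do rewrite ReN; exact: measurable_funN.
by under eq_fun do rewrite ImN; exact: measurable_funN.
Qed.

Lemma cmeasurableB f g : cmeasurable f -> cmeasurable g ->
  cmeasurable (fun x => f x - g x).
Proof. by move=> mf mg; apply: cmeasurableD => //; exact: cmeasurableN. Qed.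

Lemma cmeasurable_sum I (r : seq I) (P : pred I) (F : I -> T -> R[i]) :
  (forall i, P i -> cmeasurable (F i)) ->
  cmeasurable (fun x => \sum_(i <- r | P i) F i x).
Proof.
move=> mF; elim: r => [|i r IH].
  by under eq_fun do rewrite big_nil; exact: cmeasurable_cst.
under eq_fun do rewrite big_cons.
by case Pi : (P i) => //; apply: cmeasurableD => //; exact: mF.
Qed.

Lemma cmeasurable_prod I (r : seq I) (P : pred I) (F : I -> T -> R[i]) :
  (forall i, P i -> cmeasurable (F i)) ->
  cmeasurable (fun x => \prod_(i <- r | P i) F i x).
Proof.
move=> mF; elim: r => [|i r IH].
  by under eq_fun do rewrite big_nil; exact: cmeasurable_cst.
under eq_fun do rewrite big_cons.
by case Pi : (P i) => //; apply: cmeasurableM => //; exact: mF.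
Qed.

Lemma cmeasurable_ccvg (F : nat -> T -> R[i]) f :
  (forall n, cmeasurable (F n)) -> (forall x, ccvg (F ^~ x) (f x)) ->
  cmeasurable f.
Proof.
move=> mF Ff; split.
  apply: (@measurable_fun_cvg _ _ _ _ (fun n x => complex.Re (F n x))).
    by move=> n; exact: (mF n).1.
  by move=> x _; exact: (Ff x).1.
apply: (@measurable_fun_cvg _ _ _ _ (fun n x => complex.Im (F n x))).
  by move=> n; exact: (mF n).2.
by move=> x _; exact: (Ff x).2.
Qed.

Lemma measurable_normc f : cmeasurable f -> measurable_fun setT (fun x => normc (f x)).
Proof.
move=> [f1 f2].
have -> : (fun x => normc (f x)) = Num.sqrt \o
    (fun x => complex.Re (f x) ^+ 2 + complex.Im (f x) ^+ 2).
  by apply/funext => x /=; case: (f x).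
apply: measurableT_comp.
  exact: (continuous_measurable_fun (@sqrt_continuous R)).
by apply: measurable_funD; apply: measurable_funX.
Qed.

Lemma emeasurable_normc f : cmeasurable f ->
  measurable_fun setT (fun x => (normc (f x))%:E).
Proof. by move=> mf; apply/measurable_EFinP; exact: measurable_normc. Qed.

Lemma cmeasurable_cexp (h : T -> R) : measurable_fun setT h ->
  cmeasurable (fun x => cexp (h x)).
Proof.
move=> mh; split => /=.
  apply: (@measurableT_comp _ _ _ _ _ _ (@cos R)) => //.
  exact: (continuous_measurable_fun (@continuous_cos R)).
apply: (@measurableT_comp _ _ _ _ _ _ (@sin R)) => //.
exact: (continuous_measurable_fun (@continuous_sin R)).
Qed.

End ComplexMeasurable.

Lemma cmeasurable_comp {R : realType} d1 d2 (T1 : measurableType d1)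
    (T2 : measurableType d2) (f : T2 -> R[i]) (h : T1 -> T2) :
  cmeasurable f -> measurable_fun setT h -> cmeasurable (fun x => f (h x)).
Proof. by move=> [f1 f2] mh; split; [exact: (measurableT_comp f1)|exact: (measurableT_comp f2)]. Qed.

Section ComplexIntegral.
Context {R : realType} dsp (T : measurableType dsp).
Variable mu : {measure set T -> \bar R}.
Local Notation normc := (@Normc.normc R).
Implicit Types f g b : T -> R[i].

Definition cintegrable g :=
  mu.-integrable setT (EFin \o (fun x => complex.Re (g x))) /\
  mu.-integrable setT (EFin \o (fun x => complex.Im (g x))).

Lemma cintegrableP g : cintegrable g <->
  cmeasurable g /\ (\int[mu]_x (normc (g x))%:E < +oo)%E.
Proof.
split=> [[g1 g2]|[mg goo]].
  have mg : cmeasurable g.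
    by split; apply/measurable_EFinP; [exact: measurable_int g1|
                                       exact: measurable_int g2].
  split => //.
  have := integrableD measurableT (integrable_abse g1) (integrable_abse g2).
  move=> h; have /(le_integrable measurableT (emeasurable_normc mg)) : forall x, setT x -> (`|(normc (g x))%:E| <=
      `|((abse \o (EFin \o (fun x => complex.Re (g x)))) \+
        (abse \o (EFin \o (fun x => complex.Im (g x))))) x|)%E.
    move=> x _ /=; rewrite lee_fin ger0_norm ?normc_ge0//.
    by rewrite ger0_norm ?addr_ge0// normc_le_ReIm.
  move=> /(_ _ h) /integrableP[_].
  by under eq_integral do rewrite /= ger0_norm ?normc_ge0//.
have ig : mu.-integrable setT (fun x => (normc (g x))%:E).
  apply/integrableP; split; first exact: emeasurable_normc.
  by under eq_integral do rewrite /= ger0_norm ?normc_ge0//.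
split; apply: (le_integrable measurableT _ _ ig).
- by apply/measurable_EFinP; exact: mg.1.
- move=> x _ /=; rewrite lee_fin (ger0_norm (normc_ge0 _)); exact: Re_le_normc.
- by apply/measurable_EFinP; exact: mg.2.
- move=> x _ /=; rewrite lee_fin (ger0_norm (normc_ge0 _)); exact: Im_le_normc.
Qed.

Lemma cintegrable_normc_le g (h : T -> R) : cmeasurable g ->
  mu.-integrable setT (EFin \o h) -> (forall x, normc (g x) <= h x) ->
  cintegrable g.
Proof.
move=> mg ih gh; apply/cintegrableP; split => //.
have : mu.-integrable setT (fun x => (normc (g x))%:E).
  apply: (le_integrable measurableT _ _ ih); first exact: emeasurable_normc.
  move=> x _ /=; rewrite lee_fin ger0_norm ?normc_ge0//.
  exact: le_trans (gh x) (ler_norm _).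
move=> /integrableP[_].
by under eq_integral do rewrite /= ger0_norm ?normc_ge0//.
Qed.

Lemma cintegrable_integrable_normc g : cintegrable g ->
  mu.-integrable setT (EFin \o (fun x => normc (g x))).
Proof.
move=> /cintegrableP[mg goo]; apply/integrableP; split.
  exact: emeasurable_normc.
by under eq_integral do rewrite /= ger0_norm ?normc_ge0//.
Qed.

Lemma cintegrable_measurable g : cintegrable g -> cmeasurable g.
Proof. by move=> /cintegrableP[]. Qed.

Lemma cintegrable_bddM b g (B : R) : cmeasurable b ->
  (forall x, normc (b x) <= B) -> cintegrable g -> cintegrable (fun x => b x * g x).
Proof.
move=> mb bB ig.
apply: (@cintegrable_normc_le _ (fun x => B * normc (g x))).
- by apply: cmeasurableM => //; exact: cintegrable_measurable.
- exact: (integrableZl measurableT B (cintegrable_integrable_normc ig)).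
- by move=> x; rewrite Normc.normcM ler_wpM2r// normc_ge0.
Qed.

Lemma cintegralD f g : cintegrable f -> cintegrable g ->
  cintegral mu (fun x => f x + g x) = cintegral mu f + cintegral mu g.
Proof.
move=> [f1 f2] [g1 g2]; apply: complex_ext; rewrite /cintegral/=.
  by rewrite -RintegralD//; apply: eq_Rintegral => x _; rewrite ReD.
by rewrite -RintegralD//; apply: eq_Rintegral => x _; rewrite ImD.
Qed.

Lemma cintegrableD f g : cintegrable f -> cintegrable g ->
  cintegrable (fun x => f x + g x).
Proof.
move=> [f1 f2] [g1 g2]; split.
  apply: eq_integrable (integrableD measurableT f1 g1) => // x _ /=.
  by rewrite ReD EFinD.
apply: eq_integrable (integrableD measurableT f2 g2) => // x _ /=.
by rewrite ImD EFinD.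
Qed.

Lemma cintegrable0 : cintegrable (fun=> 0).
Proof. by split; exact: integrable0. Qed.

Lemma cintegral0 : cintegral mu (fun=> 0) = 0.
Proof. by apply: complex_ext; rewrite /cintegral/= /Rintegral integral0. Qed.

Lemma cintegrableZ (c : R[i]) g : cintegrable g -> cintegrable (fun x => c * g x).
Proof. by apply: cintegrable_bddM => //; exact: cmeasurable_cst. Qed.

Lemma cintegralZ (c : R[i]) g : cintegrable g ->
  cintegral mu (fun x => c * g x) = c * cintegral mu g.
Proof.
move=> [g1 g2]; apply: complex_ext; rewrite /cintegral ?ReM ?ImM/=.
  rewrite -!RintegralZl// -RintegralB//; last 2 first.
    exact: (integrableZl measurableT _ g1).
    exact: (integrableZl measurableT _ g2).
  by apply: eq_Rintegral => x _; rewrite ReM.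
rewrite -!RintegralZl// -RintegralD//; last 2 first.
  exact: (integrableZl measurableT _ g2).
  exact: (integrableZl measurableT _ g1).
by apply: eq_Rintegral => x _; rewrite ImM.
Qed.

Lemma cintegralN g : cintegrable g ->
  cintegral mu (fun x => - g x) = - cintegral mu g.
Proof.
move=> ig; rewrite -mulN1r -cintegralZ//.
by congr cintegral; apply/funext => x; rewrite mulN1r.
Qed.

Lemma cintegrableN g : cintegrable g -> cintegrable (fun x => - g x).
Proof.
move=> /(cintegrableZ (-1)); congr cintegrable.
by apply/funext => x; rewrite mulN1r.
Qed.

Lemma cintegrableB f g : cintegrable f -> cintegrable g ->
  cintegrable (fun x => f x - g x).
Proof. by move=> jf jg; apply: cintegrableD => //; exact: cintegrableN. Qed.

Lemma cintegralB f g : cintegrable f -> cintegrable g ->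
  cintegral mu (fun x => f x - g x) = cintegral mu f - cintegral mu g.
Proof.
by move=> jf jg; rewrite cintegralD ?cintegralN//; exact: cintegrableN.
Qed.

Lemma cintegrable_sum I (r : seq I) (P : pred I) (F : I -> T -> R[i]) :
  (forall i, P i -> cintegrable (F i)) ->
  cintegrable (fun x => \sum_(i <- r | P i) F i x).
Proof.
move=> iF; elim: r => [|i r IH].
  by under eq_fun do rewrite big_nil; exact: cintegrable0.
under eq_fun do rewrite big_cons.
by case Pi : (P i) => //; apply: cintegrableD => //; exact: iF.
Qed.

Lemma cintegral_sum I (r : seq I) (P : pred I) (F : I -> T -> R[i]) :
  (forall i, P i -> cintegrable (F i)) ->
  cintegral mu (fun x => \sum_(i <- r | P i) F i x) =
  \sum_(i <- r | P i) cintegral mu (F i).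
Proof.
move=> iF; elim: r => [|i r IH].
  by rewrite big_nil; under eq_fun do rewrite big_nil; exact: cintegral0.
rewrite big_cons; under eq_fun do rewrite big_cons.
case: ifPn => Pi //; rewrite cintegralD ?IH//; first exact: iF.
exact: cintegrable_sum.
Qed.

(* The factor 2 comes from estimating real and imaginary parts separately. *)
Lemma normc_cintegral g : cintegrable g ->
  ((normc (cintegral mu g))%:E <= 2%:E * \int[mu]_x (normc (g x))%:E)%E.
Proof.
move=> ig; have [g1 g2] := ig.
have inor := cintegrable_integrable_normc ig.
have le1 h : mu.-integrable setT (EFin \o h) -> (forall x, `|h x| <= normc (g x)) ->
    (`|\int[mu]_x h x|%:E <= \int[mu]_x (normc (g x))%:E)%E.
  move=> ih hg; rewrite EFin_normr_Rintegral//.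
  apply: (le_trans (le_abse_integral mu measurableT (measurable_int _ ih))).
  apply: ge0_le_integral => //.
  - by apply: measurableT_comp => //; exact: measurable_int ih.
  - exact: measurable_int inor.
  - by move=> x _; rewrite lee_fin.
apply: (@le_trans _ _ (`|\int[mu]_x complex.Re (g x)|%:E +
                       `|\int[mu]_x complex.Im (g x)|%:E)%E).
  by rewrite -EFinD lee_fin; exact: normc_le_ReIm.
rewrite (_ : 2%:E = 1 + 1)%E// ge0_muleDl// !mul1e leeD//.
  by apply: le1 => // x; exact: Re_le_normc.
by apply: le1 => // x; exact: Im_le_normc.
Qed.

End ComplexIntegral.

(** * Integrals on the torus *)
Section ComplexFubini.
Context {R : realType} d1 d2 (T1 : measurableType d1) (T2 : measurableType d2).
Variable m1 : {sigma_finite_measure set T1 -> \bar R}.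
Variable m2 : {sigma_finite_measure set T2 -> \bar R}.

(** The inner integral is the difference of the Tonelli integrals of the positive and negative
    parts, and [fine] keeps measurability even where that difference is infinite. *)
Lemma measurable_fun_Rintegral2 (F : T1 * T2 -> R) :
  measurable_fun setT F -> measurable_fun setT (fun x => \int[m2]_y F (x, y)).
Proof.
move=> mF; have mF' : measurable_fun setT (EFin \o F) by exact/measurable_EFinP.
apply: (@measurableT_comp _ _ _ _ _ _ (@fine R)) => //.
have -> : (fun x => \int[m2]_y (F (x, y))%:E)%E =
    (fubini_F m2 (EFin \o F)^\+ \- fubini_F m2 (EFin \o F)^\-)%E.
  apply/funext => x; rewrite integralE /fubini_F.
  by rewrite (funepos_comp (EFin \o F) (pair x)) (funeneg_comp (EFin \o F) (pair x)).
apply: emeasurable_funB.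
  apply: measurable_fun_fubini_tonelli_F => //; exact: measurable_funepos.
apply: measurable_fun_fubini_tonelli_F => //; exact: measurable_funeneg.
Qed.

Lemma cmeasurable_cintegral2 (F : T1 * T2 -> R[i]) : cmeasurable F ->
  cmeasurable (fun x => cintegral m2 (fun y => F (x, y))).
Proof.
move=> [F1 F2]; split => /=.
  exact: (measurable_fun_Rintegral2 F1).
exact: (measurable_fun_Rintegral2 F2).
Qed.

Lemma Rintegral_Fubini (F : T1 * T2 -> R) :
  (m1 \x m2)%E.-integrable setT (EFin \o F) ->
  \int[m1]_x (\int[m2]_y F (x, y)) = \int[(m1 \x m2)%E]_z F z.
Proof.
move=> iF; rewrite /Rintegral; congr fine.
rewrite -(integral12_prod_meas1 iF).
(* The real inner integral, cut by [fine], agrees with the extended one where the section is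
   integrable, that is for almost every x. *)
apply: ae_eq_integral => //.
- apply/measurable_EFinP; apply: (@measurable_fun_Rintegral2 F).
  by apply/measurable_EFinP; exact: measurable_int iF.
- exact: measurable_fubini_F iF.
- apply: filterS (ae_integrable1 iF) => x ix _ /=.
  by rewrite fineK//; exact: integrable_fin_num ix.
Qed.

Lemma cintegral_Fubini (F : T1 * T2 -> R[i]) : cintegrable (m1 \x m2)%E F ->
  cintegral m1 (fun x => cintegral m2 (fun y => F (x, y))) =
  cintegral (m1 \x m2)%E F.
Proof.
move=> [F1 F2]; apply: complex_ext; rewrite /cintegral/=.
  exact: (Rintegral_Fubini F1).
exact: (Rintegral_Fubini F2).
Qed.

End ComplexFubini.

(** * Change of variables: from nonnegative to complex integrands *)

Section MeasureTransport.
Context {R : realType} d1 d2 (T1 : measurableType d1) (T2 : measurableType d2).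
Variables (m1 : {measure set T1 -> \bar R}) (m2 : {measure set T2 -> \bar R}).
Variable psi : T1 -> T2.
Hypothesis mpsi : measurable_fun setT psi.
Hypothesis m12 : forall F : T2 -> \bar R, measurable_fun setT F ->
  (forall x, 0 <= F x)%E -> (\int[m1]_x F (psi x) = \int[m2]_y F y)%E.

Lemma integral_transport (F : T2 -> \bar R) : measurable_fun setT F ->
  (\int[m1]_x F (psi x) = \int[m2]_y F y)%E.
Proof.
move=> mF; rewrite integralE [RHS]integralE; congr (_ - _)%E.
  rewrite -(m12 (measurable_funepos mF)) => [|x]; first by rewrite (funepos_comp F psi).
  exact: funepos_ge0.
rewrite -(m12 (measurable_funeneg mF)) => [|x]; first by rewrite (funeneg_comp F psi).
exact: funeneg_ge0.
Qed.

Lemma cintegrable_transport (F : T2 -> R[i]) : cintegrable m2 F ->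
  cintegrable m1 (fun x => F (psi x)).
Proof.
move=> /cintegrableP[mF Foo]; apply/cintegrableP; split.
  exact: cmeasurable_comp mF mpsi.
rewrite (m12 (F := fun y => (Normc.normc (F y))%:E))//.
  exact: emeasurable_normc.
by move=> x; rewrite lee_fin normc_ge0.
Qed.

Lemma cintegral_transport (F : T2 -> R[i]) : cmeasurable F ->
  cintegral m1 (fun x => F (psi x)) = cintegral m2 F.
Proof.
move=> [F1 F2]; apply: complex_ext; rewrite /cintegral/=; congr fine.
  by apply: (@integral_transport (fun y => (complex.Re (F y))%:E)); exact/measurable_EFinP.
by apply: (@integral_transport (fun y => (complex.Im (F y))%:E)); exact/measurable_EFinP.
Qed.

End MeasureTransport.

Section TorusIntegral.
Context {R : realType}.
Local Notation circle := (@uniform_prob R 0 (2 * pi) twopi_gt0).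

Lemma tnth_vset d (x : d.-tuple R) i s l :
  tnth (vset x i s) l = if l == i then s else tnth x l.
Proof. by rewrite tnth_mktuple. Qed.

Lemma tnth_vsub d (x t : d.-tuple R) l : tnth (vsub x t) l = tnth x l - tnth t l.
Proof. by rewrite tnth_mktuple. Qed.

Lemma tnth_vcons0 d (s : R) (z : d.-tuple R) : tnth (vcons (s, z)) ord0 = s.
Proof. by []. Qed.

Lemma tnth_vconsS d (s : R) (z : d.-tuple R) j :
  tnth (vcons (s, z)) (lift ord0 j) = tnth z j.
Proof. by rewrite /vcons/= tnthS. Qed.

Lemma vset_vcons0 d (a s : R) (z : d.-tuple R) :
  vset (vcons (a, z)) ord0 s = vcons (s, z).
Proof.
apply: eq_from_tnth => l; rewrite tnth_vset.
by case: (unliftP ord0 l) => [j ->|->]; rewrite ?tnth_vconsS.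
Qed.

Lemma vset_vconsS d (a s : R) (z : d.-tuple R) i :
  vset (vcons (a, z)) (lift ord0 i) s = vcons (a, vset z i s).
Proof.
apply: eq_from_tnth => l; rewrite tnth_vset.
case: (unliftP ord0 l) => [j ->|->]; last by rewrite tnth_vcons0.
by rewrite !tnth_vconsS tnth_vset (inj_eq lift_inj).
Qed.

Lemma measurable_vset d (i : 'I_d) :
  measurable_fun setT (fun st : measurableTypeR R * d.-tuple R => vset st.2 i (st.1 : R)).
Proof.
apply/measurable_fun_tnthP => l.
rewrite [X in measurable_fun _ X](_ : _ =
    fun st => if l == i then (st.1 : R) else tnth st.2 l); last first.
  by apply/funext => st /=; rewrite tnth_vset.
case: (l == i).
  exact: (@measurable_fst _ _ (measurableTypeR R) (d.-tuple R)).
apply: (@measurableT_comp _ _ _ _ _ _ (fun t : d.-tuple R => tnth t l)) => //.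
exact: measurable_tnth.
Qed.

Lemma torus_vcons d (F : d.+1.-tuple R -> \bar R) : measurable_fun setT F ->
  (forall x, 0 <= F x)%E ->
  (\int[torus d.+1]_x F x =
   \int[circle]_s \int[torus d]_z F (vcons (s, z)))%E.
Proof.
move=> mF F0; rewrite /= ge0_integral_distribution//.
rewrite (fubini_tonelli1 (m1 := circle) (m2 := torus d) (F \o @vcons _ d))//.
  by apply: measurableT_comp => //; exact: measurable_vcons.
by move=> x; exact: F0.
Qed.

(** Coordinates are independent and uniform, so resampling one of them preserves the measure. By
    induction on d: if i is the head, the overwritten head integrates to one; otherwise the two
    circle integrals are exchanged and the tail is handled by induction. *)
Lemma torus_vset d (i : 'I_d) (F : d.-tuple R -> \bar R) :
  measurable_fun setT F -> (forall x, 0 <= F x)%E ->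
  (\int[circle]_s \int[torus d]_t F (vset t i s) = \int[torus d]_t F t)%E.
Proof.
elim: d i F => [[]//|d IH] i F mF F0.
have mFv : measurable_fun setT (F \o @vcons R d).
  by apply: measurableT_comp => //; exact: measurable_vcons.
have mFs (s : R) : measurable_fun setT (fun t => F (vset t i s)).
  apply: (@measurableT_comp _ _ _ _ _ _ F) => //.
  exact: (measurableT_comp (measurable_vset i) (measurable_pair1 (s : measurableTypeR R))).
under eq_integral do rewrite torus_vcons//.
rewrite torus_vcons//; case: (unliftP ord0 i) => [j ij|i0]; last first.
  apply: eq_integral => s _.
  transitivity (\int[circle]_a \int[torus d]_z F (vcons (s : R, z)))%E.
    by apply: eq_integral => a _; apply: eq_integral => z _; rewrite i0 vset_vcons0.
  rewrite integral_cst// [X in (_ * X)%E](_ : _ = 1%E) ?mule1//.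
  exact: probability_setT.
pose G (q : measurableTypeR R * measurableTypeR R) : \bar R :=
  (\int[torus d]_z F (vcons (q.2 : R, vset z j (q.1 : R))))%E.
transitivity (\int[circle]_s \int[circle]_a G (s, a))%E.
  apply: eq_integral => s _; apply: eq_integral => a _.
  by apply: eq_integral => z _; rewrite ij vset_vconsS.
rewrite (@fubini_tonelli _ _ _ _ _ circle circle G).
- apply: eq_integral => a _; rewrite /G/=.
  rewrite (IH j (fun z => F (vcons (a, z))))//.
  exact: (measurableT_comp mFv (measurable_pair1 (a : measurableTypeR R))).
- pose H (w : (measurableTypeR R * measurableTypeR R) * d.-tuple R) :=
    F (vcons (w.1.2 : R, vset w.2 j (w.1.1 : R))).
  have mw : measurable_fun setT
      (fun w : (measurableTypeR R * measurableTypeR R) * d.-tuple R =>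
        (w.1.1, w.2)).
    by apply: measurable_fun_pair => //; apply: measurableT_comp.
  have mw' : measurable_fun setT
      (fun w : (measurableTypeR R * measurableTypeR R) * d.-tuple R =>
        (w.1.2, vset w.2 j (w.1.1 : R))).
    apply: measurable_fun_pair; first by apply: measurableT_comp.
    exact: (measurableT_comp (measurable_vset j) mw).
  apply: (@measurable_fun_fubini_tonelli_F _ _ _ _ _ (torus d) H) => //.
    exact: (measurableT_comp mFv mw').
  by move=> w; exact: F0.
- by move=> q; apply: integral_ge0.
Qed.

Lemma measurable_tuple1 :
  measurable_fun setT (fun s : measurableTypeR R => [tuple (s : R)]).
Proof.
apply/measurable_fun_tnthP => i; rewrite ord1.
exact: (@measurable_id _ (measurableTypeR R)).
Qed.

Lemma ge0_torus1 (F : 1.-tuple R -> \bar R) : measurable_fun setT F ->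
  (forall x, 0 <= F x)%E ->
  (\int[circle]_s F [tuple (s : R)] = \int[torus 1]_x F x)%E.
Proof.
move=> mF F0; rewrite -[RHS]/(integral (torus 0.+1) setT F) torus_vcons//.
apply: eq_integral => s _.
have mF1 : measurable_fun setT (fun z : 0.-tuple R => F (vcons (s, z))).
  apply: measurableT_comp => //.
  exact: (measurableT_comp (@measurable_vcons R 0) (measurable_pair1 (s : measurableTypeR R))).
rewrite integral_dirac// diracT mul1e.
by congr F; apply: eq_from_tnth => i; rewrite ord1.
Qed.

Lemma cintegral_torus1 (F : 1.-tuple R -> R[i]) : cmeasurable F ->
  cintegral circle (fun s => F [tuple (s : R)]) = cintegral (torus 1) F.
Proof. by apply: cintegral_transport => G mG G0; exact: ge0_torus1. Qed.

Lemma cintegral_vset d (i : 'I_d) (F : d.-tuple R -> R[i]) :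
  cintegrable (torus d) F ->
  cintegral circle (fun s => cintegral (torus d) (fun t => F (vset t i (s : R)))) =
  cintegral (torus d) F.
Proof.
move=> iF.
have tr (G : d.-tuple R -> \bar R) : measurable_fun setT G ->
    (forall x, 0 <= G x)%E ->
    (\int[(circle \x torus d)%E]_w G (vset w.2 i (w.1 : R)) = \int[torus d]_t G t)%E.
  move=> mG G0; rewrite -(torus_vset i mG)//.
  rewrite (fubini_tonelli1 (m1 := circle) (m2 := torus d) (fun w => G (vset w.2 i (w.1 : R))))//.
  exact: (measurableT_comp mG (measurable_vset i)).
have := cintegrable_transport (measurable_vset i) tr iF.
move=> /cintegral_Fubini/= ->.
exact: (cintegral_transport tr (cintegrable_measurable iF)).
Qed.

End TorusIntegral.

Lemma Lnorm_oo {R : realType} d (T : measurableType d) (P : probability T R)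
  (f : T -> \bar R) : Lnorm P +oo%E f = ess_sup P (abse \o f).
Proof.
rewrite unlock ifT//.
have : (0 < 1%:E :> \bar R)%E by exact: lte01.
by rewrite -(probability_setT P).
Qed.

(** * Schur test *)
Section LnormAverage.
Local Open Scope ereal_scope.
Context {R : realType} d1 d2 d3
  (X : measurableType d1) (Y : measurableType d2) (Z : measurableType d3).
Variables (m1 : probability X R) (m2 : probability Y R) (m3 : probability Z R).
Variables (k : X * Y -> R) (psi : X * Y -> Z) (A : R).
Hypotheses (mk : measurable_fun setT k) (k0 : forall w, (0 <= k w)%R).
Hypothesis mpsi : measurable_fun setT psi.
Hypothesis A0 : (0 < A)%R.
Hypothesis kA : forall x, \int[m2]_y (k (x, y))%:E <= A%:E.
Hypothesis kpsiA : forall v : Z -> \bar R, measurable_fun setT v ->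
  (forall z, 0 <= v z) ->
  \int[m1]_x \int[m2]_y ((k (x, y))%:E * v (psi (x, y))) <= A%:E * \int[m3]_z v z.

Let mkx x : measurable_fun setT (fun y => k (x, y)).
Proof. exact: (measurableT_comp mk (measurable_pair1 x)). Qed.

Let mpsix x : measurable_fun setT (fun y => psi (x, y)).
Proof. exact: (measurableT_comp mpsi (measurable_pair1 x)). Qed.

(** The map [psi] lets one statement serve twice. With [psi = snd] it is the Schur test, [kA]
    bounding the rows and [kpsiA] encoding the bound of the columns; with a constant kernel and
    [psi] overwriting one coordinate it says that averaging over the other variables is bounded on
    L^p. *)
Let average (h : Z -> R) x := \int[m2]_y (k (x, y) * h (psi (x, y)))%:E.

Let mav (h : Z -> R) : measurable_fun setT h ->
  measurable_fun setT (fun w => (k w * h (psi w))%:E).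
Proof.
move=> mh; apply/measurable_EFinP; apply: measurable_funM => //.
exact: (measurableT_comp mh).
Qed.

Let mavx (h : Z -> R) x : measurable_fun setT h ->
  measurable_fun setT (fun y => (k (x, y) * h (psi (x, y)))%:E).
Proof. by move=> mh; exact: (measurableT_comp (mav mh) (measurable_pair1 x)). Qed.

Let average_ge0 (h : Z -> R) x : (forall z, (0 <= h z)%R) -> 0 <= average h x.
Proof. by move=> h0; apply: integral_ge0 => y _; rewrite lee_fin mulr_ge0. Qed.

Let measurable_average (h : Z -> R) : measurable_fun setT h ->
  (forall z, (0 <= h z)%R) -> measurable_fun setT (average h).
Proof.
move=> mh h0.
apply: (@measurable_fun_fubini_tonelli_F _ _ _ _ _ m2
  (fun w => (k w * h (psi w))%:E)); first exact: mav.
by move=> w; rewrite lee_fin mulr_ge0.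
Qed.

(** The values of [h] above its essential supremum s form a null set, which [psi (x, _)] may still
    hit. The excess v = max(h - s, 0) has integral zero, so by [kpsiA] its average vanishes for
    almost every x, and there h <= s + v gives the bound. *)
Let average_oo (h : Z -> R) : measurable_fun setT h -> (forall z, (0 <= h z)%R) ->
  'N[m1]_+oo[average h] <= A%:E * 'N[m3]_+oo[EFin \o h].
Proof.
move=> mh h0; rewrite !Lnorm_oo.
set S := ess_sup m3 _.
have S0 : 0 <= S.
  have := Lnorm_ge0 m3 +oo (EFin \o h).
  by rewrite Lnorm_oo.
case E : S S0 => [s||//] S0; last by rewrite gt0_muley ?lte_fin// leey.
pose v z := (Num.max (h z - s) 0)%:E.
have mv : measurable_fun setT v.
  apply/measurable_EFinP; apply: measurable_maxr => //.
  by apply: measurable_funB.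
have v0 z : 0 <= v z by rewrite lee_fin le_max lexx orbT.
have hs : \forall z \ae m3, (h z <= s)%R.
  have := ess_sup_ge m3 (abse \o (EFin \o h)); rewrite -/S E.
  by apply: filterS => z /=; rewrite lee_fin ger0_norm.
have iv : \int[m3]_z v z = 0.
  rewrite (ge0_ae_eq_integral (g := cst 0))//; first exact: integral0.
  apply: filterS hs => z hz _; rewrite /v/=.
  by congr EFin; apply/max_idPr; rewrite subr_le0.
have := kpsiA mv v0; rewrite iv mule0.
have mkv : measurable_fun setT (fun w => (k w)%:E * v (psi w)).
  apply: emeasurable_funM; first exact/measurable_EFinP.
  exact: (measurableT_comp mv).
have kv0 w : 0 <= (k w)%:E * v (psi w) by rewrite mule_ge0// lee_fin.
move=> ikv; apply/ess_supP.
have /ae_eq_integral_abs : \int[m1]_x `|\int[m2]_y ((k (x, y))%:E * v (psi (x, y)))| = 0.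
  apply/eqP; rewrite eq_le; apply/andP; split; last exact: integral_ge0.
  under eq_integral do rewrite gee0_abs ?integral_ge0//.
  exact: ikv.
move=> /(_ measurableT); rewrite /ae_eq => H.
have {}H : \forall x \ae m1, \int[m2]_y ((k (x, y))%:E * v (psi (x, y))) = 0.
  apply: filterS (H _) => [x /(_ I)//|].
  exact: (@measurable_fun_fubini_tonelli_F _ _ _ _ _ m2 (fun w => (k w)%:E * v (psi w))).
apply: filterS H => x Hx /=.
rewrite gee0_abs ?average_ge0//.
apply: (@le_trans _ _ (\int[m2]_y (s%:E * (k (x, y))%:E + (k (x, y))%:E * v (psi (x, y))))).
  apply: ge0_le_integral => //.
  - by move=> y _; rewrite lee_fin mulr_ge0.
  - exact: mavx.
  - apply: emeasurable_funD; last exact: (measurableT_comp mkv (measurable_pair1 x)).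
    by apply/measurable_EFinP; apply: measurable_funM.
  - move=> y _; rewrite /v -!EFinM -EFinD lee_fin (mulrC s) -mulrDr.
    by rewrite ler_wpM2l// -lerBlDl le_max lexx.
rewrite ge0_integralD; [|by []|..].
- rewrite Hx adde0 ge0_integralZl; [|by []| | |exact: S0].
  + by rewrite muleC lee_wpmul2r.
  + by apply/measurable_EFinP; exact: mkx.
  + by move=> y _; rewrite lee_fin.
- by move=> y _; rewrite mule_ge0// lee_fin.
- by apply/measurable_EFinP; apply: measurable_funM => //; exact: mkx.
- by move=> y _; exact: kv0.
- exact: (measurableT_comp mkv (measurable_pair1 x)).
Qed.

(** Hölder's inequality for the splitting k = k^(1/q) k^(1/p): by [kA] the first factor contributes
    A^(1/q), and A^(p/q) = A^(p-1). *)
Let average_powR (h : Z -> R) (p : R) x : (1 < p)%R -> measurable_fun setT h ->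
  (forall z, (0 <= h z)%R) ->
  average h x `^ p <= (A `^ (p - 1))%:E *
    \int[m2]_y ((k (x, y))%:E * (h (psi (x, y)) `^ p)%:E).
Proof.
move=> p1 mh h0; have p0 : (0 < p)%R by rewrite (lt_trans ltr01).
pose q := (p / (p - 1))%R.
have pm1 : (0 < p - 1)%R by rewrite subr_gt0.
have q0 : (0 < q)%R by rewrite divr_gt0.
have pq : (q^-1 + p^-1 = 1)%R.
  by rewrite /q; field; rewrite !gt_eqF.
pose f1 y := (k (x, y) `^ q^-1)%R.
pose f2 y := (k (x, y) `^ p^-1 * h (psi (x, y)))%R.
have mf1 : measurable_fun setT f1.
  by apply: (measurableT_comp (measurable_powR _)).
have mf2 : measurable_fun setT f2.
  apply: measurable_funM; first by apply: (measurableT_comp (measurable_powR _)).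
  exact: (measurableT_comp mh).
have f10 y : (0 <= f1 y)%R by exact: powR_ge0.
have f20 y : (0 <= f2 y)%R by rewrite mulr_ge0 ?powR_ge0.
have E12 y : (f1 y * f2 y = k (x, y) * h (psi (x, y)))%R.
  rewrite /f1 /f2 mulrA -powRD ?pq ?powRr1//.
  by rewrite oner_eq0.
have := hoelder m2 mf1 mf2 q0 p0 pq.
rewrite Lnorm1 (_ : \int[m2]_y `|((f1 \* f2)%R y)%:E| = average h x); last first.
  by apply: eq_integral => y _ /=; rewrite E12 ger0_norm// mulr_ge0.
rewrite unlock.
rewrite (_ : \int[m2]_y (`|(EFin \o f1) y| `^ q) = \int[m2]_y (k (x, y))%:E); last first.
  apply: eq_integral => y _ /=; rewrite ger0_norm// -powRrM mulVf ?powRr1//.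
  by rewrite gt_eqF.
rewrite (_ : \int[m2]_y (`|(EFin \o f2) y| `^ p) =
    \int[m2]_y ((k (x, y))%:E * (h (psi (x, y)) `^ p)%:E)); last first.
  apply: eq_integral => y _ /=; rewrite ger0_norm// powRM ?powR_ge0//.
  by rewrite -powRrM mulVf ?powRr1 ?gt_eqF.
set I := (X in _ <= _ * X `^ _) => H.
have I0 : 0 <= I.
  by apply: integral_ge0 => y _; rewrite mule_ge0 ?lee_fin ?powR_ge0.
have av0 : 0 <= average h x by exact: average_ge0.
have {}H : average h x <= (A `^ q^-1)%:E * I `^ p^-1.
  apply: (le_trans H); rewrite lee_wpmul2r ?poweR_ge0//.
  rewrite -poweR_EFin gt0_ler_poweR ?invr_ge0 ?(ltW q0)// ?in_itv/= ?leey ?andbT//.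
    by apply: integral_ge0 => y _; rewrite lee_fin.
  by rewrite lee_fin ltW.
apply: (@le_trans _ _ (((A `^ q^-1)%:E * I `^ p^-1) `^ p)).
  rewrite gt0_ler_poweR ?(ltW p0)// ?in_itv/= ?leey ?andbT//.
  by rewrite mule_ge0 ?poweR_ge0// lee_fin powR_ge0.
rewrite poweRM ?poweR_ge0 ?lee_fin ?powR_ge0//.
rewrite -poweRrM mulVf ?gt_eqF// poweRe1// poweR_EFin -powRrM.
by rewrite /q invf_div divfK ?gt_eqF.
Qed.

Let average_fin (h : Z -> R) (p : R) : (1 <= p)%R -> measurable_fun setT h ->
  (forall z, (0 <= h z)%R) ->
  'N[m1]_p%:E[average h] <= A%:E * 'N[m3]_p%:E[EFin \o h].
Proof.
move=> p1 mh h0; have p0 : (0 < p)%R by rewrite (lt_le_trans ltr01).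
have mhp : measurable_fun setT (fun z => (h z `^ p)%:E).
  by apply/measurable_EFinP; apply: (measurableT_comp (measurable_powR _)).
have hp0 z : 0 <= (h z `^ p)%:E by rewrite lee_fin powR_ge0.
have H : \int[m1]_x (average h x `^ p) <= (A `^ p)%:E * \int[m3]_z (h z `^ p)%:E.
  apply: (@le_trans _ _ (\int[m1]_x ((A `^ (p - 1))%:E *
      \int[m2]_y ((k (x, y))%:E * (h (psi (x, y)) `^ p)%:E)))).
    have mI : measurable_fun setT
        (fun x => \int[m2]_y ((k (x, y))%:E * (h (psi (x, y)) `^ p)%:E)).
      apply: (@measurable_fun_fubini_tonelli_F _ _ _ _ _ m2
         (fun w => (k w)%:E * (h (psi w) `^ p)%:E)).
        apply: emeasurable_funM; first exact/measurable_EFinP.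
        exact: (measurableT_comp mhp).
      by move=> w; rewrite mule_ge0 ?lee_fin ?powR_ge0.
    apply: ge0_le_integral => //.
    - by move=> x _; exact: poweR_ge0.
    - apply: (measurableT_comp (measurable_poweR _)).
      exact: measurable_average.
    - by apply: emeasurable_funM.
    (* At p = 1 there is no finite conjugate exponent; the estimate is then an equality with A^0 =
       1. *)
    - move=> x _; move: p1; rewrite le_eqVlt => /predU1P[<-|p1]; last exact: average_powR.
      rewrite subrr powRr0 mul1e poweRe1 ?average_ge0//.
      by rewrite le_eqVlt; apply/orP; left; apply/eqP; apply: eq_integral => y _; rewrite powRr1.
  rewrite ge0_integralZl//.
  - rewrite -(mulr_powRB1 (ltW A0) p0) mulrC EFinM -muleA lee_wpmul2l ?lee_fin ?powR_ge0//.
    exact: kpsiA.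
  - apply: (@measurable_fun_fubini_tonelli_F _ _ _ _ _ m2
         (fun w => (k w)%:E * (h (psi w) `^ p)%:E)).
      apply: emeasurable_funM; first exact/measurable_EFinP.
      exact: (measurableT_comp mhp).
    by move=> w; rewrite mule_ge0 ?lee_fin ?powR_ge0.
  - by move=> x _; apply: integral_ge0 => y _; rewrite mule_ge0 ?lee_fin ?powR_ge0.
  - by rewrite lee_fin powR_ge0.
rewrite unlock.
have E1 : \int[m1]_x (`|average h x| `^ p) = \int[m1]_x (average h x `^ p).
  by apply: eq_integral => x _; rewrite gee0_abs ?average_ge0.
have E2 : \int[m3]_z (`|(EFin \o h) z| `^ p) = \int[m3]_z (h z `^ p)%:E.
  by apply: eq_integral => z _ /=; rewrite ger0_norm.
rewrite E1 E2.
apply: (@le_trans _ _ (((A `^ p)%:E * \int[m3]_z (h z `^ p)%:E) `^ p^-1)).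
  rewrite gt0_ler_poweR ?invr_ge0 ?(ltW p0)// ?in_itv/= ?leey ?andbT//.
    by apply: integral_ge0 => x _; exact: poweR_ge0.
  by rewrite mule_ge0 ?lee_fin ?powR_ge0// integral_ge0.
rewrite poweRM ?lee_fin ?powR_ge0//; last exact: integral_ge0.
by rewrite poweR_EFin -powRrM mulfV ?powRr1 ?gt_eqF// ltW.
Qed.

Lemma Lnorm_average (p : \bar R) (h : Z -> R) : 1 <= p ->
  measurable_fun setT h -> (forall z, (0 <= h z)%R) ->
  Lnorm m1 p (fun x => \int[m2]_y (k (x, y) * h (psi (x, y)))%:E) <=
  A%:E * Lnorm m3 p (EFin \o h).
Proof.
case: p => [p|_|//]; last exact: average_oo.
by rewrite lee_fin => p1; exact: average_fin.
Qed.

End LnormAverage.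

(** * Trigonometric sums and aliasing *)
Section SymmetricSums.
Implicit Types n m L : nat.

(** The index shift is that of [freq], so that a cubic partial sum in d variables becomes a product
    of such sums. *)
Definition symsum (V : nmodType) n (F : int -> V) : V :=
  \sum_(k < n.*2.+1) F (k%:Z - n%:Z).

Lemma symsum0 (V : nmodType) (F : int -> V) : symsum 0 F = F 0.
Proof. by rewrite /symsum big_ord1. Qed.

Lemma symsumS (V : nmodType) n (F : int -> V) :
  symsum n.+1 F = symsum n F + (F n.+1%:Z + F (- n.+1%:Z)).
Proof.
rewrite /symsum doubleS big_ord_recr big_ord_recl/= sub0r.
have -> : (n.*2.+2%:Z - n.+1%:Z = n.+1%:Z)%R by lia.
rewrite addrAC addrC; congr (_ + _); last by rewrite addrC.
by apply: eq_bigr => i _; congr F; rewrite /bump/=; lia.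
Qed.

Lemma eq_symsum (V : nmodType) n (F G : int -> V) :
  (forall j, (`|j| <= n)%N -> F j = G j) -> symsum n F = symsum n G.
Proof. by move=> FG; apply: eq_bigr => k _; apply: FG; have := ltn_ord k; lia. Qed.

Lemma symsumD (V : nmodType) n (F G : int -> V) :
  symsum n (fun j => F j + G j) = symsum n F + symsum n G.
Proof. exact: big_split. Qed.

Lemma symsumB (V : zmodType) n (F G : int -> V) :
  symsum n (fun j => F j - G j) = symsum n F - symsum n G.
Proof. by rewrite /symsum sumrB. Qed.

Lemma symsumZ (V : pzRingType) n (c : V) (F : int -> V) :
  symsum n (fun j => c * F j) = c * symsum n F.
Proof. by rewrite /symsum mulr_sumr. Qed.

Lemma symsum_le (R : numDomainType) n (F G : int -> R) :
  (forall j, (`|j| <= n)%N -> F j <= G j) -> symsum n F <= symsum n G.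
Proof. by move=> FG; apply: ler_sum => k _; apply: FG; have := ltn_ord k; lia. Qed.

Lemma symsum_cst (R : pzSemiRingType) n (c : R) :
  symsum n (fun=> c) = (2 * n + 1)%N%:R * c.
Proof. by rewrite /symsum sumr_const card_ord mulr_natl mul2n addn1. Qed.

Lemma symsum_split0 (V : nmodType) n (F : int -> V) :
  symsum n F = F 0 + \sum_(l < n) (F l.+1%:Z + F (- l.+1%:Z)).
Proof.
elim: n => [|n IH]; first by rewrite symsum0 big_ord0 addr0.
by rewrite symsumS IH big_ord_recr/= !addrA.
Qed.

Lemma symsum_vanish (V : nmodType) m n (F : int -> V) : (m <= n)%N ->
  (forall j, (m < `|j|)%N -> F j = 0) -> symsum n F = symsum m F.
Proof.
move=> mn F0; elim: n mn => [|n IH]; first by rewrite leqn0 => /eqP ->.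
rewrite leq_eqVlt => /predU1P[->//|mn].
by rewrite symsumS IH// !F0 ?addr0//; lia.
Qed.

Lemma symsum_shiftr (V : comNzRingType) n (F : int -> V) :
  symsum n (fun j => F (j + 1)) = symsum n F + (F n.+1%:Z - F (- n%:Z)).
Proof.
elim: n => [|n IH]; first by rewrite !symsum0 oppr0 add0r addrC subrK.
rewrite !symsumS IH.
have -> : (n.+1%:Z + 1 = n.+2%:Z)%R by lia.
have -> : (- n.+1%:Z + 1 = - n%:Z)%R by lia.
by ring.
Qed.

Lemma symsum_shiftl (V : comNzRingType) n (F : int -> V) :
  symsum n (fun j => F (j - 1)) = symsum n F + (F (- n.+1%:Z) - F n%:Z).
Proof.
elim: n => [|n IH]; first by rewrite !symsum0 addrC subrK.
rewrite !symsumS IH.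
have -> : (n.+1%:Z - 1 = n%:Z)%R by lia.
have -> : (- n.+1%:Z - 1 = - n.+2%:Z)%R by lia.
by ring.
Qed.

Lemma sum_nat_blocks (V : nmodType) a N (f : nat -> V) :
  \sum_(0 <= k < a * N) f k = \sum_(0 <= l < a) \sum_(0 <= j < N) f (l * N + j)%N.
Proof.
elim: a => [|a IH]; first by rewrite mul0n !big_geq.
rewrite big_nat_recr//= -IH mulSn addnC (@big_cat_nat _ _ _ (a * N)%N)//= ?leq_addr//.
by congr (_ + _); rewrite -{1}(add0n (a * N)%N) big_addn addKn; under eq_bigr do rewrite addnC.
Qed.

(** Translates of the window from -m to m by multiples of 2m+1 tile the range exactly; this dictates
    the truncation at L(2m+1)+m wherever aliasing is used. *)
Lemma symsum_blocks (V : nmodType) L m (F : int -> V) :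
  symsum (L * (2 * m + 1) + m) F =
  symsum L (fun l => symsum m (fun j => F (l * (2 * m + 1)%N%:Z + j))).
Proof.
rewrite /symsum.
have -> : ((L * (2 * m + 1) + m).*2.+1 = L.*2.+1 * m.*2.+1)%N by lia.
rewrite -(big_mkord xpredT (fun k => F (k%:Z - (L * (2 * m + 1) + m)%N%:Z))).
rewrite sum_nat_blocks big_mkord; apply: eq_bigr => l _.
by rewrite big_mkord; apply: eq_bigr => j _; congr F; lia.
Qed.

End SymmetricSums.

Section FourierSums.
Context {R : realType}.
Local Notation normc := (@Normc.normc R).
Implicit Types (a : int -> R) (y : R) (n m L : nat).

Lemma normc_symsum n (F : int -> R[i]) :
  normc (symsum n F) <= symsum n (fun j => normc (F j)).
Proof. exact: normc_sum. Qed.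

Definition fsum n a y : R[i] := symsum n (fun j => (a j)%:C * cexp (j%:~R * y)).

Definition diff2 a (j : int) : R := a (j + 1) + a (j - 1) - 2 * a j.

Lemma normc_coef_cexp (c t : R) : normc (c%:C * cexp t) = `|c|.
Proof. by rewrite Normc.normcM normc_cexp mulr1 normcR. Qed.

Lemma fsum_norm_le n a y : normc (fsum n a y) <= symsum n (fun j => `|a j|).
Proof.
apply: (le_trans (normc_symsum _ _)); apply: symsum_le => j _.
by rewrite normc_coef_cexp.
Qed.

(* Summation by parts, twice. *)
Lemma fsum_diff2 n a y :
  (2 - 2 * cos y)%:C * fsum n a y =
  - fsum n (diff2 a) y
  + cexp (- y) * ((a n.+1%:Z)%:C * cexp (n.+1%:R * y) - (a (- n%:Z))%:C * cexp (- n%:R * y))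
  + cexp y * ((a (- n.+1%:Z))%:C * cexp (- n.+1%:R * y) - (a n%:Z)%:C * cexp (n%:R * y)).
Proof.
pose G j := (a j)%:C * cexp (j%:~R * y).
have H1 := symsum_shiftr n G; have H2 := symsum_shiftl n G.
have e : (2 - 2 * cos y)%:C = 2 - cexp (- y) - cexp y.
  by apply: complex_ext; rewrite /= ?cosN ?sinN; ring.
have -> : fsum n (diff2 a) y =
    cexp (- y) * symsum n (fun j => G (j + 1)) +
    cexp y * symsum n (fun j => G (j - 1)) - 2 * symsum n G.
  rewrite -!symsumZ -symsumD -symsumB; apply: eq_symsum => j _; rewrite /G /diff2.
  have -> : cexp (- y) * ((a (j + 1))%:C * cexp ((j + 1)%:~R * y)) =
      (a (j + 1))%:C * cexp (j%:~R * y).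
    by rewrite mulrCA -cexpD rmorphD/=; congr (_ * cexp _); ring.
  have -> : cexp y * ((a (j - 1))%:C * cexp ((j - 1)%:~R * y)) =
      (a (j - 1))%:C * cexp (j%:~R * y).
    by rewrite mulrCA -cexpD rmorphB/=; congr (_ * cexp _); ring.
  by rewrite rmorphB rmorphD rmorphM/= rmorph_nat; ring.
rewrite H1 H2 e /fsum -/G.
have -> : G n.+1%:Z = (a n.+1%:Z)%:C * cexp (n.+1%:R * y) by [].
have -> : G n%:Z = (a n%:Z)%:C * cexp (n%:R * y) by [].
have -> : G (- n%:Z) = (a (- n%:Z))%:C * cexp (- n%:R * y) by rewrite /G rmorphN.
have -> : G (- n.+1%:Z) = (a (- n.+1%:Z))%:C * cexp (- n.+1%:R * y) by rewrite /G rmorphN.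
by ring.
Qed.

Lemma normc_fsum_diff2 n a y :
  (2 - 2 * cos y) * normc (fsum n a y) <=
  symsum n (fun j => `|diff2 a j|) +
  (`|a n.+1%:Z| + `|a (- n%:Z)| + (`|a (- n.+1%:Z)| + `|a n%:Z|)).
Proof.
have c0 : 0 <= 2 - 2 * cos y by have := cos_le1 y; lra.
have -> : (2 - 2 * cos y) * normc (fsum n a y) = normc ((2 - 2 * cos y)%:C * fsum n a y).
  by rewrite Normc.normcM normcR ger0_norm.
rewrite fsum_diff2 -addrA (le_trans (normcD _ _))// lerD//.
  by rewrite normcNE fsum_norm_le.
rewrite (le_trans (normcD _ _))// lerD// Normc.normcM normc_cexp mul1r.
  by rewrite (le_trans (normcB _ _))// !normc_coef_cexp.
by rewrite (le_trans (normcB _ _))// !normc_coef_cexp.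
Qed.

(* [(2 * m + 1) / poisson_den m y] is the Poisson kernel of radius
   [m / (m + 1)]. *)
Definition poisson_den m y : R := 1 + m%:R * m.+1%:R * (2 - 2 * cos y).

Lemma poisson_den_ge1 m y : 1 <= poisson_den m y.
Proof.
rewrite lerDl mulr_ge0 ?mulr_ge0//; have := cos_le1 y; lra.
Qed.

(** The weight is 1 plus m(m+1) times 2 - 2 cos y: the 1 is paid by the trivial bound, the rest by
    the bound after two summations by parts. *)
Lemma fsum_poisson_den m n a y (s t : R) :
  symsum n (fun j => `|a j|) <= s ->
  symsum n (fun j => `|diff2 a j|) +
  (`|a n.+1%:Z| + `|a (- n%:Z)| + (`|a (- n.+1%:Z)| + `|a n%:Z|)) <= t ->
  poisson_den m y * normc (fsum n a y) <= s + m%:R * m.+1%:R * t.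
Proof.
move=> sa ta; rewrite mulrDl mul1r lerD//.
  exact: le_trans (fsum_norm_le _ _ _) sa.
rewrite -[leLHS]mulrA ler_wpM2l ?mulr_ge0//.
exact: le_trans (normc_fsum_diff2 _ _ _) ta.
Qed.

Lemma cexp_mulrn (t : R) k : cexp (t *+ k) = cexp t ^+ k.
Proof. by elim: k => [|k IH]; rewrite ?mulr0n ?cexp0// mulrS exprS cexpD IH. Qed.

Lemma cexp_neq1 (t : R) : t != 0 -> `|t| < 2 * pi -> cexp t != 1.
Proof.
move=> t0 t2; apply/eqP => /(congr1 (@complex.Re R))/= ct.
have : sin (`|t| / 2) = 0.
  apply/eqP; rewrite -sqrf_eq0 -(eqr_pMn2r (n := 2))// mul0rn.
  have : cos `|t| = 1 by case: (ler0P t) => _; rewrite ?cosN.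
  rewrite {1}(splitr `|t|) cosD -!expr2 cos2sin2 => /eqP.
  by rewrite -(subr_eq0 _ 1) => /eqP H; apply/eqP; lra.
by apply/eqP; rewrite gt_eqF// sin_gt0_pi// ?divr_gt0 ?normr_gt0//; lra.
Qed.

(** A geometric sum of powers of a (2m+1)-th root of unity; [|q| <= 2m] excludes nonzero multiples
    of 2m+1, so the root differs from 1 unless q = 0. *)
Lemma sum_cexp_nodes m (q : int) : (`|q| <= 2 * m)%N ->
  \sum_(0 <= k < (2 * m).+1) cexp (q%:~R * node m k) =
  if q == 0 then (2 * m + 1)%N%:R else 0 :> R[i].
Proof.
move=> qm; have [->|q0] := eqVneq q 0.
  under eq_bigr do rewrite mul0r cexp0.
  by rewrite sumr_const_nat subn0 addn1.
pose w : R[i] := cexp (q%:~R * (2 * pi) / (2 * m + 1)%N%:R).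
have wk k : cexp (q%:~R * node m k) = w ^+ k :> R[i].
  by rewrite -cexp_mulrn -mulr_natr /node; congr cexp; ring.
have N0 : (2 * m + 1)%N%:R != 0 :> R by rewrite pnatr_eq0 addn1.
have wN : w ^+ (2 * m).+1 = 1.
  rewrite -[(2 * m).+1]addn1 /w -cexp_mulrn -[_ *+ (2 * m + 1)]mulr_natr divfK//.
  by rewrite mulrC cexp_twopi_int.
have w1 : w != 1.
  apply: cexp_neq1; first by rewrite mulf_neq0 ?invr_neq0// mulf_neq0 ?intr_eq0// lt0r_neq0 ?twopi_gt0.
  rewrite !normrM normfV (ger0_norm (ler0n R (2 * m + 1))) ltr_pdivrMr ?ltr0n ?addn1//.
  rewrite -normrM [ltLHS]mulrC (@ger0_norm _ (2 * pi)) ?mulr_ge0 ?pi_ge0//.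
  rewrite ltr_pM2l ?mulr_gt0 ?pi_gt0// -intr_norm.
  by rewrite -[ltRHS]/((2 * m).+1%:Z%:~R) ltr_int; lia.
under eq_bigr do rewrite wk.
apply: (@mulfI _ (w - 1)); first by rewrite subr_eq0.
by rewrite mulr0 big_mkord -subrX1 wN subrr.
Qed.

Lemma cexp_node_period m (l : int) k :
  cexp (l%:~R * (2 * m + 1)%N%:R * node m k) = 1 :> R[i].
Proof.
rewrite /node.
have N0 : (2 * m + 1)%N%:R != 0 :> R by rewrite pnatr_eq0 addn1.
rewrite -[RHS](cexp_twopi_int (l * k%:Z)); congr cexp.
by rewrite rmorphM/=; field.
Qed.

(** With P the full series of the mask this is the kernel of [Qop]. P is left free so that aliasing
    is done on finite sums and the limit taken afterwards. *)
Definition quad_kernel (a : int -> R) m (P : R -> R[i]) (x t : R) : R[i] :=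
  (2 * m + 1)%N%:R^-1 *
  \sum_(0 <= k < (2 * m).+1) fsum m a (node m k - t) * P (x - node m k).

(* The quadrature at [2 m + 1] nodes only sees frequencies modulo [2 m + 1]. *)
Lemma quad_kernel_aliasing (a b : int -> R) m L (x t : R) :
  quad_kernel a m (fsum (L * (2 * m + 1) + m) b) x t =
  symsum L (fun l => cexp (l%:~R * (2 * m + 1)%N%:R * x) *
    fsum m (fun j => a j * b (l * (2 * m + 1)%N%:Z + j)) (x - t)).
Proof.
set N := (2 * m + 1)%N.
have N0 : N%:R != 0 :> R[i] by rewrite pnatr_eq0 /N addn1.
rewrite /quad_kernel.
have E k : fsum m a (node m k - t) * fsum (L * N + m) b (x - node m k) =
    symsum L (fun l => symsum m (fun i => symsum m (fun j =>
      (a j * b (l * N%:Z + i))%:C * cexp ((l * N%:Z + i)%:~R * x - j%:~R * t) *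
       cexp ((j - i)%:~R * node m k)))).
  rewrite {2}/fsum symsum_blocks -symsumZ; apply: eq_symsum => l _.
  rewrite -symsumZ; apply: eq_symsum => i _.
  rewrite mulrC -symsumZ; apply: eq_symsum => j _.
  rewrite mulrACA -rmorphM/= [b _ * a _]mulrC -!mulrA; congr (_ * _).
  (* The part of the frequency that is a multiple of 2m+1 contributes 1 at every node, so only the
     difference j - i is seen there. *)
  rewrite -!cexpD -[LHS]mulr1 -(cexp_node_period m l k) -cexpD.
  by congr cexp; rewrite -/N; ring.
under eq_bigr do rewrite E.
rewrite /symsum exchange_big mulr_sumr; apply: eq_bigr => l _.
rewrite exchange_big !mulr_sumr; apply: eq_bigr => i _.
(* Discrete orthogonality over the nodes keeps only the term j = i. *)
rewrite exchange_big/= (bigD1 i)//=.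
rewrite -mulr_sumr sum_cexp_nodes; last by have := ltn_ord i; lia.
rewrite subrr eqxx mulrDr (mulrC N%:R^-1) mulrK ?unitfE//.
rewrite big1 ?mulr0 ?addr0 => [|j ji].
  rewrite mulrCA -cexpD; congr (_ * cexp _).
  by ring.
rewrite -mulr_sumr sum_cexp_nodes; last by have := ltn_ord i; have := ltn_ord j; lia.
rewrite ifF ?mulr0//; apply/negbTE; apply: contra ji => /eqP H.
by apply/eqP/val_inj => /=; lia.
Qed.

(** The block l = 0 of the aliasing formula is the series weighted by the cut-off; subtracting it
    from the full sum leaves the high frequencies 1 - a, and the other blocks are the aliases. *)
Lemma quad_kernel_error (a b : int -> R) m L (x t : R) :
  (forall j, (m < `|j|)%N -> a j = 0) ->
  fsum (L * (2 * m + 1) + m) b (x - t) -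
    quad_kernel a m (fsum (L * (2 * m + 1) + m) b) x t =
  fsum (L * (2 * m + 1) + m) (fun j => (1 - a j) * b j) (x - t) -
  \sum_(l < L)
    (cexp (l.+1%:R * (2 * m + 1)%N%:R * x) *
      fsum m (fun j => a j * b (l.+1%:Z * (2 * m + 1)%N%:Z + j)) (x - t) +
     cexp (- l.+1%:R * (2 * m + 1)%N%:R * x) *
      fsum m (fun j => a j * b (- l.+1%:Z * (2 * m + 1)%N%:Z + j)) (x - t)).
Proof.
move=> a0; rewrite quad_kernel_aliasing symsum_split0.
have -> : cexp (0%:~R * (2 * m + 1)%N%:R * x) = 1 by rewrite !mul0r cexp0.
rewrite mul1r opprD addrA; congr (_ + - _).
have -> : fsum m (fun j => a j * b (0 * (2 * m + 1)%N%:Z + j)) (x - t) =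
    fsum (L * (2 * m + 1) + m) (fun j => a j * b j) (x - t).
  rewrite [RHS](@symsum_vanish _ m) ?leq_addl// => [|j /a0 ->].
    by apply: eq_symsum => j _; rewrite mul0r add0r.
  by rewrite !mul0r.
rewrite -symsumB; apply: eq_symsum => j _.
by rewrite -mulrBl -rmorphB/=; congr (_%:C * _); ring.
Qed.

End FourierSums.

(** * Two derivatives and first and second differences *)

Section SecondDerivatives.
Context {R : realType}.
Implicit Types (f g : R -> R) (t : R).

(** [f1] is a function, but it is tied to the derivative of [f] only at the point t. The product and
    chain rules thus compose pointwise, without tracking neighbourhoods on which the formulas
    hold. *)
Definition derive2 f f1 (d2 t : R) := is_derive t 1 f (f1 t) /\ is_derive t 1 f1 d2.

Lemma is_derive1_chain f g t (a b : R) :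
  is_derive (g t) 1 f a -> is_derive t 1 g b -> is_derive t 1 (f \o g) (a * b).
Proof.
move=> [df fa] [dg gb]; split.
  move/derivable1_diffP : dg => dg; move/derivable1_diffP : df => df.
  by apply/derivable1_diffP; exact: differentiable_comp dg df.
by rewrite -derive1E derive1_comp// !derive1E fa gb.
Qed.

Lemma derive2M f f1 g g1 (f2 g2 t : R) : derive2 f f1 f2 t -> derive2 g g1 g2 t ->
  derive2 (fun s => f s * g s) (fun s => f1 s * g s + f s * g1 s)
    (f2 * g t + 2 * (f1 t * g1 t) + f t * g2) t.
Proof.
move=> [fd f1d] [gd g1d]; split.
  by apply: is_derive_eq (is_deriveM fd gd) _; rewrite /GRing.scale/=; ring.
have := is_deriveD (is_deriveM f1d gd) (is_deriveM fd g1d).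
by move=> /is_derive_eq; apply; rewrite /GRing.scale/=; ring.
Qed.

Lemma derive2_comp f f1 g g1 (f2 g2 t : R) : derive2 f f1 f2 (g t) -> derive2 g g1 g2 t ->
  derive2 (fun s => f (g s)) (fun s => f1 (g s) * g1 s)
    (f2 * g1 t ^+ 2 + f1 (g t) * g2) t.
Proof.
move=> [fd f1d] [gd g1d]; split; first exact: is_derive1_chain fd gd.
have := is_deriveM (is_derive1_chain f1d gd) g1d.
by move=> /is_derive_eq; apply; rewrite /GRing.scale/=; ring.
Qed.

Lemma derive2_powR (a t : R) : 0 < t ->
  derive2 (fun s => s `^ a) (fun s => a * s `^ (a - 1)) (a * ((a - 1) * t `^ (a - 1 - 1))) t.
Proof.
move=> t0; split; first exact: is_derive1_powR.
by apply: is_derive_eq (is_deriveZ a (is_derive1_powR (a - 1) t0)) _.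
Qed.

Lemma derive2_ln t : 0 < t -> derive2 (@ln R) (fun s => s^-1) (- (t ^+ 2)^-1) t.
Proof.
move=> t0; split; first exact: is_derive1_ln.
have := is_deriveV (lt0r_neq0 t0) (is_derive_id t 1).
by move=> /is_derive_eq; apply; rewrite /GRing.scale/= mulr1.
Qed.

Lemma derive2_affine (a b t : R) : derive2 (fun s => s * a + b) (fun=> a) 0 t.
Proof.
split; last exact: is_derive_cst.
have := is_deriveD (is_deriveM (is_derive_id t 1) (is_derive_cst a t 1)) (is_derive_cst b t 1).
by move=> /is_derive_eq; apply; rewrite /GRing.scale/=; ring.
Qed.

Lemma is_derive_continuous f (d t : R) : is_derive t 1 f d -> {for t, continuous f}.
Proof.
by move=> [fd _]; apply: differentiable_continuous; exact/derivable1_diffP.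
Qed.

Lemma MVT_is_derive f f1 (a b : R) : a < b ->
  (forall t, a <= t <= b -> is_derive t 1 f (f1 t)) ->
  exists2 c, a <= c <= b & f b - f a = f1 c * (b - a).
Proof.
move=> ab fd; have [||c cab ->] := @MVT _ f f1 a b ab.
- by move=> t tab; apply: fd; rewrite !ltW ?(itvP tab).
- apply: derivable_within_continuous => t; rewrite in_itv/= => tab.
  by have [] := fd _ tab.
by exists c => //; rewrite !ltW ?(itvP cab).
Qed.

Lemma differences_le f f1 f2 (a B1 B2 : R) :
  (forall t, a - 1 <= t <= a + 1 -> derive2 f f1 (f2 t) t) ->
  (forall t, a - 1 <= t <= a + 1 -> `|f1 t| <= B1) ->
  (forall t, a - 1 <= t <= a + 1 -> `|f2 t| <= B2) ->
  [/\ `|f (a + 1) - f a| <= B1, `|f (a - 1) - f a| <= B1 &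
      `|f (a + 1) + f (a - 1) - 2 * f a| <= B2].
Proof.
move=> fd fB1 fB2; split.
- have [||c cab ->] := @MVT_is_derive f f1 a (a + 1); first by lra.
    by move=> t tab; have [] := fd t; first by lra.
  by rewrite addrAC subrr add0r mulr1; apply: fB1; lra.
- have [||c cab E] := @MVT_is_derive f f1 (a - 1) a; first by lra.
    by move=> t tab; have [] := fd t; first by lra.
  by rewrite distrC E opprB addrC subrK mulr1; apply: fB1; lra.
(* The second difference is the increment of f(t+1) - f(t) from a - 1 to a, so the mean value
   theorem applies twice; c and c + 1 stay in [a - 1, a + 1]. *)
have [||c cab E] := @MVT_is_derive (fun t => f (t + 1) - f t)
    (fun t => f1 (t + 1) - f1 t) (a - 1) a; first by lra.
  move=> t tab; have [fd1 _] := fd t ltac:(lra).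
  have [fd2 _] := fd (t + 1) ltac:(lra).
  have sh : is_derive t 1 (fun s : R => s + 1) 1.
    have := is_deriveD (is_derive_id t 1) (is_derive_cst (1 : R) t 1).
    by move=> /is_derive_eq; apply; rewrite addr0.
  have := is_deriveB (is_derive1_chain (g := fun s : R => s + 1) fd2 sh) fd1.
  by move=> /is_derive_eq; apply; rewrite mulr1.
have -> : f (a + 1) + f (a - 1) - 2 * f a = f1 (c + 1) - f1 c.
  move: E; rewrite (_ : a - (a - 1) = 1) ?mulr1; last by ring.
  by rewrite subrK => <-; ring.
have [||e eab ->] := @MVT_is_derive f1 f2 c (c + 1); first by lra.
  by move=> t tab; have [] := fd t; first by lra.
by rewrite addrAC subrr add0r mulr1; apply: fB2; lra.
Qed.

End SecondDerivatives.

(** * Differences of masks and cut-offs *)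
Section Symbols.
Context {R : realType}.
Implicit Types (W f g : R -> R) (t : R).

(* Functions of the order of [W] whose derivatives gain a factor [1 / t]. *)
Definition symbol (T0 : R) W f := exists f1 f2 : R -> R, exists C : R,
  forall t, T0 <= t -> [/\ derive2 f f1 (f2 t) t, `|f t| <= C * W t,
    `|f1 t| <= C * W t / t & `|f2 t| <= C * W t / t ^+ 2].

Lemma symbolM (T0 : R) W W' f g : 0 < T0 -> symbol T0 W f -> symbol T0 W' g ->
  symbol T0 (fun t => W t * W' t) (fun t => f t * g t).
Proof.
move=> T00 [f1 [f2 [C Cf]]] [g1 [g2 [D Dg]]].
exists (fun t => f1 t * g t + f t * g1 t).
exists (fun t => f2 t * g t + 2 * (f1 t * g1 t) + f t * g2 t).
(* The Leibniz rule for the second derivative has total weight 1 + 2 + 1 = 4. *)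
exists (4 * C * D) => t tT; have t0 : 0 < t by exact: lt_le_trans tT.
have [df fC f1C f2C] := Cf t tT; have [dg gD g1D g2D] := Dg t tT.
have CW := le_trans (normr_ge0 _) fC; have DW := le_trans (normr_ge0 _) gD.
pose X := C * W t; pose Y := D * W' t; pose i := t^-1.
have i0 : 0 < i by rewrite invr_gt0.
have XY0 : 0 <= X * Y by exact: mulr_ge0.
have XYi0 : 0 <= X * Y * i by rewrite mulr_ge0// ltW.
have XYii0 : 0 <= X * Y * i ^+ 2 by rewrite mulr_ge0// exprn_ge0// ltW.
have prod (u v x y z : R) : `|u| <= x -> `|v| <= y -> x * y = z -> `|u * v| <= z.
  by move=> ux vy <-; rewrite normrM ler_pM.
have E : 4 * C * D * (W t * W' t) = 4 * (X * Y) by rewrite /X /Y; ring.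
split; first exact: derive2M.
- by rewrite E; have := prod _ _ _ _ _ fC gD erefl; rewrite -/X -/Y; lra.
- rewrite E -/i; apply: (le_trans (ler_normD _ _)).
  have := prod _ _ _ _ (X * Y * i) f1C gD; rewrite -/X -/Y -/i => /(_ ltac:(ring)).
  have := prod _ _ _ _ (X * Y * i) fC g1D; rewrite -/X -/Y -/i => /(_ ltac:(ring)).
  by rewrite -mulrA; lra.
- rewrite E -exprVn -/i; apply: (le_trans (ler_normD _ _)).
  have := ler_normD (f2 t * g t) (2 * (f1 t * g1 t)).
  rewrite (normrM 2) (ger0_norm (ler0n _ 2)).
  rewrite -exprVn -/i in f2C g2D.
  have := prod _ _ _ _ (X * Y * i ^+ 2) f1C g1D; rewrite -/X -/Y -/i => /(_ ltac:(ring)).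
  have := prod _ _ _ _ (X * Y * i ^+ 2) f2C gD; rewrite -/X -/Y -/i => /(_ ltac:(ring)).
  have := prod _ _ _ _ (X * Y * i ^+ 2) fC g2D; rewrite -/X -/Y -/i => /(_ ltac:(ring)).
  by rewrite -mulrA; lra.
Qed.

Lemma symbol_powR (T0 r : R) : 0 < T0 -> 0 <= r ->
  symbol T0 (fun t => t `^ (- r)) (fun t => t `^ (- r)).
Proof.
move=> T00 r0; exists (fun t => - r * t `^ (- r - 1)).
exists (fun t => - r * ((- r - 1) * t `^ (- r - 1 - 1))).
(* Dominates 1, r and r(r+1), the factors produced by zero, one and two derivatives. *)
exists (1 + r * (r + 1)) => t tT; have t0 : 0 < t by exact: lt_le_trans tT.
have tn : t != 0 by rewrite gt_eqF.
have P1 : t `^ (- r - 1) = t `^ (- r) / t.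
  by rewrite powRD ?tn ?implybT// powR_inv1// ltW.
have P2 : t `^ (- r - 1 - 1) = t `^ (- r) / t ^+ 2.
  by rewrite powRD ?tn ?implybT// P1 powR_inv1 ?ltW// -mulrA -invfM.
have w0 := powR_ge0 t (- r).
have rr0 : 0 <= r * r by exact: mulr_ge0.
split; first exact: derive2_powR.
- by rewrite ger0_norm// ler_peMl// lerDl; lra.
- rewrite P1 normrM normrN (ger0_norm r0) ger0_norm ?divr_ge0 ?(ltW t0)// mulrA.
  by rewrite ler_wpM2r ?invr_ge0 ?(ltW t0)// ler_wpM2r//; lra.
- rewrite P2 !normrM normrN (ger0_norm r0) ler0_norm; last by lra.
  rewrite normfV (ger0_norm w0) normrX (ger0_norm (ltW t0)) !mulrA.
  by rewrite ler_wpM2r ?invr_ge0 ?exprn_ge0 ?(ltW t0)// ler_wpM2r//; lra.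
Qed.

Lemma expR1_gt1 : 1 < expR (1 : R).
Proof. by rewrite -expR0 ltr_expR. Qed.

Lemma ln_ge1 t : expR 1 <= t -> 1 <= ln t.
Proof. by move=> te; rewrite -[leLHS]expRK ler_ln ?posrE ?expR_gt0// (lt_le_trans (expR_gt0 1)). Qed.

(** Every derivative of ln(t+1) gains 1/(t+1) <= 1/t, while the derivatives of the outer power are
    taken at ln(t+1) >= 1, where their own gain may be dropped; hence the threshold e. *)
Lemma symbol_ln_powR (kappa : R) : 0 <= kappa ->
  symbol (expR 1) (fun t => ln (t + 1) `^ (- kappa)) (fun t => ln (t + 1) `^ (- kappa)).
Proof.
move=> k0; pose q s : R := s * 1 + 1; have T00 : 0 < expR 1 :> R by exact: expR_gt0.
have [p1 [p2 [C HC]]] := symbol_powR ltr01 k0.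
exists (fun t => p1 (ln (q t)) * ((q t)^-1 * 1)).
exists (fun t => p2 (ln (q t)) * ((q t)^-1 * 1) ^+ 2
   + p1 (ln (q t)) * (- ((q t) ^+ 2)^-1 * 1 ^+ 2 + (q t)^-1 * 0)).
exists (2 * C) => t tT; have t0 : 0 < t by exact: lt_le_trans tT.
have qE : q t = t + 1 by rewrite /q mulr1.
have t1 : 0 < q t by rewrite qE; lra.
have l1 : 1 <= ln (q t) by apply: ln_ge1; rewrite qE; lra.
have [dp pC p1C p2C] := HC _ l1.
set w := ln (q t) `^ (- kappa) in pC p1C p2C.
have CW := le_trans (normr_ge0 _) pC.
have wE : ln (t + 1) `^ (- kappa) = w by rewrite /w qE.
rewrite !wE -!mulrA.
have {}p1C : `|p1 (ln (q t))| <= C * w.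
  by apply: (le_trans p1C); rewrite ler_pdivrMr ?ler_peMr//; lra.
have {}p2C : `|p2 (ln (q t))| <= C * w.
  by apply: (le_trans p2C); rewrite ler_pdivrMr ?ler_peMr ?exprn_ege1// exprn_gt0//; lra.
have it : `|(q t)^-1| <= t^-1.
  by rewrite ger0_norm ?invr_ge0 ?(ltW t1)// lef_pV2 ?posrE// qE; lra.
have it2 : `|(q t)^-1 ^+ 2| <= t^-1 ^+ 2.
  by rewrite normrX lerXn2r ?nnegrE ?invr_ge0 ?(ltW t0)//.
split.
- have dl := derive2_comp (g := q) (derive2_ln t1) (derive2_affine 1 1 t).
  have := derive2_comp (g := fun s => ln (q s)) dp dl.
  by have -> : (fun s : R => ln (s + 1) `^ (- kappa)) =
     (fun s => (ln (q s)) `^ (- kappa)) by apply/funext => s; rewrite /q mulr1.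
- by rewrite (le_trans pC)//; lra.
- rewrite mulr1 normrM (le_trans (ler_pM _ _ p1C it))// (mulrA C).
  by rewrite ler_peMl ?ler1n// mulr_ge0 ?invr_ge0 ?(ltW t0).
- rewrite !mulr1 mulr0 addr0 expr1n mulr1 -exprVn mulrN -mulrBl normrM.
  rewrite (_ : 2 * (C * (w / t ^+ 2)) = (C * w + C * w) * t^-1 ^+ 2); last first.
    by rewrite exprVn; ring.
  by rewrite ler_pM// (le_trans (ler_normB _ _))// lerD.
Qed.

(** Each derivative of F(ln t) brings a factor 1/t: this is the point of a profile in log t. The
    threshold e makes ln t >= 1, where the bounds on F hold. *)
Lemma symbol_log_profile (F : R -> R) (a1 : R) : twice_derivable F ->
  (forall (t : R) (k : nat), 1 <= t -> (k <= 2)%N -> `|derive1n k F t| <= a1) ->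
  symbol (expR 1) (fun=> 1) (fun t => F (ln t)).
Proof.
move=> [dF dF'] Fa; have T00 : 0 < expR 1 :> R by exact: expR_gt0.
exists (fun t => derive1 F (ln t) * t^-1).
exists (fun t => derive1n 2 F (ln t) * t^-1 ^+ 2 + derive1 F (ln t) * - (t ^+ 2)^-1).
exists (2 * a1) => t tT; have t0 : 0 < t by exact: lt_le_trans tT.
have l1 := ln_ge1 tT.
have F0 := Fa _ 0 l1 isT; have F1 := Fa _ 1 l1 isT; have F2 := Fa _ 2 l1 isT.
have a10 := le_trans (normr_ge0 _) F0.
have ti : 0 <= t^-1 by rewrite invr_ge0 ltW.
split.
- apply: derive2_comp (derive2_ln t0); split.
    by rewrite derive1E; exact/derivableP.
  by rewrite /derive1n/= derive1E; exact/derivableP.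
- by rewrite mulr1 (le_trans F0)//; lra.
- by rewrite mulr1 normrM (ger0_norm ti) ler_wpM2r// (le_trans F1)//; lra.
- rewrite mulr1 -exprVn mulrN -mulrBl normrM (ger0_norm (exprn_ge0 _ ti)).
  by rewrite ler_wpM2r ?exprn_ge0// (le_trans (ler_normB _ _))// mulr_natl lerD.
Qed.

End Symbols.

Section DiscreteSymbols.
Context {R : realType}.
Implicit Types (r kappa : R) (lam theta : R -> R).

(** The order of the mask at the integer n; the shifts by 1 and 2 keep both the power and the
    logarithm positive at n = 0. *)
Definition mask_weight r kappa (n : nat) : R :=
  n.+1%:R `^ (- r) * ln n.+2%:R `^ (- kappa).

Definition mask_differences r kappa (A : R) (b : int -> R) := forall n : int,
  [/\ `|b n| <= A * mask_weight r kappa `|n|,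
      `|b (n + 1) - b n| <= A * mask_weight r kappa `|n| / `|n|.+1%:R,
      `|b (n - 1) - b n| <= A * mask_weight r kappa `|n| / `|n|.+1%:R &
      `|diff2 b n| <= A * mask_weight r kappa `|n| / `|n|.+1%:R ^+ 2].

Lemma ln_gt0_nat (n : nat) : 0 < ln n.+2%:R :> R.
Proof. by rewrite ln_gt0// ltr1n. Qed.

Lemma mask_weight_gt0 r kappa n : 0 < mask_weight r kappa n.
Proof. by rewrite mulr_gt0 ?powR_gt0 ?ln_gt0_nat. Qed.

Lemma powR_antimono (a x y : R) : 0 <= a -> 0 < x -> x <= y -> y `^ (- a) <= x `^ (- a).
Proof.
move=> a0 x0 xy; have y0 := lt_le_trans x0 xy.
by rewrite !powRN lef_pV2 ?posrE ?powR_gt0// ge0_ler_powR// nnegrE ltW.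
Qed.

Lemma mask_weight_antimono r kappa m n : 0 <= r -> 0 <= kappa -> (m <= n)%N ->
  mask_weight r kappa n <= mask_weight r kappa m.
Proof.
move=> r0 k0 mn; rewrite ler_pM ?powR_ge0// powR_antimono ?ler_nat ?ln_gt0_nat//.
by rewrite ler_ln ?posrE// ler_nat.
Qed.

(** For n >= 3 one has (n+1)/2 <= n - 1, and n + 2 <= n^2 gives ln(n+2)/2 <= ln n; halving the two
    bases costs 2^r and 2^kappa. *)
Lemma mask_weight_shift r kappa (n : nat) t : 0 <= r -> 0 <= kappa -> (3 <= n)%N ->
  n%:R - 1 <= t -> t `^ (- r) * ln (t + 1) `^ (- kappa) <=
    2 `^ r * 2 `^ kappa * mask_weight r kappa n.
Proof.
move=> r0 k0 n3 nt.
have nR : 3 <= n%:R :> R by rewrite ler_nat.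
have t0 : 0 < t by lra.
have E1 : n.+1%:R = n%:R + 1 :> R by rewrite -addn1 natrD.
have E2 : n.+2%:R = n%:R + 2 :> R by rewrite -addn2 natrD.
rewrite /mask_weight mulrACA.
have halfE (a x : R) : 0 <= x -> (x / 2) `^ (- a) = 2 `^ a * x `^ (- a).
  have n2 : 2 != 0 :> R by rewrite pnatr_eq0.
  move=> x0; rewrite -{2}(divfK n2 x) [in RHS]powRM ?divr_ge0//.
  by rewrite mulrCA -powRD ?subrr ?powRr0 ?mulr1 ?n2 ?implybT.
rewrite -!halfE ?ln_ge0 ?ler1n//.
have l1 : 0 < ln n.+2%:R / 2 :> R by rewrite divr_gt0 ?ln_gt0_nat.
rewrite ler_pM ?powR_ge0// powR_antimono//; try lra.
apply: (@le_trans _ _ (ln n%:R)); last by rewrite ler_ln ?posrE; lra.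
rewrite ler_pdivrMr// mulr_natr mulr2n -lnM ?posrE; try lra.
rewrite ler_ln ?posrE ?mulr_gt0; try lra.
by rewrite E2; nra.
Qed.

(** Reflection exchanges the forward and the backward difference and fixes the second one. *)
Lemma even_mask_differences r kappa A (b : int -> R) :
  (forall j, b (- j) = b j) ->
  (forall n : nat, [/\ `|b n%:Z| <= A * mask_weight r kappa n,
      `|b (n%:Z + 1) - b n%:Z| <= A * mask_weight r kappa n / n.+1%:R,
      `|b (n%:Z - 1) - b n%:Z| <= A * mask_weight r kappa n / n.+1%:R &
      `|diff2 b n%:Z| <= A * mask_weight r kappa n / n.+1%:R ^+ 2]) ->
  mask_differences r kappa A b.
Proof.
move=> bN H [n|n]; first exact: H.
have [h1 h2 h3 h4] := H n.+1; rewrite NegzE abszN absz_nat.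
have e1 : b (- n.+1%:Z + 1) = b (n.+1%:Z - 1) by rewrite -bN; congr b; lia.
have e2 : b (- n.+1%:Z - 1) = b (n.+1%:Z + 1) by rewrite -bN; congr b; lia.
rewrite /diff2 e1 e2 bN; split => //.
by move: h4; rewrite /diff2 [b (_ - 1) + _]addrC.
Qed.

Lemma mask_differences_large r kappa (C : R) (u : R -> R) (b : int -> R) (n : nat) :
  0 <= r -> 0 <= kappa -> 0 <= C -> (3 <= n)%N ->
  (exists u1 u2 : R -> R, forall t : R, n%:R - 1 <= t ->
    [/\ derive2 u u1 (u2 t) t,
      `|u t| <= C * (t `^ (- r) * ln (t + 1) `^ (- kappa)),
      `|u1 t| <= C * (t `^ (- r) * ln (t + 1) `^ (- kappa)) / t &
      `|u2 t| <= C * (t `^ (- r) * ln (t + 1) `^ (- kappa)) / t ^+ 2]) ->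
  [/\ b n%:Z = u n%:R, b (n%:Z + 1) = u (n%:R + 1) & b (n%:Z - 1) = u (n%:R - 1)] ->
  let A := 4 * C * (2 `^ r * 2 `^ kappa) in
  [/\ `|b n%:Z| <= A * mask_weight r kappa n,
      `|b (n%:Z + 1) - b n%:Z| <= A * mask_weight r kappa n / n.+1%:R,
      `|b (n%:Z - 1) - b n%:Z| <= A * mask_weight r kappa n / n.+1%:R &
      `|diff2 b n%:Z| <= A * mask_weight r kappa n / n.+1%:R ^+ 2].
Proof.
move=> r0 k0 C0 n3 [u1 [u2 Hu]] [bn bn1 bn2] A.
have nR : 3 <= n%:R :> R by rewrite ler_nat.
have E1 : n.+1%:R = n%:R + 1 :> R by rewrite -addn1 natrD.
pose D := C * (2 `^ r * 2 `^ kappa * mask_weight r kappa n).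
have D0 : 0 <= D by rewrite !mulr_ge0 ?powR_ge0// ltW// mask_weight_gt0.
have AE : A * mask_weight r kappa n = 4 * D by rewrite /A /D; ring.
have W (t : R) : n%:R - 1 <= t -> C * (t `^ (- r) * ln (t + 1) `^ (- kappa)) <= D.
  by move=> nt; rewrite ler_wpM2l// mask_weight_shift.
(* Here n >= 3 gives t >= (n+1)/2; the square of this factor 2 is the 4 in [A]. *)
have ti (t : R) : n%:R - 1 <= t -> 0 <= t^-1 <= 2 / n.+1%:R.
  move=> nt; have t0 : 0 < t by lra.
  rewrite invr_ge0 (ltW t0)/= -[leLHS]mul1r ler_pdivlMr ?ltr0n// mulrAC ler_pdivrMr//.
  by rewrite mul1r E1; lra.
have u1D (t : R) : n%:R - 1 <= t -> `|u1 t| <= 2 * D / n.+1%:R.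
  move=> nt; have [_ _ h _] := Hu t nt; have /andP[ti0 ti1] := ti t nt.
  apply: (le_trans h); rewrite (_ : 2 * D / _ = D * (2 / n.+1%:R)); last by ring.
  by rewrite ler_pM ?W// mulr_ge0// mulr_ge0 ?powR_ge0.
have u2D (t : R) : n%:R - 1 <= t -> `|u2 t| <= 4 * D / n.+1%:R ^+ 2.
  move=> nt; have [_ _ _ h] := Hu t nt; have /andP[ti0 ti1] := ti t nt.
  apply: (le_trans h); rewrite -[(t ^+ 2)^-1]exprVn -[(_ ^+ 2)^-1 in leRHS]exprVn.
  rewrite (_ : 4 * D * _ = D * (2 / n.+1%:R) ^+ 2); last by ring.
  rewrite ler_pM ?W ?exprn_ge0//; first by rewrite mulr_ge0// mulr_ge0 ?powR_ge0.
  by rewrite lerXn2r// nnegrE// (le_trans ti0).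
have [|||d1 d2 d3] := @differences_le R u u1 u2 n%:R (2 * D / n.+1%:R) (4 * D / n.+1%:R ^+ 2).
- by move=> t /andP[nt _]; have [] := Hu t nt.
- by move=> t /andP[nt _]; exact: u1D.
- by move=> t /andP[nt _]; exact: u2D.
have le24 : 2 * D / n.+1%:R <= 4 * D / n.+1%:R.
  by rewrite ler_wpM2r ?invr_ge0//; lra.
rewrite /diff2 !AE bn bn1 bn2; split.
- have [|_ h _ _] := Hu n%:R; first by lra.
  by apply: (le_trans h); apply: (le_trans (W _ _)); lra.
- exact: le_trans le24.
- exact: le_trans le24.
- exact: d3.
Qed.

(** 4M bounds the values and all differences; (K+1)^2 and the weight at K undo the decay demanded
    for n <= K. *)
Lemma mask_differences_small r kappa (M : R) (b : int -> R) (K n : nat) :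
  0 <= r -> 0 <= kappa -> (n <= K)%N -> (forall j, `|b j| <= M) ->
  let A := 4 * M * K.+1%:R ^+ 2 / mask_weight r kappa K in
  [/\ `|b n%:Z| <= A * mask_weight r kappa n,
      `|b (n%:Z + 1) - b n%:Z| <= A * mask_weight r kappa n / n.+1%:R,
      `|b (n%:Z - 1) - b n%:Z| <= A * mask_weight r kappa n / n.+1%:R &
      `|diff2 b n%:Z| <= A * mask_weight r kappa n / n.+1%:R ^+ 2].
Proof.
move=> r0 k0 nK bM A.
have M0 : 0 <= M := le_trans (normr_ge0 _) (bM 0).
have wK := mask_weight_gt0 r kappa K.
have n1 : 1 <= n.+1%:R :> R by rewrite ler1n.
have nK1 : n.+1%:R <= K.+1%:R :> R by rewrite ler_nat.
have H : 4 * M * n.+1%:R ^+ 2 <= A * mask_weight r kappa n.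
  apply: (@le_trans _ _ (A * mask_weight r kappa K)).
    rewrite /A divfK ?gt_eqF// ler_wpM2l ?mulr_ge0//.
    by rewrite lerXn2r ?nnegrE.
  by rewrite ler_wpM2l ?mask_weight_antimono// /A divr_ge0 ?(ltW wK)// !mulr_ge0// exprn_ge0.
have n2 : n.+1%:R <= n.+1%:R ^+ 2 :> R by rewrite expr2 ler_peMr.
have M4 : 4 * M <= 4 * M * n.+1%:R ^+ 2 by rewrite ler_peMr ?mulr_ge0//; lra.
have H1 : 4 * M * n.+1%:R <= A * mask_weight r kappa n.
  by apply: le_trans H; rewrite ler_wpM2l ?mulr_ge0.
have M41 : 4 * M <= 4 * M * n.+1%:R by rewrite ler_peMr ?mulr_ge0.
have B0 := bM n%:Z; have Bp := bM (n%:Z + 1); have Bm := bM (n%:Z - 1).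
split.
- by lra.
- rewrite ler_pdivlMr ?ltr0n//; apply: le_trans H1; rewrite ler_wpM2r//.
  by rewrite (le_trans (ler_normB _ _))//; lra.
- rewrite ler_pdivlMr ?ltr0n//; apply: le_trans H1; rewrite ler_wpM2r//.
  by rewrite (le_trans (ler_normB _ _))//; lra.
- rewrite ler_pdivlMr ?exprn_gt0 ?ltr0n//; apply: le_trans H; rewrite ler_wpM2r ?exprn_ge0//.
  rewrite /diff2 (le_trans (ler_normB _ _))// normrM (ger0_norm (ler0n _ 2)).
  by have := ler_normD (b (n%:Z + 1)) (b (n%:Z - 1)); lra.
Qed.

Lemma mask_differencesP r kappa lam : 0 <= r -> 0 <= kappa ->
  (exists M : R, forall t : R, `|lam t| <= M) -> is_mask r kappa lam ->
  exists2 A : R, 0 <= A & mask_differences r kappa A (fun j => lam j%:~R).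
Proof.
move=> r0 k0 [M lM] [lamN _ [F [dF [a1 Fa] lamE]]].
have e0 : 0 < expR 1 :> R by exact: expR_gt0.
have := symbolM e0 (symbolM e0 (symbol_powR e0 r0) (symbol_ln_powR k0))
   (symbol_log_profile dF Fa).
move=> [u1 [u2 [C HC]]].
set u := (fun t => _ * F (ln t)) in HC.
(* Beyond K one has n >= 3, and [n - 1, n + 1] lies above e, where the symbol estimates hold. *)
pose K := (maxn 3 (Num.bound (expR (1 : R)))).+1.
have M0 : 0 <= M := le_trans (normr_ge0 _) (lM 0).
pose A1 := 4 * `|C| * (2 `^ r * 2 `^ kappa).
pose A2 := 4 * M * K.+1%:R ^+ 2 / mask_weight r kappa K.
have A10 : 0 <= A1 by rewrite !mulr_ge0 ?powR_ge0.
have A20 : 0 <= A2 by rewrite divr_ge0 ?(ltW (mask_weight_gt0 _ _ _))// !mulr_ge0// exprn_ge0.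
exists (A1 + A2); first by rewrite addr_ge0.
have mono (A B : R) (n : nat) (x y z w : R) : 0 <= B ->
   [/\ x <= A * mask_weight r kappa n, y <= A * mask_weight r kappa n / n.+1%:R,
       z <= A * mask_weight r kappa n / n.+1%:R & w <= A * mask_weight r kappa n / n.+1%:R ^+ 2] ->
   [/\ x <= (A + B) * mask_weight r kappa n, y <= (A + B) * mask_weight r kappa n / n.+1%:R,
       z <= (A + B) * mask_weight r kappa n / n.+1%:R & w <= (A + B) * mask_weight r kappa n / n.+1%:R ^+ 2].
  move=> B0 [h1 h2 h3 h4]; have w0 := ltW (mask_weight_gt0 r kappa n).
  have le1 : A * mask_weight r kappa n <= (A + B) * mask_weight r kappa n.
    by rewrite ler_wpM2r// lerDl.
  split; [exact: le_trans le1|apply: (le_trans h2)|apply: (le_trans h3)|apply: (le_trans h4)];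
    by rewrite ler_wpM2r// invr_ge0// exprn_ge0.
apply: even_mask_differences => [j|n]; first by rewrite rmorphN lamN.
have [nK|Kn] := leqP n K.
  rewrite [A1 + A2]addrC; apply: mono => //.
  by apply: mask_differences_small => // j; exact: lM.
apply: mono => //.
have eK : expR 1 < n%:R - 1 :> R.
  have h := archi_boundP (ltW e0).
  have h2 : (Num.bound (expR (1 : R)) + 1)%N%:R <= n%:R :> R by rewrite ler_nat; rewrite /K in Kn; lia.
  by move: h2; rewrite natrD; lra.
have e1 : 1 < expR 1 :> R by exact: expR1_gt1.
have lamu (t : R) : 1 <= t -> lam t = u t.
  by move=> t1; rewrite lamE// !ger0_norm//; lra.
apply: (@mask_differences_large _ _ `|C| u) => //.
- by rewrite /K in Kn; lia.
- exists u1, u2 => t nt; have te : expR 1 <= t by lra.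
  have [h1 h2 h3 h4] := HC t te; have t0 : 0 < t by lra.
  rewrite !mulr1 in h2 h3 h4.
  have w0 : 0 <= t `^ (- r) * ln (t + 1) `^ (- kappa) by rewrite mulr_ge0 ?powR_ge0.
  have Cw := ler_wpM2r w0 (ler_norm C).
  split => //; [exact: le_trans Cw|apply: (le_trans h3)|apply: (le_trans h4)];
    by rewrite ler_wpM2r// invr_ge0 ?exprn_ge0// ltW.
- by split; rewrite ?rmorphD ?rmorphB/= lamu//; lra.
Qed.

Definition cutoff_differences (T : R) (m : nat) (c : int -> R) := forall j : int,
  [/\ `|c j| <= T, `|c (j + 1) - c j| <= T / m%:R,
      `|c (j - 1) - c j| <= T / m%:R & `|diff2 c j| <= T / m%:R ^+ 2].

Lemma continuous_bounded (f : R -> R) (a b : R) : a <= b -> continuous f ->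
  exists B : R, forall t : R, a <= t <= b -> `|f t| <= B.
Proof.
move=> ab cf; have [|c cab H] := @EVT_max R (fun t => `|f t|) a b ab.
  apply: continuous_subspaceT => t.
  exact: (continuous_comp (cf t) (@norm_continuous _ R (f t))).
by exists `|f c| => t tab; apply: H; rewrite in_itv/=.
Qed.

Lemma cutoff_differencesP theta : is_cutoff theta ->
  exists2 T : R, 0 <= T & forall m, (0 < m)%N ->
    cutoff_differences T m (fun j => theta (j%:~R / m%:R)).
Proof.
move=> [[dth dth' cth2] _ th0].
have cont (f : R -> R) : (forall t, derivable f t 1) -> continuous f.
  move=> df t; apply: (@is_derive_continuous _ f ('D_1 f t)); exact/derivableP.
(* If |j| <= 2m, the points between (j - 1)/m and (j + 1)/m lie in [-3, 3] because m >= 1; if |j| >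
   2m, j and its neighbours are beyond the support of the cut-off. *)
have ab : - 3 <= 3 :> R by lra.
have [B0 H0] := continuous_bounded ab (cont _ dth).
have [B1 H1] := continuous_bounded ab (cont _ dth').
have [B2 H2] := continuous_bounded ab cth2.
have zero3 : (- 3 : R) <= 0 <= (3 : R) by lra.
have B00 := le_trans (normr_ge0 _) (H0 _ zero3).
have B10 := le_trans (normr_ge0 _) (H1 _ zero3).
have B20 := le_trans (normr_ge0 _) (H2 _ zero3).
pose T := B0 + B1 + B2; exists T => [|m m0 j]; first by rewrite /T; lra.
have mR : 1 <= m%:R :> R by rewrite ler1n.
have mi : 0 <= m%:R^-1 :> R by rewrite invr_ge0; lra.
have mm : m%:R * m%:R^-1 = 1 :> R by rewrite mulfV//; lra.
have T0 : 0 <= T by rewrite /T; lra.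
have [jm|jm] := leP (`|j|%N) (2 * m)%N; last first.
  have z (i : int) : (m <= `|i|)%N -> theta (i%:~R / m%:R) = 0.
    move=> mi'; apply: th0; apply/negP => /andP[h1 h2].
    have : `|i%:~R / m%:R : R| < 1 by rewrite ltr_norml h1.
    rewrite normrM normfV ltr_pdivrMr ?normr_gt0; last by lra.
    rewrite mul1r (ger0_norm (ler0n _ m)) -intr_norm -[ltRHS]/(m%:Z%:~R) ltr_int; clear -mi'; lia.
  rewrite /diff2 !z; [|clear -jm; lia..].
  by split; rewrite ?subrr ?mulr0 ?subr0 ?addr0 ?normr0 ?divr_ge0 ?exprn_ge0.
have jR : `|j%:~R : R| <= 2 * m%:R.
  by rewrite -intr_norm -natrM -[leRHS]/((2 * m)%N%:Z%:~R) ler_int; clear -jm; lia.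
have in3 (t : R) : j%:~R - 1 <= t <= j%:~R + 1 -> - 3 <= t * m%:R^-1 + 0 <= 3.
  move=> /andP[t1 t2]; rewrite addr0 ler_pdivlMr ?ler_pdivrMr; try lra.
  by move: jR; rewrite ler_norml => /andP[j1 j2]; lra.
have [|||d1 d2 d3] := @differences_le R (fun t => theta (t * m%:R^-1 + 0))
  (fun t => derive1 theta (t * m%:R^-1 + 0) * m%:R^-1)
  (fun t => derive1n 2 theta (t * m%:R^-1 + 0) * m%:R^-1 ^+ 2 + derive1 theta (t * m%:R^-1 + 0) * 0)
  j%:~R (T / m%:R) (T / m%:R ^+ 2).
- move=> t _; pose q s : R := s * m%:R^-1 + 0.
  apply: (@derive2_comp _ theta _ q); last exact: derive2_affine.
  split; first by rewrite derive1E; exact/derivableP.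
  by rewrite /derive1n/= derive1E; exact/derivableP.
- move=> t /in3 /H1 h; rewrite normrM (ger0_norm mi) ler_wpM2r//.
  by rewrite (le_trans h)// /T; lra.
- move=> t /in3 /H2 h; rewrite mulr0 addr0 normrM (ger0_norm (exprn_ge0 _ mi)) exprVn.
  by rewrite ler_wpM2r ?invr_ge0 ?exprn_ge0// (le_trans h)// /T; lra.
have thE (i : int) (x : R) : i%:~R = x -> theta (i%:~R / m%:R) = theta (x * m%:R^-1 + 0).
  by move=> ->; rewrite addr0.
have e0 := thE j j%:~R erefl.
have e1 := thE (j + 1) (j%:~R + 1) (intrD _ j 1).
have e2 := thE (j - 1) (j%:~R - 1) (intrB _ j 1).
rewrite /diff2 e0 e1 e2; split => //.
have := in3 j%:~R ltac:(lra) => /H0 h; rewrite (le_trans h)// /T; lra.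
Qed.

End DiscreteSymbols.

(** * Tails of the sums of k^(-r) for r > 1 *)

Section PowerSums.
Context {R : realType}.
Implicit Type r : R.

Definition tail_const r : R := 2 `^ r / (r - 1).

Lemma tail_const_ge0 r : 1 < r -> 0 <= tail_const r.
Proof. by move=> r1; rewrite divr_ge0 ?powR_ge0//; lra. Qed.

(** The mean value theorem for x^(1-r) on [i, i+1] replaces the comparison with an integral; x/2 <=
    i is the origin of 2^r in [tail_const]. *)
Lemma powR_le_telescope r (i : nat) : 1 < r -> (0 < i)%N ->
  i%:R `^ (- r) <= tail_const r * (i%:R `^ (1 - r) - i.+1%:R `^ (1 - r)).
Proof.
move=> r1 i0; have iR : 1 <= i%:R :> R by rewrite ler1n.
have iS : i.+1%:R = i%:R + 1 :> R by rewrite -addn1 natrD.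
have [||x xi E] := @MVT_is_derive R (fun x => x `^ (1 - r))
  (fun x => (1 - r) * x `^ (1 - r - 1)) i%:R i.+1%:R; first by lra.
  by move=> x xi; apply: is_derive1_powR; lra.
have {}E : i%:R `^ (1 - r) - i.+1%:R `^ (1 - r) = (r - 1) * x `^ (- r).
  rewrite -opprB E iS (_ : 1 - r - 1 = - r); last by ring.
  by ring.
rewrite E /tail_const mulrA divfK; last by rewrite subr_eq0 gt_eqF.
have x2 : x / 2 <= i%:R by lra.
apply: (@le_trans _ _ ((x / 2) `^ (- r))); first by rewrite powR_antimono//; lra.
have n2 : 2 != 0 :> R by rewrite pnatr_eq0.
rewrite -{2}(divfK n2 x) [in leRHS]powRM ?divr_ge0//; try lra.
by rewrite mulrCA -powRD ?subrr ?powRr0 ?mulr1 ?n2 ?implybT.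
Qed.

Lemma powR1r_antimono r (i j : nat) : 1 < r -> (0 < i)%N -> (i <= j)%N ->
  j%:R `^ (1 - r) <= i%:R `^ (1 - r) :> R.
Proof.
move=> r1 i0 ij; rewrite -opprB powR_antimono ?ltr0n ?ler_nat//; lra.
Qed.

(** Capping the telescoping sequence i^(1-r) at P keeps it nonincreasing, so discarded indices
    contribute nonnegative differences and the first admissible index need not be located; the total
    is at most the cap. *)
Lemma sum_powR_le r (P : R) (m n : nat) : 1 < r -> 0 <= P ->
  (forall i, (0 < i)%N -> (m <= 2 * i)%N -> i%:R `^ (1 - r) <= P) ->
  \sum_(i < n) (if (m <= 2 * i.+1)%N then i.+1%:R `^ (- r) else 0) <= tail_const r * P.
Proof.
move=> r1 P0 HP; pose G i := Num.min P (i.+1%:R `^ (1 - r)).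
have t0 := tail_const_ge0 r1.
apply: (@le_trans _ _ (\sum_(i < n) tail_const r * (G i - G i.+1))).
  apply: ler_sum => i _; case: ifPn => mi.
    apply: (le_trans (powR_le_telescope r1 (ltn0Sn i))); rewrite ler_wpM2l//.
    rewrite /G !min_r//; first by apply: HP => //; lia.
    exact: HP.
  rewrite mulr_ge0// subr_ge0 /G le_min; apply/andP; split; first by rewrite ge_min lexx.
  by rewrite ge_min powR1r_antimono ?orbT.
rewrite -mulr_sumr ler_wpM2l//.
have -> : \sum_(i < n) (G i - G i.+1) = G 0%N - G n.
  rewrite -opprB -telescope_sumr// big_mkord -sumrN.
  by apply: eq_bigr => i _; rewrite opprB.
have : G 0%N <= P by rewrite /G ge_min lexx.
have : 0 <= G n by rewrite /G le_min P0 powR_ge0.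
lra.
Qed.

Lemma sum_powR_bounded r (n : nat) : 1 < r ->
  \sum_(i < n) i.+1%:R `^ (- r) <= tail_const r.
Proof.
move=> r1; rewrite -[leRHS]mulr1; have := @sum_powR_le r 1 0 n r1 ler01.
apply => i i0 _; rewrite -[leRHS](powRr0 i%:R) ler_powR ?ler1n//; lra.
Qed.

Lemma symsum_powR_le r (m n : nat) : 1 < r -> (0 < m)%N ->
  symsum n (fun j : int => if (m <= 2 * `|j|.+1)%N then `|j|.+1%:R `^ (- r) else 0) <=
  tail_const r * 2 `^ r * m%:R `^ (1 - r).
Proof.
move=> r1 m0; rewrite symsum_split0.
pose f i : R := if (m <= 2 * i.+1)%N then i.+1%:R `^ (- r) else 0.
have f0 i : 0 <= f i by rewrite /f; case: ifP => // _; exact: powR_ge0.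
apply: (@le_trans _ _ (2 * \sum_(i < n.+1) f i)).
  rewrite big_ord_recl/= mulrDr lerD//; first by rewrite -[leLHS]/(f 0%N) ler_peMl// ler1n.
  rewrite mulr_sumr; apply: ler_sum => i _.
  by rewrite -/(f i.+1) /bump/= add1n mulr_natl mulr2n.
have mR : 0 < m%:R :> R by rewrite ltr0n.
(* Here 2^r is 2 times 2^(r-1): the 2 counts the signs of j, the rest comes from (m/2)^(1-r), since
   the condition reads |j| + 1 >= m/2. *)
have -> : tail_const r * 2 `^ r * m%:R `^ (1 - r) =
    2 * (tail_const r * (m%:R / 2) `^ (1 - r)).
  have n2 : 2 != 0 :> R by rewrite pnatr_eq0.
  rewrite -{1}(divfK n2 m%:R) [in LHS]powRM ?divr_ge0 ?(ltW mR)//.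
  have e2 : 2 `^ r * 2 `^ (1 - r) = 2 :> R.
    by rewrite -powRD ?n2 ?implybT// addrC subrK powRr1.
  by rewrite mulrACA e2; ring.
rewrite ler_wpM2l// sum_powR_le ?powR_ge0// => i i0 mi.
rewrite -opprB powR_antimono//; [lra|by rewrite divr_gt0|].
by rewrite ler_pdivrMr// mulrC -natrM ler_nat.
Qed.

End PowerSums.

(** * Pointwise error of the quadrature kernel *)
Section KernelError.
Context {R : realType}.
Local Notation normc := (@Normc.normc R).
Variables (r kappa A T : R) (b : int -> R) (c : nat -> int -> R).
Hypotheses (r1 : 1 < r) (k0 : 0 <= kappa) (A0 : 0 <= A) (T0 : 0 <= T).
Hypothesis bA : mask_differences r kappa A b.
Hypothesis cT : forall m, (0 < m)%N -> cutoff_differences T m (c m).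
Hypothesis c1 : forall m j, (0 < m)%N -> (2 * `|j| <= m)%N -> c m j = 1.
Hypothesis c0 : forall m j, (0 < m)%N -> (m <= `|j|)%N -> c m j = 0.

Let r0 : 0 <= r. Proof. exact: ltW (lt_trans ltr01 r1). Qed.

Definition log_const : R := (ln 2 / 3) `^ (- kappa).

Lemma log_const_ge0 : 0 <= log_const. Proof. exact: powR_ge0. Qed.

(** The hypothesis gives ln(n+2) >= max(1, k - 1) ln 2, and max(1, k - 1) >= (k+1)/3 for every k,
    with equality at k = 2; hence the 3 in [log_const]. *)
Lemma mask_weight_dyadic (k n : nat) : (2 ^ k <= 2 * n.+1)%N ->
  mask_weight r kappa n <= log_const * k.+1%:R `^ (- kappa) * n.+1%:R `^ (- r).
Proof.
move=> kn; rewrite /mask_weight mulrC ler_wpM2r ?powR_ge0//.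
have l2 : 0 < ln 2 :> R by rewrite ln_gt0// ltr1n.
rewrite /log_const -powRM ?divr_ge0 ?(ltW l2)//.
rewrite powR_antimono ?mulr_gt0 ?divr_gt0//.
have ln1 : ln 2 <= ln n.+2%:R :> R by rewrite ler_ln ?posrE// ler_nat.
case: k kn => [|k] kn; first by rewrite mulr1; lra.
have lnk : k%:R * ln 2 <= ln n.+2%:R :> R.
  rewrite mulr_natl -lnXn//; rewrite ler_ln ?posrE ?exprn_gt0//.
  by rewrite -natrX ler_nat; rewrite expnS leq_pmul2l// in kn; lia.
have kR : k.+2%:R = k%:R + 2 :> R by rewrite -addn2 natrD.
rewrite kR; case: k kn lnk {kR} => [|k] _ lnk; first by lra.
have k1 : k.+1%:R = k%:R + 1 :> R by rewrite -addn1 natrD.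
have kge : 0 <= k%:R :> R by [].
rewrite k1 in lnk *; nra.
Qed.

(** The discrete Leibniz rule. Since |q+j| + 1 >= m/2, the gain of each difference of the mask is at
    most 2/m, and the four products contribute 9 = 4 + 1 + 2 + 2. *)
Lemma cutoff_mask_product (S : R) (m : nat) (e : int -> R) (q j : int) :
  (0 < m)%N -> cutoff_differences S m e -> (m <= 2 * (absz (q + j)%R).+1)%N ->
  `|e j * b (q + j)| <= S * A * mask_weight r kappa (absz (q + j)) /\
  `|diff2 (fun i => e i * b (q + i)) j| <=
     9 * (S * A * mask_weight r kappa (absz (q + j))) / m%:R ^+ 2.
Proof.
move=> m0 eS mn; have [e1 e2 e3 e4] := eS j; have [b1 b2 b3 b4] := bA (q + j).
set n := absz (q + j) in mn b1 b2 b3 b4 *; set w := mask_weight r kappa n in b1 b2 b3 b4 *.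
have S0 := le_trans (normr_ge0 _) e1.
have w0 : 0 < w by exact: mask_weight_gt0.
have mR : 0 < m%:R :> R by rewrite ltr0n.
pose i := m%:R^-1 : R; have i0 : 0 < i by rewrite invr_gt0.
have ni : 0 <= (n.+1%:R^-1 : R) <= 2 * i.
  rewrite invr_ge0 ler0n/= -[leLHS]mul1r ler_pdivrMr ?ltr0n// mulrAC.
  by rewrite -[leRHS]/(_ / _) ler_pdivlMr// mul1r -natrM ler_nat.
have Aw : 0 <= A * w by rewrite mulr_ge0// ltW.
have {}b2 : `|b (q + j + 1) - b (q + j)| <= 2 * (A * w * i).
  by apply: (le_trans b2); rewrite [leRHS]mulrCA ler_wpM2l//; case/andP: ni.
have {}b3 : `|b (q + j - 1) - b (q + j)| <= 2 * (A * w * i).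
  by apply: (le_trans b3); rewrite [leRHS]mulrCA ler_wpM2l//; case/andP: ni.
have {}b4 : `|diff2 b (q + j)| <= 4 * (A * w * i ^+ 2).
  apply: (le_trans b4); rewrite [leRHS]mulrCA ler_wpM2l// -exprVn.
  case/andP: ni => ni0 ni1; rewrite (_ : 4 * i ^+ 2 = (2 * i) ^+ 2); last by ring.
  by rewrite lerXn2r ?nnegrE// (le_trans ni0).
rewrite -/i in e2 e3; rewrite -exprVn -/i in e4.
have prod (u v x y z : R) : `|u| <= x -> `|v| <= y -> x * y = z -> `|u * v| <= z.
  by move=> ux vy <-; rewrite normrM ler_pM.
split; first by apply: (prod _ _ _ _ _ e1 b1); ring.
have -> : diff2 (fun i => e i * b (q + i)) j =
    e j * diff2 b (q + j) + diff2 e j * b (q + j) +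
    ((e (j + 1) - e j) * (b (q + j + 1) - b (q + j)) +
     (e (j - 1) - e j) * (b (q + j - 1) - b (q + j))).
  by rewrite /diff2 !addrA; ring.
have p1 := prod _ _ _ _ (4 * (S * A * w * i ^+ 2)) e1 b4 ltac:(ring).
have p2 := prod _ _ _ _ (S * A * w * i ^+ 2) e4 b1 ltac:(ring).
have p3 := prod _ _ _ _ (2 * (S * A * w * i ^+ 2)) e2 b2 ltac:(ring).
have p4 := prod _ _ _ _ (2 * (S * A * w * i ^+ 2)) e3 b3 ltac:(ring).
rewrite -exprVn -/i -mulrA.
apply: (le_trans (ler_normD _ _)); apply: (le_trans (lerD (ler_normD _ _) (ler_normD _ _))).
lra.
Qed.

Lemma mm1_le (m : nat) : (0 < m)%N -> m%:R * m.+1%:R <= 2 * m%:R ^+ 2 :> R.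
Proof. by move=> m0; rewrite expr2 -!natrM ler_nat; nia. Qed.

(** The aliases enter with 114 = 2 * 57, one 57 of [block_le] for each sign; the other summand is
    the constant of [high_frequency_le], where 1 - c has the cut-off constant T + 1. *)
Definition error_const : R := log_const * A * (114 * T * tail_const r +
   (T + 1) * (19 * tail_const r * 2 `^ r + 8)).

(** In this alias block all frequencies are at least (l+1)m in absolute value, so 2m+1 coefficients
    of size ((l+1)m)^(-r) add up to order m^(1-r) (l+1)^(-r), which is summable over l. *)
Lemma block_le (k l : nat) (q : int) (y : R) (m := (2 ^ k)%N) :
  q = l.+1%:Z * (2 * m + 1)%N%:Z \/ q = - l.+1%:Z * (2 * m + 1)%N%:Z ->
  poisson_den m y * normc (fsum m (fun j => c m j * b (q + j)) y) <=
  57 * (T * A * log_const) * k.+1%:R `^ (- kappa) * m%:R `^ (1 - r) * l.+1%:R `^ (- r).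
Proof.
move=> qE; have m0 : (0 < m)%N by rewrite expn_gt0.
have mR : 0 < m%:R :> R by rewrite ltr0n.
pose Z := T * A * (log_const * k.+1%:R `^ (- kappa) * (l.+1 * m)%N%:R `^ (- r)).
have Z0 : 0 <= Z by rewrite !mulr_ge0 ?powR_ge0.
have far (j : int) : (`|j| <= m)%N -> (l.+1 * m <= absz (q + j)%R)%N.
  by case: qE => ->; nia.
have wZ (j : int) : (`|j| <= m)%N -> T * A * mask_weight r kappa (absz (q + j)) <= Z.
  move=> jm; have h := far j jm; rewrite ler_wpM2l ?mulr_ge0//.
  apply: (le_trans (@mask_weight_dyadic k _ _)); first by rewrite -/m; nia.
  rewrite ler_wpM2l ?mulr_ge0 ?powR_ge0// powR_antimono ?ltr0n ?muln_gt0//.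
  by rewrite ler_nat; lia.
have cb (j : int) : (`|j| <= m)%N -> `|c m j * b (q + j)| <= Z /\
    `|diff2 (fun i => c m i * b (q + i)) j| <= 9 * Z / m%:R ^+ 2.
  move=> jm; have [|h1 h2] := @cutoff_mask_product T m (c m) q j m0 (cT m0).
    by have := far j jm; nia.
  split; first exact: le_trans (wZ j jm).
  apply: (le_trans h2); rewrite ler_wpM2r ?invr_ge0 ?exprn_ge0 ?(ltW mR)//.
  by rewrite ler_wpM2l// wZ.
pose N1 := (2 * m + 1)%N%:R : R.
have N0 : 0 <= N1 by [].
have N3 : N1 <= 3 * m%:R by rewrite /N1 -natrM ler_nat; clear -m0; lia.
apply: (@le_trans _ _ (N1 * Z + m%:R * m.+1%:R * (N1 * (9 * Z / m%:R ^+ 2)))).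
  apply: fsum_poisson_den.
    rewrite -symsum_cst; apply: symsum_le => j jm; exact: (cb j jm).1.
  (* The cut-off vanishes from m on, and with it all four boundary terms. *)
  rewrite !c0 ?abszN ?absz_nat// !mul0r !normr0 !addr0 -symsum_cst.
  by apply: symsum_le => j jm; exact: (cb j jm).2.
have mm := mm1_le m0.
have m2 : 0 < m%:R ^+ 2 :> R by rewrite exprn_gt0.
(* 19 = 1 + 2 * 9, from m(m+1) <= 2m^2; below, 2m+1 <= 3m turns it into 57. *)
apply: (@le_trans _ _ (19 * (N1 * Z))).
  have : m%:R * m.+1%:R * (N1 * (9 * Z / m%:R ^+ 2)) <= 18 * (N1 * Z).
    rewrite (_ : m%:R * m.+1%:R * _ = (m%:R * m.+1%:R / m%:R ^+ 2) * (9 * (N1 * Z))); last by ring.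
    rewrite (_ : 18 * _ = 2 * (9 * (N1 * Z))); last by ring.
    apply: ler_wpM2r; first by rewrite mulr_ge0// mulr_ge0.
    by rewrite ler_pdivrMr.
  by lra.
apply: (@le_trans _ _ (57 * (m%:R * Z))).
  have := ler_wpM2r Z0 N3; lra.
rewrite le_eqVlt; apply/orP; left; apply/eqP.
rewrite /Z natrM powRM ?ler0n// powRD ?powRr1 ?ler0n//; last first.
  by rewrite (gt_eqF mR) implybT.
by ring.
Qed.

(** Frequencies with 2(|j|+1) < m drop out, so the differences gain 1/m as before and the power sum
    starts near m/2. The condition m^2 <= n serves the boundary terms: each is of order n^(-r) <=
    m^(-2r) <= m^(1-r)/m^2, which absorbs m(m+1); the four of them give 8 = 2 * 4. *)
Lemma high_frequency_le (k n : nat) (y : R) (m := (2 ^ k)%N) : (m * m <= n)%N ->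
  poisson_den m y * normc (fsum n (fun j => (1 - c m j) * b j) y) <=
  (T + 1) * A * log_const * (19 * tail_const r * 2 `^ r + 8) *
    k.+1%:R `^ (- kappa) * m%:R `^ (1 - r).
Proof.
move=> mn; have m0 : (0 < m)%N by rewrite expn_gt0.
have mR : 0 < m%:R :> R by rewrite ltr0n.
have m1 : 1 <= m%:R :> R by rewrite ler1n.
pose e j := 1 - c m j.
have eT : cutoff_differences (T + 1) m e.
  move=> j; have [h1 h2 h3 h4] := cT m0 j; rewrite /e /diff2.
  have ET : T / m%:R <= (T + 1) / m%:R by rewrite ler_wpM2r ?invr_ge0 ?(ltW mR)//; lra.
  split.
  - by apply: (le_trans (ler_normB _ _)); rewrite normr1; lra.
  - rewrite (_ : _ - _ = - (c m (j + 1) - c m j)); last by ring.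
    by rewrite normrN (le_trans h2).
  - rewrite (_ : _ - _ = - (c m (j - 1) - c m j)); last by ring.
    by rewrite normrN (le_trans h3).
  - rewrite (_ : _ - _ = - diff2 (c m) j); last by rewrite /diff2; ring.
    rewrite normrN (le_trans h4)// ler_wpM2r ?invr_ge0 ?exprn_ge0 ?(ltW mR)//; lra.
pose Z := (T + 1) * A * (log_const * k.+1%:R `^ (- kappa)).
have T1 : 0 <= T + 1 by rewrite addr_ge0.
have Z0 : 0 <= Z by rewrite !mulr_ge0 ?powR_ge0.
pose f (j : int) : R := if (m <= 2 * `|j|.+1)%N then `|j|.+1%:R `^ (- r) else 0.
have wZ (j : int) : (m <= 2 * `|j|.+1)%N ->
    (T + 1) * A * mask_weight r kappa `|j| <= Z * f j.
  move=> jm; rewrite /f jm /Z -[leRHS]mulrA ler_wpM2l ?mulr_ge0//.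
  exact: mask_weight_dyadic.
pose a j := e j * b j.
have aE : a = (fun j => e j * b (0 + j)) by apply/funext => j; rewrite add0r.
have ab (j : int) : `|a j| <= Z * f j /\ `|diff2 a j| <= 9 * (Z * f j) / m%:R ^+ 2.
  (* Below this threshold j and both neighbours satisfy 2|i| <= m, where 1 - c is zero. *)
  have [jm|jm] := leqP m (2 * `|j|.+1)%N; last first.
    have e0 (i : int) : (`|i| <= `|j|.+1)%N -> e i = 0.
      by move=> ij; rewrite /e c1 ?subrr//; clear -ij jm; lia.
    rewrite /diff2 /a !e0; [|clear; lia..].
    rewrite /f leqNgt jm/= !(mul0r, mulr0, addr0, subr0, normr0).
    by split.
  have := @cutoff_mask_product (T + 1) m e 0 j m0 eT; rewrite add0r => /(_ jm)[h1 h2].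
  rewrite aE; split; first by rewrite add0r (le_trans h1)// wZ.
  apply: (le_trans h2); rewrite ler_wpM2r ?invr_ge0 ?exprn_ge0 ?(ltW mR)//.
  by rewrite ler_wpM2l// wZ.
pose P := tail_const r * 2 `^ r * m%:R `^ (1 - r).
have P0 : 0 <= P.
  by rewrite mulr_ge0 ?powR_ge0// mulr_ge0 ?powR_ge0// tail_const_ge0.
have sf : symsum n f <= P by exact: symsum_powR_le.
have m2 : 0 < m%:R ^+ 2 :> R by rewrite exprn_gt0.
have mm := mm1_le m0.
have fn (j : int) : (n <= `|j|)%N -> f j <= m%:R `^ (1 - r) / m%:R ^+ 2.
  move=> nj; have nj1 : (m * m <= `|j|)%N := leq_trans mn nj.
  have mj : (m <= `|j|)%N := leq_trans (leq_pmulr m m0) nj1.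
  rewrite /f ifT; last by clear -mj; lia.
  apply: (@le_trans _ _ ((m * m)%N%:R `^ (- r))).
    by rewrite powR_antimono ?ltr0n ?muln_gt0 ?m0// ler_nat leqW.
  rewrite natrM powRM ?(ltW mR)// powRD ?(gt_eqF mR) ?implybT// powRr1 ?(ltW mR)//.
  rewrite mulrAC ler_wpM2r ?powR_ge0// expr2 invfM mulrA divff ?gt_eqF// mul1r.
  rewrite -powR_inv1 ?(ltW mR)// ler_powR// lerN2 ltW//.
apply: (@le_trans _ _ (Z * P + m%:R * m.+1%:R *
   (9 * (Z * P) / m%:R ^+ 2 + 4 * (Z * (m%:R `^ (1 - r) / m%:R ^+ 2))))).
  apply: (@fsum_poisson_den _ _ _ a).
    apply: (@le_trans _ _ (symsum n (fun j => Z * f j))).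
      by apply: symsum_le => j _; exact: (ab j).1.
    by rewrite symsumZ ler_wpM2l.
  apply: lerD.
    apply: (@le_trans _ _ (symsum n (fun j => 9 * Z / m%:R ^+ 2 * f j))).
      apply: symsum_le => j _; apply: (le_trans (ab j).2).
      by rewrite le_eqVlt; apply/orP; left; apply/eqP; ring.
    rewrite symsumZ (_ : 9 * (Z * P) / _ = 9 * Z / m%:R ^+ 2 * P); last by ring.
    apply: ler_wpM2l => //; apply: divr_ge0; last exact: ltW.
    exact: mulr_ge0.
  have bd (j : int) : (n <= `|j|)%N -> `|a j| <= Z * (m%:R `^ (1 - r) / m%:R ^+ 2).
    by move=> nj; rewrite (le_trans (ab j).1)// ler_wpM2l// fn.
  have B1 := bd n.+1%:Z (leqnSn n); have B2 := bd n%:Z (leqnn n).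
  have B3 : `|a (- n%:Z)| <= Z * (m%:R `^ (1 - r) / m%:R ^+ 2) by apply: bd; clear; lia.
  have B4 : `|a (- n.+1%:Z)| <= Z * (m%:R `^ (1 - r) / m%:R ^+ 2) by apply: bd; clear; lia.
  lra.
rewrite (_ : m%:R * m.+1%:R * _ = (m%:R * m.+1%:R / m%:R ^+ 2) *
   (9 * (Z * P) + 4 * (Z * m%:R `^ (1 - r)))); last by ring.
have Q0 : 0 <= 9 * (Z * P) + 4 * (Z * m%:R `^ (1 - r)).
  by rewrite addr_ge0// mulr_ge0// mulr_ge0// powR_ge0.
have : (m%:R * m.+1%:R / m%:R ^+ 2) * (9 * (Z * P) + 4 * (Z * m%:R `^ (1 - r))) <=
    2 * (9 * (Z * P) + 4 * (Z * m%:R `^ (1 - r))) by apply: ler_wpM2r => //; rewrite ler_pdivrMr.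
move=> H; apply: (le_trans (lerD (lexx _) H)).
rewrite le_eqVlt; apply/orP; left; apply/eqP.
by rewrite /Z /P; ring.
Qed.

Lemma partial_kernel_error_le (k L : nat) (x t : R) (m := (2 ^ k)%N) : (m <= L)%N ->
  poisson_den m (x - t) *
    normc (fsum (L * (2 * m + 1) + m) b (x - t) -
           quad_kernel (c m) m (fsum (L * (2 * m + 1) + m) b) x t) <=
  error_const * k.+1%:R `^ (- kappa) * m%:R `^ (1 - r).
Proof.
move=> mL; have m0 : (0 < m)%N by rewrite expn_gt0.
have p0 : 0 <= poisson_den m (x - t) := le_trans ler01 (poisson_den_ge1 _ _).
rewrite quad_kernel_error; last by move=> j mj; apply: c0 => //; exact: ltnW.
apply: (le_trans (ler_wpM2l p0 (normcB _ _))); rewrite mulrDr.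
(* L >= m makes the truncation L(2m+1)+m at least m^2. *)
have H := @high_frequency_le k (L * (2 * m + 1) + m) (x - t) ltac:(nia).
pose w : R := k.+1%:R `^ (- kappa) * m%:R `^ (1 - r).
have w0 : 0 <= w by rewrite mulr_ge0 ?powR_ge0.
have G : poisson_den m (x - t) * normc (\sum_(l < L)
    (cexp (l.+1%:R * (2 * m + 1)%N%:R * x) *
      fsum m (fun j => c m j * b (l.+1%:Z * (2 * m + 1)%N%:Z + j)) (x - t) +
     cexp (- l.+1%:R * (2 * m + 1)%N%:R * x) *
      fsum m (fun j => c m j * b (- l.+1%:Z * (2 * m + 1)%N%:Z + j)) (x - t))) <=
    114 * (T * A * log_const) * w * tail_const r.
  apply: (le_trans (ler_wpM2l p0 (normc_sum _ _ _))); rewrite mulr_sumr.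
  apply: (@le_trans _ _ (\sum_(l < L) 114 * (T * A * log_const) * w * l.+1%:R `^ (- r))).
    apply: ler_sum => l _.
    apply: (le_trans (ler_wpM2l p0 (normcD _ _))); rewrite mulrDr !Normc.normcM !normc_cexp !mul1r.
    have h1 := @block_le k l _ (x - t) (or_introl erefl).
    have h2 := @block_le k l _ (x - t) (or_intror erefl).
    apply: (le_trans (lerD h1 h2)); rewrite le_eqVlt; apply/orP; left; apply/eqP.
    by rewrite /w; ring.
  rewrite -mulr_sumr ler_wpM2l//; last exact: sum_powR_bounded.
  by rewrite !mulr_ge0 ?powR_ge0.
apply: (le_trans (lerD H G)); rewrite le_eqVlt; apply/orP; left; apply/eqP.
by rewrite /error_const /w -/m; ring.
Qed.

End KernelError.

(** * Absolutely convergent Fourier series with explicit tails *)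

Section AbsolutelyConvergent.
Context {R : realType}.
Local Notation normc := (@Normc.normc R).
Variables (r B : R) (b : int -> R).
Hypotheses (r1 : 1 < r) (B0 : 0 <= B).
Hypothesis bB : forall j, `|b j| <= B * `|j|.+1%:R `^ (- r).

Definition fourier (y : R) : R[i] := climn (fun n => fsum n b y).

Let F y j : R[i] := (b j)%:C * cexp (j%:~R * y).

Let pair_le y l : normc (F y l.+1%:Z + F y (- l.+1%:Z)) <= 2 * B * l.+1%:R `^ (- r).
Proof.
have l1 : l.+2%:R `^ (- r) <= l.+1%:R `^ (- r) :> R.
  by rewrite powR_antimono ?ltr0n ?ler_nat// ltW// (lt_trans ltr01).
have h (j : int) : absz j = l.+1 -> normc (F y j) <= B * l.+1%:R `^ (- r).
  move=> jl; rewrite normc_coef_cexp (le_trans (bB j))// jl ler_wpM2l//.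
apply: (le_trans (normcD _ _)); have h1 := h l.+1%:Z erefl.
by have h2 := h (- l.+1%:Z) erefl; lra.
Qed.

Let fsumE n y : fsum n b y = F y 0 + \sum_(l < n) (F y l.+1%:Z + F y (- l.+1%:Z)).
Proof. exact: symsum_split0. Qed.

Definition fourier_tail n : R := 2 * B * tail_const r * n.+1%:R `^ (1 - r).

Lemma fsum_diff_le n N y : (n <= N)%N ->
  normc (fsum N b y - fsum n b y) <= fourier_tail n.
Proof.
move=> nN; rewrite !fsumE opprD addrACA subrr add0r.
rewrite -!(big_mkord xpredT (fun l => F y l.+1%:Z + F y (- l.+1%:Z))).
rewrite (@big_cat_nat _ _ _ n 0 N)//= addrAC subrr add0r.
apply: (le_trans (normc_sum _ _ _)).
apply: (@le_trans _ _ (\sum_(n <= l < N) 2 * B * l.+1%:R `^ (- r))).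
  by apply: ler_sum => l _; exact: pair_le.
rewrite /fourier_tail -mulr_sumr -[leRHS]mulrA ler_wpM2l ?mulr_ge0//.
have S : \sum_(i < N) (if (2 * n.+1 <= 2 * i.+1)%N then i.+1%:R `^ (- r) else 0) <=
    tail_const r * n.+1%:R `^ (1 - r).
  apply: sum_powR_le => //.
  by move=> i i0 ni; rewrite powR1r_antimono//; clear -ni; lia.
apply: le_trans S.
rewrite -(big_mkord xpredT (fun i => if (2 * n.+1 <= 2 * i.+1)%N then i.+1%:R `^ (- r) else 0)).
rewrite [leRHS](@big_cat_nat _ _ _ n 0 N)//= [X in _ <= X + _]big1_seq ?add0r => [|i /andP[_]].
  rewrite le_eqVlt; apply/orP; left; apply/eqP.
  by apply: eq_big_nat => i /andP[ni _]; rewrite ifT//; lia.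
by rewrite mem_index_iota => /andP[_ ni]; rewrite ifF//; lia.
Qed.

Lemma fsum_ccvg y : ccvg (fun n => fsum n b y) (fourier y).
Proof.
have cv (f : R[i] -> R) : (forall x z, f (x + z) = f x + f z) ->
    (forall x, `|f x| <= normc x) -> cvgn (fun n => f (fsum n b y)).
  move=> fD fn; pose u l := f (F y l.+1%:Z + F y (- l.+1%:Z)).
  have f0 : f 0 = 0 by apply: (addrI (f 0)); rewrite -fD !addr0.
  have -> : (fun n => f (fsum n b y)) = (fun n => f (F y 0) + series u n).
    apply/funext => n; rewrite fsumE fD; congr (_ + _).
    by rewrite (big_morph f fD f0) seriesEord.
  apply: is_cvgD; first exact: is_cvg_cst.
  apply: normed_cvg; apply: nondecreasing_is_cvgn.
    by apply: nondecreasing_series => n _ _; exact: normr_ge0.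
  exists (2 * B * tail_const r) => _ [n _ <-]; rewrite /normed_series_of /series/= big_mkord.
  apply: (@le_trans _ _ (\sum_(l < n) 2 * B * l.+1%:R `^ (- r))).
    by apply: ler_sum => l _; exact: le_trans (fn _) (pair_le _ _).
  by rewrite -mulr_sumr ler_wpM2l ?mulr_ge0// sum_powR_bounded.
by split; [exact: (cv _ ReD (@Re_le_normc R))|exact: (cv _ ImD (@Im_le_normc R))].
Qed.

Lemma fourier_fsum_le n y : normc (fourier y - fsum n b y) <= fourier_tail n.
Proof.
apply: (@ccvg_normc_le _ (fun N => fsum N b y - fsum n b y) _ _ n).
  by apply: ccvgB; [exact: fsum_ccvg|exact: ccvg_cst].
by move=> N nN; exact: fsum_diff_le.
Qed.

Lemma fourier_tail_small (e : R) : 0 < e ->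
  exists n0, forall n, (n0 <= n)%N -> fourier_tail n <= e.
Proof.
move=> e0; pose D := 2 * B * tail_const r + 1.
have t0 := tail_const_ge0 r1.
have BT : 0 <= 2 * B * tail_const r by apply: mulr_ge0 t0; exact: mulr_ge0.
have D0 : 0 < D by rewrite ltr_pwDr.
(* The solution of D x^(1-r) = e. *)
pose x := (D / e) `^ (r - 1)^-1.
have rm : 0 < r - 1 by rewrite subr_gt0.
have x0 : 0 < x by rewrite powR_gt0// divr_gt0.
exists (Num.bound x) => n nx.
have xn : x <= n.+1%:R.
  apply: (le_trans (ltW (archi_boundP (ltW x0)))); rewrite ler_nat; exact: leqW.
have xE : x `^ (1 - r) = e / D.
  rewrite /x -powRrM (_ : 1 - r = - (r - 1)); last by ring.
  rewrite mulrN mulVf ?gt_eqF// powR_inv1 ?divr_ge0 ?ltW//.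
  by rewrite invf_div.
apply: (@le_trans _ _ (D * x `^ (1 - r))).
  apply: ler_pM; rewrite ?powR_ge0//.
    by rewrite lerDl.
  by rewrite -opprB powR_antimono// ltW.
by rewrite xE mulrC divfK// gt_eqF.
Qed.

Lemma fourier_bounded y : normc (fourier y) <= B + fourier_tail 0.
Proof.
have -> : fourier y = fsum 0 b y + (fourier y - fsum 0 b y) by rewrite addrC subrK.
apply: (le_trans (normcD _ _)); apply: lerD; last exact: fourier_fsum_le.
rewrite /fsum symsum0 normc_coef_cexp; apply: (le_trans (bB 0)).
by rewrite powR1 mulr1.
Qed.

Lemma cmeasurable_fourier : cmeasurable (fourier : measurableTypeR R -> R[i]).
Proof.
apply: (@cmeasurable_ccvg _ _ _ (fun n y => fsum n b y)); last exact: fsum_ccvg.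
move=> n; apply: cmeasurable_sum => k _; apply: cmeasurableM.
  exact: cmeasurable_cst.
by apply: cmeasurable_cexp; exact: mulrl_measurable.
Qed.

End AbsolutelyConvergent.

Section TrigSeries.
Context {R : realType}.

(** Summation over cubes pays off here: by distributivity the partial sum of a product of
    coefficients is a product of univariate partial sums. *)
Lemma trig_partial_sum d n (c : 'I_d -> int -> R) (x : d.-tuple R) :
  \sum_(k : d.-tuple 'I_(n.*2.+1))
    (\prod_(l < d) c l (tnth (freq k) l))%:C *
      cexp (\sum_(l < d) (tnth (freq k) l)%:~R * tnth x l) =
  \prod_(l < d) fsum n (c l) (tnth x l).
Proof.
rewrite /fsum /symsum bigA_distr_bigA/=.
rewrite (reindex (fun k : d.-tuple 'I_(n.*2.+1) => [ffun l => tnth k l])) /=; last first.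
  exists (fun f : {ffun 'I_d -> 'I_(n.*2.+1)} => [tuple f l | l < d]) => [k _|f _].
    by apply: eq_from_tnth => l; rewrite tnth_mktuple ffunE.
  by apply/ffunP => l; rewrite ffunE tnth_mktuple.
apply: eq_bigr => k _; rewrite cexp_sum rmorph_prod/= -big_split/=.
by apply: eq_bigr => l _; rewrite ffunE /freq tnth_mktuple.
Qed.

Lemma trig_series_prod d (c : 'I_d -> int -> R) (l : 'I_d -> R[i]) (x : d.-tuple R) :
  (forall i, ccvg (fun n => fsum n (c i) (tnth x i)) (l i)) ->
  trig_series (fun j => \prod_(i < d) c i (tnth j i)) x = \prod_(i < d) l i.
Proof.
move=> cl; apply: ccvg_climn.
under eq_fun do rewrite trig_partial_sum.
exact: ccvg_prod.
Qed.

Lemma Hker_fsum (theta : R -> R) m (y : 1.-tuple R) : (0 < m)%N -> is_cutoff theta ->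
  Hker theta m y = fsum m (fun j => theta (j%:~R / m%:R)) (tnth y ord0).
Proof.
move=> m0 [_ _ th0].
have -> : Hker theta m y =
    trig_series (fun j => \prod_(i < 1) theta ((tnth j i)%:~R / m%:R)) y.
  by congr trig_series; apply/funext => j; rewrite big_ord1.
rewrite (@trig_series_prod 1 (fun _ j => theta (j%:~R / m%:R))
  (fun i => fsum m (fun j => theta (j%:~R / m%:R)) (tnth y i))) ?big_ord1// => i.
apply: (@ccvg_eventually_cst _ _ _ m) => n mn.
apply: symsum_vanish => // j mj; rewrite th0 ?mul0r//.
apply/negP => /andP[h1 h2]; have : `|j%:~R / m%:R : R| < 1 by rewrite ltr_norml h1.
have mR : 0 < m%:R :> R by rewrite ltr0n.
rewrite normrM normfV (ger0_norm (ltW mR)) ltr_pdivrMr// mul1r -intr_norm.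
by rewrite -[ltRHS]/(m%:Z%:~R) ltr_int; clear -mj; lia.
Qed.

End TrigSeries.

(** * The Poisson kernel *)
Section CircleIntegral.
Context {R : realType}.
Local Notation circle := (@uniform_prob R 0 (2 * pi) twopi_gt0).
Local Notation normc := (@Normc.normc R).

Lemma bounded_cintegrable d (T : measurableType d) (P : probability T R)
    (g : T -> R[i]) (B : R) : cmeasurable g -> (forall x, normc (g x) <= B) ->
  cintegrable P g.
Proof.
move=> mg gB; apply: (@cintegrable_normc_le _ _ _ _ _ (cst B)) => //.
exact: finite_measure_integrable_cst.
Qed.

Lemma Rintegral_circle0 (f F : R -> R) : continuous f ->
  (forall t : R, is_derive t 1 F (f t)) -> (forall t, `|f t| <= 1) ->
  F 0 = F (2 * pi) -> \int[circle]_t f t = 0.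
Proof.
move=> cf dF f1 F02.
(* Adding 1 makes the integrand nonnegative, so that the uniform integral can be rewritten as a
   Lebesgue integral on [0, 2 pi], with primitive s + F(s). *)
have f0 t : 0 <= 1 + f t by have := f1 t; rewrite ler_norml => /andP[]; lra.
have c1f : continuous (fun t => 1 + f t).
  by move=> t; apply: cvgD; [exact: cvg_cst|exact: cf].
have mf : measurable_fun [set: measurableTypeR R] f := continuous_measurable_fun cf.
have dG (t : R) : is_derive t 1 (fun s : R => s + F s) (1 + f t).
  exact: is_deriveD (is_derive_id t 1) (dF t).
have cG (t : R) : {for t, continuous (fun s : R => s + F s)}.
  exact: is_derive_continuous (dG t).
have I1 : (\int[circle]_t (1 + f t)%:E = 1)%E.
  rewrite integral_uniform//; last first.
    by apply/measurable_EFinP; exact: continuous_measurable_fun.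
  rewrite (@continuous_FTC2 _ (fun t => 1 + f t) (fun t => t + F t)).
  - rewrite F02 add0r -EFinB addrK subr0 -EFinM mulVf// gt_eqF//.
    exact: twopi_gt0.
  - exact: twopi_gt0.
  - exact: continuous_subspaceT.
  - split.
    + by move=> t _; have [] := dG t.
    + by apply: cvg_at_right_filter; exact: cG.
    + by apply: cvg_at_left_filter; exact: cG.
  - by move=> t _; rewrite derive1E; have [_ ->] := dG t.
have if_ : circle.-integrable setT (EFin \o f).
  apply: (measurable_bounded_integrable (mu := circle)) => //.
    by rewrite -ge0_fin_numE ?fin_num_measure.
  exists 1; split => // x x1 t _ /=; exact: le_trans (f1 t) (ltW x1).
have i1 : circle.-integrable setT (EFin \o cst 1) by exact: finite_measure_integrable_cst.
have : \int[circle]_t (cst 1 t + f t) = 1 by rewrite /Rintegral I1.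
rewrite (RintegralD measurableT i1 if_) Rintegral_cst// [X in fine X]probability_setT.
by rewrite /= mulr1 => /eqP; rewrite -subr_eq0 addrAC subrr add0r => /eqP.
Qed.

Lemma cintegral_cst (c : R[i]) : cintegral circle (fun=> c) = c.
Proof.
by rewrite /cintegral !Rintegral_cst// [X in fine X]probability_setT !mulr1; case: c.
Qed.

Lemma cintegral_cexp (k : int) (a : R) :
  cintegral circle (fun t => cexp (k%:~R * (t : R) + a)) = if k == 0 then cexp a else 0.
Proof.
case: eqP => [->|/eqP k0].
  under eq_fun do rewrite mul0r add0r.
  exact: cintegral_cst.
have kn0 : k%:~R != 0 :> R by rewrite intr_eq0.
have dl (t : R) : is_derive t 1 (fun s : R => k%:~R * s + a) k%:~R.
  have := is_deriveD (is_deriveZ (k%:~R : R) (is_derive_id t 1)) (is_derive_cst a t 1).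
  by rewrite addr0 [_ *: 1]mulr1.
have cl : continuous (fun s : R => k%:~R * s + a).
  by move=> t; apply: is_derive_continuous; exact: dl.
have per : cexp (k%:~R * (2 * pi) + a) = cexp a.
  by rewrite cexpD [_ * (2 * pi)]mulrC cexp_twopi_int mul1r.
rewrite /cintegral /cexp /=; congr (_ +i* _).
- apply: (@Rintegral_circle0 (fun t => cos (k%:~R * t + a))
    (fun t => k%:~R^-1 * sin (k%:~R * t + a))).
  + by move=> t; apply: continuous_comp; [exact: cl|exact: continuous_cos].
  + move=> t.
    have := is_deriveZ (k%:~R^-1 : R) (@is_derive1_chain _ _ (fun s => k%:~R * s + a) _ _ _ (is_derive_sin (k%:~R * t + a)) (dl t)).
    by rewrite [_ *: _]mulrCA mulVf// mulr1.
  + by move=> t; rewrite ler_norml cos_geN1 cos_le1.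
  + by move: per => [_ ->]; rewrite mulr0 add0r.
- apply: (@Rintegral_circle0 (fun t => sin (k%:~R * t + a))
    (fun t => - k%:~R^-1 * cos (k%:~R * t + a))).
  + by move=> t; apply: continuous_comp; [exact: cl|exact: continuous_sin].
  + move=> t.
    have := is_deriveZ (- k%:~R^-1 : R) (@is_derive1_chain _ _ (fun s => k%:~R * s + a) _ _ _ (is_derive_cos (k%:~R * t + a)) (dl t)).
    by rewrite [_ *: _]mulNr mulNr mulrN opprK mulrCA mulVf// mulr1.
  + by move=> t; rewrite ler_norml sin_geN1 sin_le1.
  + by move: per => [-> _]; rewrite mulr0 add0r.
Qed.

Lemma cmeasurable_cexp_affine (k : int) (a : R) :
  cmeasurable (fun t : measurableTypeR R => cexp (k%:~R * (t : R) + a)).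
Proof.
apply: cmeasurable_cexp; apply: measurable_funD; last exact: measurable_cst.
by apply: measurable_funM; [exact: measurable_cst|exact: measurable_id].
Qed.

Lemma cintegrable_cexp (c : R[i]) (k : int) (a : R) :
  cintegrable circle (fun t => c * cexp (k%:~R * (t : R) + a)).
Proof.
apply: cintegrableZ; apply: (@bounded_cintegrable _ _ _ _ 1) => [|x].
  exact: cmeasurable_cexp_affine.
by rewrite normc_cexp.
Qed.

Lemma cintegral_trig_coef n (c : int -> R[i]) (k : int) :
  cintegral circle (fun t => cexp (- (k%:~R * (t : R))) *
    symsum n (fun j => c j * cexp (j%:~R * (t : R)))) =
  if (`|k| <= n)%N then c k else 0.
Proof.
have -> : (fun t : measurableTypeR R => cexp (- (k%:~R * (t : R))) *
      symsum n (fun j => c j * cexp (j%:~R * (t : R)))) =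
    (fun t : measurableTypeR R => \sum_(l < n.*2.+1) c (l%:Z - n%:Z) *
      cexp ((l%:Z - n%:Z - k)%:~R * (t : R) + 0)).
  apply/funext => t; rewrite /symsum mulr_sumr; apply: eq_bigr => l _.
  rewrite mulrCA -cexpD; congr (_ * cexp _).
  by move: (l%:Z - n%:Z) => j; rewrite intrD mulrNz; ring.
rewrite cintegral_sum; last by move=> l _; exact: cintegrable_cexp.
under eq_bigr => l _.
  rewrite cintegralZ; last first.
    by apply: (@bounded_cintegrable _ _ _ _ 1) => [|x]; [exact: cmeasurable_cexp_affine|rewrite normc_cexp].
  rewrite cintegral_cexp subr_eq0 cexp0; over.
transitivity (symsum n (fun j => if j == k then c j else 0)).
  by apply: eq_bigr => l _; case: ifP => // _; rewrite ?mulr1 ?mulr0.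
case: leqP => kn; last first.
  rewrite (@eq_symsum _ _ _ (fun=> 0)).
    by rewrite /symsum big1.
  by move=> j jn; case: eqP => // jk; move: jn; rewrite jk leqNgt kn.
rewrite /symsum.
have kn' : (absz (k + n%:Z)%R < n.*2.+1)%N by clear -kn; lia.
rewrite (bigD1 (Ordinal kn'))//= big1 ?addr0 => [|i ik].
  by rewrite (_ : (absz _)%:Z - n%:Z = k) ?eqxx//; clear -kn; lia.
case: eqP => // ik'; case/eqP: ik; apply/val_inj => /=; clear -ik'; lia.
Qed.

Lemma cintegral_fsum_coef n (a : int -> R) (k : int) (y : R) :
  cintegral circle (fun t => cexp (- (k%:~R * (t : R))) * fsum n a (t - y)) =
  if (`|k| <= n)%N then (a k)%:C * cexp (- (k%:~R * y)) else 0.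
Proof.
rewrite -(cintegral_trig_coef n (fun j => (a j)%:C * cexp (- (j%:~R * y)))).
congr cintegral; apply/funext => t; congr (_ * _); apply: eq_bigr => l _.
by rewrite mulrBr cexpD mulrA mulrAC.
Qed.

End CircleIntegral.

Section PoissonKernel.
Context {R : realType}.
Local Notation circle := (@uniform_prob R 0 (2 * pi) twopi_gt0).
Implicit Types (m n : nat) (y t : R).

Definition poisson m y : R := (2 * m + 1)%N%:R / poisson_den m y.

Lemma poisson_ge0 m y : 0 <= poisson m y.
Proof. by rewrite divr_ge0// (le_trans ler01)// poisson_den_ge1. Qed.

Lemma poissonN m y : poisson m (- y) = poisson m y.
Proof. by rewrite /poisson /poisson_den cosN. Qed.

Lemma continuous_poisson m : continuous (poisson m).
Proof.
move=> y; apply: cvgM; first exact: cvg_cst.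
apply: cvgV; first by rewrite gt_eqF// (lt_le_trans ltr01)// poisson_den_ge1.
apply: cvgD; first exact: cvg_cst.
apply: cvgM; first exact: cvg_cst.
apply: cvgB; first exact: cvg_cst.
by apply: cvgM; [exact: cvg_cst|exact: continuous_cos].
Qed.

Lemma measurable_poisson d (T : measurableType d) m (h : T -> R) :
  measurable_fun setT h -> measurable_fun setT (fun x => poisson m (h x)).
Proof.
move=> mh; apply: (measurableT_comp _ mh).
exact: continuous_measurable_fun (@continuous_poisson m).
Qed.

Let ratio m : R := m%:R / m.+1%:R.

Let partial m n y : R := 1 + \sum_(l < n) 2 * ratio m ^+ l.+1 * cos (l.+1%:R * y).

(** With q = m/(m+1) the normalized denominator is 1 + q^2 - 2 q cos y; multiplying the cosine
    series by it telescopes through 2 cos(y) cos((n+1)y) = cos((n+2)y) + cos(ny). *)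
Let partialE m n y : poisson_den m y / m.+1%:R ^+ 2 * partial m n y =
  (2 * m + 1)%N%:R / m.+1%:R ^+ 2 - 2 * ratio m ^+ n.+1 * cos (n.+1%:R * y) +
    2 * ratio m ^+ n.+2 * cos (n%:R * y).
Proof.
have s0 : m.+1%:R != 0 :> R by rewrite pnatr_eq0.
have -> : poisson_den m y / m.+1%:R ^+ 2 = 1 + ratio m ^+ 2 - 2 * ratio m * cos y.
  rewrite /poisson_den /ratio; move: s0; rewrite -natr1 => s0; field; exact: s0.
have -> : (2 * m + 1)%N%:R / m.+1%:R ^+ 2 = 1 - ratio m ^+ 2 :> R.
  rewrite /ratio natrD natrM; move: s0; rewrite -natr1 => s0; field; exact: s0.
elim: n => [|n IH].
  by rewrite /partial big_ord0 addr0 mul0r cos0 mul1r; ring.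
rewrite /partial big_ord_recr/= addrA mulrDr -/(partial m n y) IH.
have c2 : 2 * cos y * cos (n.+1%:R * y) = cos (n.+2%:R * y) + cos (n%:R * y).
  rewrite (_ : n.+2%:R * y = n.+1%:R * y + y); last by rewrite -[n.+2%:R]natr1; ring.
  rewrite (_ : n%:R * y = n.+1%:R * y - y); last by rewrite -[n.+1%:R]natr1; ring.
  by rewrite cosD cosB; ring.
rewrite (exprS _ n.+2) (exprS _ n.+1).
rewrite (_ : cos (n.+2%:R * y) = 2 * cos y * cos (n.+1%:R * y) - cos (n%:R * y)); last first.
  by rewrite c2 addrK.
ring.
Qed.

(** Both remainders in [partialE] are at most 2 q^n, and dividing by the normalized denominator
    loses at most (m+1)^2 because [poisson_den] is at least 1. *)
Let poisson_partial m n y :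
  poisson m y <= partial m n y + 4 * ratio m ^+ n * m.+1%:R ^+ 2.
Proof.
have s0 : m.+1%:R != 0 :> R by rewrite pnatr_eq0.
have s2 : 0 < m.+1%:R ^+ 2 :> R by rewrite exprn_gt0.
have D1 := poisson_den_ge1 m y.
have D0 : 0 < poisson_den m y by exact: lt_le_trans ltr01 D1.
have q0 : 0 <= ratio m by rewrite divr_ge0.
have q1 : ratio m <= 1 by rewrite ler_pdivrMr// mul1r ler_nat.
have pE := partialE m n y.
have qn : 0 <= ratio m ^+ n by exact: exprn_ge0.
have b1 k l (z : R) : (n <= k)%N -> `|ratio m ^+ k * cos (l * z)| <= ratio m ^+ n.
  move=> nk; rewrite normrM ger0_norm ?exprn_ge0//.
  rewrite (le_trans (ler_piMr _ _)) ?exprn_ge0//.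
    by rewrite ler_norml cos_geN1 cos_le1.
  by rewrite ler_wiXn2l.
have := b1 n.+1 n.+1%:R y (leqnSn _); have := b1 n.+2 n%:R y (leqW (leqnSn _)).
move: pE => /(congr1 ( *%R^~ (m.+1%:R ^+ 2))).
rewrite /poisson ler_pdivrMr//.
set a := ratio m ^+ n.+1 * cos _; set b := ratio m ^+ n.+2 * cos _.
rewrite -!(mulrA 2) -/a -/b.
move: (m.+1%:R ^+ 2) (ratio m ^+ n) (partial m n y) (poisson_den m y) s2 qn D1.
move=> s q P D s2 q0' D1 pE; rewrite !ler_norml => /andP[b2 b3] /andP[a2 a3].
have {}pE : D * P = (2 * m + 1)%N%:R - 2 * (a - b) * s.
  transitivity (D / s * P * s); first by field; rewrite gt_eqF.
  by rewrite pE; field; rewrite gt_eqF.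
have abq : 2 * (a - b) * s <= 4 * q * s by rewrite ler_pM2r//; lra.
have qD : 4 * q * s <= 4 * q * s * D.
  by rewrite ler_peMr//; apply: mulr_ge0; [apply: mulr_ge0|exact: ltW].
by rewrite mulrDl (mulrC P) pE; lra.
Qed.

Let partial_fsum m n y :
  partial m n y = complex.Re (fsum n (fun j => ratio m ^+ `|j|%N) y).
Proof.
rewrite /fsum symsum_split0 ReD Re_sum mul0r cexp0 mulr1 expr0.
congr (_ + _); apply: eq_bigr => l _ /=.
by rewrite mulrNz mulNr cosN sinN; ring.
Qed.

(** A partial sum of the Poisson series has mean exactly 1, its constant coefficient. Taking n so
    large that the remainder is at most 1 bounds the mean of the kernel by 2, without a limit under
    the integral. *)
Lemma integral_poisson_subl m y : (\int[circle]_t (poisson m (t - y))%:E <= 2%:E)%E.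
Proof.
have q0 : 0 <= ratio m by rewrite divr_ge0.
have q1 : ratio m < 1 by rewrite ltr_pdivrMr// mul1r ltr_nat.
have [n nq] : exists n, 4 * ratio m ^+ n * m.+1%:R ^+ 2 <= 1.
  have /cvgrPdist_le/(_ (4 * m.+1%:R ^+ 2)^-1) : (GRing.exp (ratio m) : nat -> R) @ \oo --> 0.
    by apply: cvg_expr; rewrite ger0_norm.
  rewrite invr_gt0 mulr_gt0 ?exprn_gt0// => /(_ isT)[n _ /(_ n (leqnn n)) /=].
  rewrite sub0r normrN ger0_norm ?exprn_ge0// => qn; exists n.
  by rewrite mulrAC mulrC -ler_pdivlMr ?mulr_gt0 ?exprn_gt0// mul1r.
have mf : cmeasurable (fun t : measurableTypeR R => fsum n (fun j => ratio m ^+ `|j|%N) (t - y)).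
  apply: cmeasurable_sum => l _; apply: cmeasurableM; first exact: cmeasurable_cst.
  apply: cmeasurable_cexp; apply: measurable_funM; first exact: measurable_cst.
  by apply: measurable_funB => //; exact: measurable_cst.
have if_ : cintegrable circle (fun t => fsum n (fun j => ratio m ^+ `|j|%N) (t - y)).
  by apply: bounded_cintegrable => // t; exact: fsum_norm_le.
have fE := cintegral_fsum_coef n (fun j => ratio m ^+ `|j|%N) 0 y.
have pE : \int[circle]_t partial m n (t - y) = 1.
  transitivity (complex.Re (cintegral circle
    (fun t => cexp (- ((0 : int)%:~R * (t : R))) * fsum n (fun j => ratio m ^+ `|j|%N) (t - y)))).
    apply: eq_Rintegral => t _.
    by rewrite mul0r oppr0 cexp0 mul1r partial_fsum.
  by rewrite fE mul0r oppr0 cexp0 mulr1 expr0.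
have ip : circle.-integrable setT (EFin \o (fun t => partial m n (t - y))).
  by case: if_ => + _; apply: eq_integrable => // t _ /=; rewrite partial_fsum.
have i1 : circle.-integrable setT (EFin \o cst 1) by exact: finite_measure_integrable_cst.
have ip1 : circle.-integrable setT (EFin \o (fun t => partial m n (t - y) + cst 1 t)).
  by apply: eq_integrable (integrableD measurableT ip i1).
have : (\int[circle]_t (partial m n (t - y) + cst 1 t)%:E = 2%:E)%E.
  rewrite -[LHS]fineK; last exact: integrable_fin_num ip1.
  have := RintegralD measurableT ip i1.
  rewrite pE Rintegral_cst// [X in fine X]probability_setT /Rintegral => ->.
  by rewrite mulr1.
move=> <-; apply: ge0_le_integral => //.
- by move=> t _; rewrite lee_fin poisson_ge0.
- apply/measurable_EFinP; apply: measurable_poisson.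
  by apply: measurable_funB => //; exact: measurable_cst.
- exact: measurable_int ip1.
- move=> t _; rewrite lee_fin (le_trans (poisson_partial m n (t - y)))//.
  by rewrite lerD2l.
Qed.

Lemma integral_poisson_subr m y : (\int[circle]_t (poisson m (y - t))%:E <= 2%:E)%E.
Proof.
apply: le_trans (integral_poisson_subl m y).
rewrite le_eqVlt; apply/orP; left; apply/eqP; apply: eq_integral => t _.
by rewrite -opprB poissonN.
Qed.
End PoissonKernel.

(** * Tensor products of kernels *)
Section SimplexSums.
Context {V : comPzRingType}.
Implicit Types (M m d : nat).

(** M bounds each coordinate and m the total. They are kept apart because the recursion on d lowers
    m while the type of the index stays fixed. *)
Definition simplex_sum d M m (F : 'I_d -> nat -> V) : V :=
  \sum_(k : {ffun 'I_d -> 'I_M.+1} | (\sum_(j < d) k j <= m)%N) \prod_(j < d) F j (k j).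

Lemma simplex_sum0 M m (F : 'I_0 -> nat -> V) : simplex_sum M m F = 1.
Proof.
rewrite /simplex_sum (big_pred1 [ffun=> ord0]) ?big_ord0// => k.
rewrite big_ord0 leq0n; apply/esym/eqP/ffunP => -[].
by move=> j j0; exfalso.
Qed.

Let ffun_cons d M (w : 'I_M.+1 * {ffun 'I_d -> 'I_M.+1}) : {ffun 'I_d.+1 -> 'I_M.+1} :=
  [ffun i => if unlift ord0 i is Some j then w.2 j else w.1].

Let ffun_cons0 d M (w : 'I_M.+1 * {ffun 'I_d -> 'I_M.+1}) : ffun_cons w ord0 = w.1.
Proof. by rewrite ffunE unlift_none. Qed.

Let ffun_consS d M (w : 'I_M.+1 * {ffun 'I_d -> 'I_M.+1}) j :
  ffun_cons w (lift ord0 j) = w.2 j.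
Proof. by rewrite ffunE liftK. Qed.

Lemma simplex_sumS d M m (F : 'I_d.+1 -> nat -> V) :
  simplex_sum M m F =
  \sum_(k < M.+1 | (k <= m)%N)
    F ord0 k * simplex_sum M (m - k) (fun j => F (lift ord0 j)).
Proof.
rewrite /simplex_sum (reindex (@ffun_cons d M)) /=; last first.
  exists (fun k => (k ord0, [ffun j => k (lift ord0 j)])) => /= [[k0 k] _|k _].
    by rewrite ffun_cons0; congr pair; apply/ffunP => j; rewrite ffunE ffun_consS.
  apply/ffunP => i; case: (unliftP ord0 i) => [j ->|->].
    by rewrite ffun_consS ffunE.
  by rewrite ffun_cons0.
under [RHS]eq_bigr do rewrite mulr_sumr.
rewrite pair_big_dep/=; apply: eq_big => [[k0 k]|[k0 k] _] /=.
  rewrite big_ord_recl ffun_cons0/=; under eq_bigr do rewrite ffun_consS.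
  by case: (leqP k0 m) => k0m; [rewrite leq_subRL|apply/negbTE; rewrite -ltnNge ltn_addr].
rewrite big_ord_recl ffun_cons0/=; congr (_ * _); apply: eq_bigr => j _.
by rewrite ffun_consS.
Qed.

Lemma eq_simplex_sum d M m (F G : 'I_d -> nat -> V) :
  (forall j k, F j k = G j k) -> simplex_sum M m F = simplex_sum M m G.
Proof. by move=> FG; apply: eq_bigr => k _; apply: eq_bigr => j _. Qed.

End SimplexSums.

Section SmolyakBound.
Context {R : realType}.
Local Notation circle := (@uniform_prob R 0 (2 * pi) twopi_gt0).
Local Notation normc := (@Normc.normc R).
Variables (P : R -> R -> R[i]) (q : nat -> R -> R -> R[i]).

Definition smolyak_error d M m (x t : d.-tuple R) : R[i] :=
  \prod_(l < d) P (tnth x l) (tnth t l) -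
  simplex_sum M m (fun l k => q k (tnth x l) (tnth t l)).

Definition level_error m (a s : R) : R[i] := P a s - \sum_(k < m.+1) q k a s.

Lemma smolyak_error0 M m (x t : 0.-tuple R) : smolyak_error M m x t = 0.
Proof. by rewrite /smolyak_error big_ord0 simplex_sum0 subrr. Qed.

(** Insert and remove the sum over k <= m of q_k times the full product of the remaining factors P;
    m <= M lets this sum fit in the range of [simplex_sum]. *)
Lemma smolyak_errorS d M m a s (x t : d.-tuple R) : (m <= M)%N ->
  smolyak_error M m (vcons (a, x)) (vcons (s, t)) =
  level_error m a s * \prod_(l < d) P (tnth x l) (tnth t l) +
  \sum_(k < m.+1) q k a s * smolyak_error M (m - k) x t.
Proof.
move=> mM; rewrite /smolyak_error big_ord_recl !tnth_vcons0 simplex_sumS.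
under eq_bigr do rewrite !tnth_vconsS.
set p := \prod_(i < d) _; rewrite /level_error mulrBl.
under [X in _ = _ + X]eq_bigr do rewrite mulrBr.
rewrite sumrB -mulr_suml addrA subrK; congr (_ - _).
rewrite [RHS](big_ord_widen M.+1 (fun k => q k a s * simplex_sum M (m - k) _)) ?ltnS//.
apply: eq_bigr => k _; rewrite !tnth_vcons0.
by congr (_ * _); apply: eq_simplex_sum => j l; rewrite !tnth_vconsS.
Qed.

Variables (r kappa C : R).
Hypotheses (k0 : 0 <= kappa) (C0 : 0 <= C).
Hypothesis mP : forall a, cmeasurable (P a : measurableTypeR R -> R[i]).
Hypothesis mq : forall k a, cmeasurable (q k a : measurableTypeR R -> R[i]).

Definition level_weight (k : nat) : R := 2 `^ (- (r * k%:R)) * k.+1%:R `^ (- kappa).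

Hypothesis PC : forall a, (\int[circle]_s (normc (P a s))%:E <= C%:E)%E.
Hypothesis qC : forall k a,
  (\int[circle]_s (normc (q k a s))%:E <= (C * level_weight k)%:E)%E.
Hypothesis eC : forall k a,
  (\int[circle]_s (normc (level_error k a s))%:E <= (C * level_weight k)%:E)%E.

Lemma level_weight_ge0 k : 0 <= level_weight k.
Proof. by rewrite mulr_ge0 ?powR_ge0. Qed.

Let tensor_sum_le I (l : seq I) d (F : d.+1.-tuple R -> R[i])
    (u : I -> measurableTypeR R -> R[i]) (v : I -> d.-tuple R -> R[i]) (al be : I -> R) :
  cmeasurable F -> (forall i, cmeasurable (u i)) -> (forall i, cmeasurable (v i)) ->
  (forall s z, F (vcons (s, z)) = \sum_(i <- l) u i s * v i z) ->
  (forall i, 0 <= be i) ->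
  (forall i, (\int[circle]_s (normc (u i s))%:E <= (al i)%:E)%E) ->
  (forall i, (\int[torus d]_z (normc (v i z))%:E <= (be i)%:E)%E) ->
  (\int[torus d.+1]_t (normc (F t))%:E <= (\sum_(i <- l) al i * be i)%:E)%E.
Proof.
move=> mF mu mv FE be0 ual vbe.
have v00 i : (0 <= \int[torus d]_z (normc (v i z))%:E)%E.
  by apply: integral_ge0 => z _; rewrite lee_fin normc_ge0.
have mnu i := emeasurable_normc (mu i); have mnv i := emeasurable_normc (mv i).
rewrite torus_vcons; [|exact: emeasurable_normc|by move=> t; rewrite lee_fin normc_ge0].
have E1 s : (\int[torus d]_z (normc (F (vcons (s, z))))%:E <=
    \sum_(i <- l) (normc (u i s))%:E * \int[torus d]_z (normc (v i z))%:E)%E.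
  apply: (@le_trans _ _ (\int[torus d]_z (\sum_(i <- l) (normc (u i s))%:E * (normc (v i z))%:E))%E).
    apply: ge0_le_integral => //.
    - by move=> z _; rewrite lee_fin normc_ge0.
    - apply: emeasurable_normc; under eq_fun do rewrite FE.
      by apply: cmeasurable_sum => i _; apply: cmeasurableM => //; exact: cmeasurable_cst.
    - by apply: emeasurable_sum => i; apply: measurable_funeM.
    - move=> z _; rewrite FE; under [leRHS]eq_bigr do rewrite -EFinM -Normc.normcM.
      by rewrite sumEFin lee_fin normc_sum.
  rewrite ge0_integral_sum//; last 2 first.
  - by move=> i; apply: measurable_funeM.
  - by move=> i z _; rewrite -EFinM lee_fin mulr_ge0// normc_ge0.
  rewrite le_eqVlt; apply/orP; left; apply/eqP; apply: eq_bigr => i _.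
  by rewrite ge0_integralZl// => [z _|]; rewrite lee_fin normc_ge0.
apply: (@le_trans _ _ (\int[circle]_s (\sum_(i <- l) (normc (u i s))%:E *
    \int[torus d]_z (normc (v i z))%:E))%E).
  apply: ge0_le_integral => //.
  - by move=> s _; apply: integral_ge0 => z _; rewrite lee_fin normc_ge0.
  - apply: (@measurable_fun_fubini_tonelli_F _ _ _ _ _ (torus d)
      (fun w : measurableTypeR R * d.-tuple R => (normc (F (vcons w)))%:E)).
      by apply: emeasurable_normc; apply: cmeasurable_comp => //; exact: measurable_vcons.
    by move=> w; rewrite lee_fin normc_ge0.
  - apply: emeasurable_sum => i; under eq_fun do rewrite muleC.
    exact: measurable_funeM.
rewrite ge0_integral_sum//; last 2 first.
- by move=> i; under eq_fun do rewrite muleC; exact: measurable_funeM.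
- by move=> i s _; rewrite mule_ge0// lee_fin normc_ge0.
rewrite -sumEFin; apply: lee_sum => i _.
under eq_integral do rewrite muleC.
rewrite ge0_integralZl//; last by move=> s _; rewrite lee_fin normc_ge0.
rewrite EFinM muleC; apply: lee_pmul => //.
by apply: integral_ge0 => s _; rewrite lee_fin normc_ge0.
Qed.

Lemma vcons_surj d (x : d.+1.-tuple R) : exists a x', x = vcons (a, x').
Proof.
exists (tnth x ord0), [tuple tnth x (lift ord0 j) | j < d].
apply: eq_from_tnth => l; case: (unliftP ord0 l) => [j ->|->].
  by rewrite tnth_vconsS tnth_mktuple.
by rewrite tnth_vcons0.
Qed.

Let cmeasurable_coord d (F : R -> R[i]) (l : 'I_d) :
  cmeasurable (F : measurableTypeR R -> R[i]) ->
  cmeasurable (fun t : d.-tuple R => F (tnth t l)).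
Proof. by move=> mF; apply: (cmeasurable_comp mF); exact: measurable_tnth. Qed.

Let cmeasurable_prodP d (x : d.-tuple R) :
  cmeasurable (fun t : d.-tuple R => \prod_(l < d) P (tnth x l) (tnth t l)).
Proof. by apply: cmeasurable_prod => l _; exact: cmeasurable_coord. Qed.

Let cmeasurable_smolyak_error d M m (x : d.-tuple R) :
  cmeasurable (smolyak_error M m x).
Proof.
apply: cmeasurableB; first exact: cmeasurable_prodP.
apply: cmeasurable_sum => k _; apply: cmeasurable_prod => l _.
exact: cmeasurable_coord.
Qed.

Let prodP_le d (x : d.-tuple R) :
  (\int[torus d]_t (normc (\prod_(l < d) P (tnth x l) (tnth t l)))%:E <= (C ^+ d)%:E)%E.
Proof.
elim: d x => [|d IH] x.
  under eq_integral do rewrite big_ord0 Normc.normc1.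
  by rewrite integral_cst// [X in (_ * X)%E](@probability_setT _ _ _ (torus 0)) mule1.
have [a [x' ->]] := vcons_surj x.
apply: le_trans (@tensor_sum_le unit [:: tt] d _ (fun _ s => P a s)
  (fun _ z => \prod_(l < d) P (tnth x' l) (tnth z l)) (fun=> C) (fun=> C ^+ d) _ _ _ _ _ _ _) _ => //.
- by move=> s z; rewrite big_seq1 big_ord_recl !tnth_vcons0; under eq_bigr do rewrite !tnth_vconsS.
- by move=> _; exact: exprn_ge0.
- by rewrite big_seq1 exprS.
Qed.

Lemma level_weight_product (k m n : nat) : (k <= m)%N ->
  level_weight k * (level_weight (m - k) * (m - k).+1%:R ^+ n) <=
  level_weight m * m.+1%:R ^+ n.
Proof.
move=> km; rewrite mulrA; apply: ler_pM; rewrite ?exprn_ge0//.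
- by rewrite mulr_ge0 ?level_weight_ge0.
- rewrite /level_weight mulrACA -powRD; last by rewrite pnatr_eq0 implybT.
  rewrite (_ : - (r * k%:R) - r * (m - k)%:R = - (r * m%:R)); last first.
    by rewrite natrB//; ring.
  rewrite ler_wpM2l ?powR_ge0// -powRM// -natrM.
  rewrite powR_antimono ?ltr0n ?ler_nat//.
  clear -km; nia.
- by rewrite lerXn2r ?nnegrE// ler_nat ltnS leq_subr.
Qed.

(** In the factor d + 1 of the induction step, 1 accounts for the level error times the full product
    and d for the sum over k. All m + 1 terms of that sum obey one and the same bound, so their
    number supplies the new power of m + 1. *)
Lemma smolyak_bound d M m (x : d.-tuple R) : (m <= M)%N ->
  (\int[torus d]_t (normc (smolyak_error M m x t))%:E <=
    (d%:R * C ^+ d * (level_weight m * m.+1%:R ^+ d.-1))%:E)%E.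
Proof.
elim: d m x => [|d IH] m x mM.
  under eq_integral do rewrite smolyak_error0 Normc.normc0.
  by rewrite integral0 mul0r mul0r.
have [a [x' ->]] := vcons_surj x.
(* [None] indexes the term with the level error and [Some k] those of the sum, so a single tensor
   estimate covers the recursion. *)
pose u (i : option nat) := if i is Some k then q k a else level_error m a.
pose v (i : option nat) (z : d.-tuple R) := if i is Some k then smolyak_error M (m - k) x' z
  else \prod_(l < d) P (tnth x' l) (tnth z l).
pose al (i : option nat) := C * level_weight (if i is Some k then k else m).
pose be (i : option nat) := if i is Some k then
  d%:R * C ^+ d * (level_weight (m - k) * (m - k).+1%:R ^+ d.-1) else C ^+ d.
apply: le_trans (@tensor_sum_le _ (None :: [seq Some k | k <- iota 0 m.+1]) d _
  u v al be _ _ _ _ _ _ _) _ => //.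
- case=> [k|] //=; apply: cmeasurableB; first exact: mP.
  by apply: cmeasurable_sum => k _; exact: mq.
- by case=> [k|]; [exact: cmeasurable_smolyak_error|exact: cmeasurable_prodP].
- move=> s z; rewrite smolyak_errorS// big_cons big_map; congr (_ + _).
  by rewrite -(big_mkord xpredT (fun k => q k a s * smolyak_error M (m - k) x' z)) /index_iota subn0.
- case=> [k|]; rewrite /be ?exprn_ge0//.
  by do 2 apply: mulr_ge0; rewrite ?mulr_ge0 ?level_weight_ge0 ?exprn_ge0.
- by case=> [k|]; [exact: qC|exact: eC].
- case=> [k|]; rewrite /be/v; last exact: prodP_le.
  by apply: IH; apply: leq_trans (leq_subr _ _) mM.
rewrite lee_fin big_cons big_map -natr1 (addrC _ 1) !mulrDl mul1r/=; apply: lerD.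
  rewrite /al /be mulrAC -exprS ler_wpM2l ?exprn_ge0//.
  by rewrite ler_peMr ?level_weight_ge0// -natrX ler1n expn_gt0.
rewrite -[_ :: iota 1 _]/(index_iota 0 m.+1) big_mkord.
(* At d = 0 the predecessor [d.-1] is 0 and supplies no power to raise; there the sum vanishes
   through the factor d. *)
have [d0|d0] := posnP d.
  by rewrite big1 => [|k _]; rewrite /be ?d0 ?mul0r ?mulr0 ?mul0r.
apply: (@le_trans _ _ (\sum_(k < m.+1) d%:R * C ^+ d.+1 * (level_weight m * m.+1%:R ^+ d.-1))).
  apply: ler_sum => k _; rewrite /al /be exprS.
  rewrite (_ : C * _ * _ = d%:R * (C * C ^+ d) * (level_weight k *
    (level_weight (m - k) * (m - k).+1%:R ^+ d.-1))); last by ring.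
  by rewrite ler_wpM2l ?mulr_ge0 ?exprn_ge0// level_weight_product// -ltnS.
rewrite sumr_const card_ord -[leLHS]mulr_natr.
have -> : m.+1%:R ^+ d = m.+1%:R ^+ d.-1 * m.+1%:R :> R by rewrite -exprSr prednK.
by move: (level_weight m) => w; rewrite !mulrA.
Qed.

End SmolyakBound.

(** * Row and column integrals of the level kernels *)

Section LevelKernels.
Context {R : realType}.
Local Notation circle := (@uniform_prob R 0 (2 * pi) twopi_gt0).
Local Notation normc := (@Normc.normc R).
Variables (b : int -> R) (c : nat -> int -> R).

Definition shift_kernel (x t : R) : R[i] := fourier b (x - t).

Definition level_kernel (k : nat) (x t : R) : R[i] :=
  let K m := quad_kernel (c m) m (fourier b) x t in
  if k is k'.+1 then K (2 ^ k'.+1)%N - K (2 ^ k')%N else K 1%N.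

Lemma level_error_quad k x t :
  level_error shift_kernel level_kernel k x t =
  fourier b (x - t) - quad_kernel (c (2 ^ k)%N) (2 ^ k) (fourier b) x t.
Proof.
rewrite /level_error; congr (_ - _).
elim: k => [|k IH]; first by rewrite big_ord1.
by rewrite big_ord_recr/= IH addrC subrK.
Qed.

Variables (r kappa A T : R).
Hypotheses (r1 : 1 < r) (k0 : 0 <= kappa) (A0 : 0 <= A) (T0 : 0 <= T).
Hypothesis bA : mask_differences r kappa A b.
Hypothesis cT : forall m, (0 < m)%N -> cutoff_differences T m (c m).
Hypothesis c1 : forall m j, (0 < m)%N -> (2 * `|j| <= m)%N -> c m j = 1.
Hypothesis c0 : forall m j, (0 < m)%N -> (m <= `|j|)%N -> c m j = 0.

Definition mask_bound : R := A * ln 2 `^ (- kappa).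

Lemma mask_bound_ge0 : 0 <= mask_bound.
Proof. by rewrite mulr_ge0 ?powR_ge0. Qed.

Lemma mask_differences_bound j : `|b j| <= mask_bound * `|j|.+1%:R `^ (- r).
Proof.
have [bj _ _ _] := bA j; apply: (le_trans bj).
rewrite -mulrA ler_wpM2l// /mask_weight mulrC ler_wpM2r ?powR_ge0//.
rewrite powR_antimono ?ln_gt0 ?ltr1n//.
by rewrite ler_ln ?posrE ?ltr0n// ler_nat.
Qed.

Let bB := mask_differences_bound.
Let B0 := mask_bound_ge0.

Let e := error_const r kappa A T.

Let e_ge0 : 0 <= e.
Proof.
rewrite /e /error_const; have := tail_const_ge0 r1; have := log_const_ge0 kappa.
have := powR_ge0 2 r; move: (tail_const r) (log_const kappa) (2 `^ r) => t l p.
by move=> ? ? ?; rewrite !(mulr_ge0, addr_ge0).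
Qed.

Lemma kernel_error_le k x t :
  normc (level_error shift_kernel level_kernel k x t) <=
  e * level_weight r kappa k * poisson (2 ^ k) (x - t).
Proof.
rewrite level_error_quad; set m := (2 ^ k)%N.
have D0 : 0 < poisson_den m (x - t) by rewrite (lt_le_trans ltr01)// poisson_den_ge1.
(* Aliasing is exact along these truncations, and the estimate is uniform in L >= m, hence passes to
   the limit. *)
pose h L := (L * (2 * m + 1) + m)%N.
have hL L : (L <= h L)%N by rewrite /h; clear; nia.
have fcv y : ccvg (fun L => fsum (h L) b y) (fourier b y).
  exact: ccvg_subseq hL (fsum_ccvg r1 B0 bB y).
have Kcv : ccvg (fun L => quad_kernel (c m) m (fsum (h L) b) x t)
    (quad_kernel (c m) m (fourier b) x t).
  apply: ccvgM; first exact: ccvg_cst.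
  by apply: ccvg_sum => l _; apply: ccvgM; [exact: ccvg_cst|exact: fcv].
have : poisson_den m (x - t) *
    normc (fourier b (x - t) - quad_kernel (c m) m (fourier b) x t) <=
    e * k.+1%:R `^ (- kappa) * m%:R `^ (1 - r).
  rewrite -ler_pdivlMl//.
  apply: (@ccvg_normc_le _ _ _ _ m (ccvgB (fcv _) Kcv)) => L mL.
  by rewrite ler_pdivlMl//; exact: partial_kernel_error_le.
have m0 : 0 < m%:R :> R by rewrite ltr0n expn_gt0.
have mr : m%:R `^ (1 - r) = m%:R * 2 `^ (- (r * k%:R)).
  rewrite powRD; last by rewrite (gt_eqF m0) implybT.
  rewrite powRr1 ?(ltW m0)//; congr (_ * _).
  by rewrite /m natrX -powR_mulrn// -powRrM mulrC mulNr.
rewrite mr -ler_pdivlMl// => /le_trans; apply.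
rewrite /level_weight /poisson -/m.
have -> : (poisson_den m (x - t))^-1 * (e * k.+1%:R `^ (- kappa) * (m%:R * 2 `^ (- (r * k%:R)))) =
   e * (2 `^ (- (r * k%:R)) * k.+1%:R `^ (- kappa)) * (m%:R / poisson_den m (x - t)) by ring.
rewrite ler_wpM2l//; first by apply: mulr_ge0; rewrite ?e_ge0 ?mulr_ge0 ?powR_ge0.
apply: ler_wpM2r; first by rewrite invr_ge0 ltW.
rewrite ler_nat; clear; lia.
Qed.

Lemma cmeasurable_fourier_comp d (X : measurableType d) (h : X -> R) :
  measurable_fun setT h -> cmeasurable (fun x => fourier b (h x)).
Proof. by move=> mh; apply: (cmeasurable_comp (cmeasurable_fourier r1 B0 bB) mh). Qed.

Lemma cmeasurable_shift_kernel d (X : measurableType d) (h1 h2 : X -> R) :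
  measurable_fun setT h1 -> measurable_fun setT h2 ->
  cmeasurable (fun x => shift_kernel (h1 x) (h2 x)).
Proof. by move=> m1 m2; apply: cmeasurable_fourier_comp; exact: measurable_funB. Qed.

Lemma cmeasurable_level_kernel k d (X : measurableType d) (h1 h2 : X -> R) :
  measurable_fun setT h1 -> measurable_fun setT h2 ->
  cmeasurable (fun x => level_kernel k (h1 x) (h2 x)).
Proof.
move=> m1 m2.
have mK m : cmeasurable (fun x => quad_kernel (c m) m (fourier b) (h1 x) (h2 x)).
  apply: cmeasurableM; first exact: cmeasurable_cst.
  apply: cmeasurable_sum => l _; apply: cmeasurableM.
    apply: cmeasurable_sum => j _; apply: cmeasurableM; first exact: cmeasurable_cst.
    apply: cmeasurable_cexp; apply: measurable_funM; first exact: measurable_cst.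
    by apply: measurable_funB => //; exact: measurable_cst.
  apply: cmeasurable_fourier_comp; apply: measurable_funB => //; exact: measurable_cst.
by case: k => [|k]; [exact: mK|apply: cmeasurableB; exact: mK].
Qed.

Let integral_normc_le (f : measurableTypeR R -> R[i]) (al : R) (m : nat) (a : R) :
  cmeasurable f -> 0 <= al -> (forall s : R, normc (f s) <= al * poisson m (a - s)) ->
  (\int[circle]_s (normc (f s))%:E <= (al * 2)%:E)%E.
Proof.
move=> mf al0 fal.
have mp : measurable_fun setT (fun s : measurableTypeR R => (poisson m (a - (s : R)))%:E).
  apply/measurable_EFinP; apply: measurable_poisson.
  by apply: measurable_funB => //; exact: measurable_cst.
apply: (@le_trans _ _ (\int[circle]_s (al%:E * (poisson m (a - (s : R)))%:E))%E).
  apply: ge0_le_integral => //.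
  - by move=> s _; rewrite lee_fin normc_ge0.
  - exact: emeasurable_normc.
  - exact: measurable_funeM.
  - by move=> s _; rewrite -EFinM lee_fin.
rewrite ge0_integralZl//; last by move=> s _; rewrite lee_fin poisson_ge0.
by rewrite EFinM lee_wpmul2l ?lee_fin// integral_poisson_subr.
Qed.

Let integral_normcD_le (f g1 g2 : measurableTypeR R -> R[i]) (a1 a2 : R) :
  cmeasurable g1 -> cmeasurable g2 -> (forall s, f s = g1 s - g2 s) ->
  (\int[circle]_s (normc (g1 s))%:E <= a1%:E)%E ->
  (\int[circle]_s (normc (g2 s))%:E <= a2%:E)%E ->
  (\int[circle]_s (normc (f s))%:E <= (a1 + a2)%:E)%E.
Proof.
move=> m1 m2 fE g1a g2a.
apply: (@le_trans _ _ (\int[circle]_s ((normc (g1 s))%:E + (normc (g2 s))%:E))%E).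
  apply: ge0_le_integral => //.
  - by move=> s _; rewrite lee_fin normc_ge0.
  - by under eq_fun do rewrite fE; apply: emeasurable_normc; exact: cmeasurableB.
  - by apply: emeasurable_funD; exact: emeasurable_normc.
  - by move=> s _; rewrite fE -EFinD lee_fin normcB.
rewrite ge0_integralD//; do ?exact: emeasurable_normc.
- by rewrite EFinD leeD.
- by move=> s _; rewrite lee_fin normc_ge0.
- by move=> s _; rewrite lee_fin normc_ge0.
Qed.

(** Dominates the three bounds required by [smolyak_bound]: that of the series of the mask, that of
    the level errors (the 2 is the Poisson mean), and that of the differences, where one more level
    costs 2^r 2^kappa. *)
Definition kernel_const : R :=
  mask_bound + fourier_tail r mask_bound 0 + e * 2 * (2 `^ r * 2 `^ kappa + 1).

(* Exchanging the variables turns column integrals into row integrals. *)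
Definition flip_kernel (f : bool) (K : R -> R -> R[i]) x t := if f then K t x else K x t.

Lemma level_error_flip f k x t :
  level_error (flip_kernel f shift_kernel) (fun k => flip_kernel f (level_kernel k)) k x t =
  flip_kernel f (level_error shift_kernel level_kernel k) x t.
Proof. by case: f. Qed.

Let mid (f : bool) (K : R -> R -> R[i]) (a : R) :
  (forall d (X : measurableType d) (h1 h2 : X -> R), measurable_fun setT h1 ->
    measurable_fun setT h2 -> cmeasurable (fun x => K (h1 x) (h2 x))) ->
  cmeasurable (flip_kernel f K a : measurableTypeR R -> R[i]).
Proof. by move=> H; case: f; apply: H => //; exact: measurable_cst. Qed.

Lemma cmeasurable_flip_shift f a :
  cmeasurable (flip_kernel f shift_kernel a : measurableTypeR R -> R[i]).
Proof. by apply: mid => d X h1 h2; exact: cmeasurable_shift_kernel. Qed.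

Lemma cmeasurable_flip_level f k a :
  cmeasurable (flip_kernel f (level_kernel k) a : measurableTypeR R -> R[i]).
Proof. by apply: mid => d X h1 h2; exact: cmeasurable_level_kernel. Qed.

Let tail0 : 0 <= fourier_tail r mask_bound 0.
Proof.
rewrite /fourier_tail; have := tail_const_ge0 r1; move: (tail_const r) => t t0.
by rewrite !mulr_ge0 ?powR_ge0// mask_bound_ge0.
Qed.

Lemma kernel_const_ge0 : 0 <= kernel_const.
Proof.
rewrite /kernel_const; have := e_ge0; have := tail0; have := mask_bound_ge0.
move: (fourier_tail r mask_bound 0) => t; move: mask_bound e => B e' ? ? ?.
by rewrite !addr_ge0 ?mulr_ge0 ?addr_ge0 ?mulr_ge0 ?powR_ge0.
Qed.

Lemma shift_kernel_integral_le f a :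
  (\int[circle]_s (normc (flip_kernel f shift_kernel a s))%:E <=
   (mask_bound + fourier_tail r mask_bound 0)%:E)%E.
Proof.
apply: (@le_trans _ _ (\int[circle]_s (mask_bound + fourier_tail r mask_bound 0)%:E)%E).
  apply: ge0_le_integral => //.
  - by move=> s _; rewrite lee_fin normc_ge0.
  - by apply: emeasurable_normc; exact: cmeasurable_flip_shift.
  - by move=> s _; rewrite lee_fin; case: f; exact: fourier_bounded.
rewrite integral_cst// [X in (_ * X)%E](@probability_setT _ _ _ circle) mule1//.
Qed.

Lemma level_error_integral_le f k a :
  (\int[circle]_s (normc (flip_kernel f (level_error shift_kernel level_kernel k) a s))%:E <=
   (e * 2 * level_weight r kappa k)%:E)%E.
Proof.
rewrite mulrAC; apply: (@integral_normc_le _ _ (2 ^ k) a).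
- apply: mid => d X h1 h2 m1 m2; apply: cmeasurableB; first exact: cmeasurable_shift_kernel.
  by apply: cmeasurable_sum => l _; exact: cmeasurable_level_kernel.
- by apply: mulr_ge0; [exact: e_ge0|exact: level_weight_ge0].
- move=> s; case: f; rewrite /flip_kernel ?kernel_error_le//.
  by rewrite -poissonN opprB kernel_error_le.
Qed.

Lemma level_weight_step k :
  level_weight r kappa k <= 2 `^ r * 2 `^ kappa * level_weight r kappa k.+1.
Proof.
rewrite /level_weight mulrACA; apply: ler_pM; rewrite ?powR_ge0//.
  rewrite -powRD; last by rewrite pnatr_eq0 implybT.
  by rewrite (_ : r - r * k.+1%:R = - (r * k%:R)) // -natr1; ring.
have -> : 2 `^ kappa * k.+2%:R `^ (- kappa) = (k.+2%:R / 2) `^ (- kappa).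
  rewrite powRM// ?invr_ge0// -powR_inv1// -powRrM mulN1r opprK mulrC//.
rewrite powR_antimono ?ltr0n ?divr_gt0//.
rewrite ler_pdivrMr// -natrM ler_nat; clear; lia.
Qed.

(** Each q_k is a difference of errors: q_0 = phi - E_0 and q_(k+1) = E_k - E_(k+1). The coarser
    weight is compared with the finer one by [level_weight_step]. *)
Lemma level_kernel_integral_le f k a :
  (\int[circle]_s (normc (flip_kernel f (level_kernel k) a s))%:E <=
   (kernel_const * level_weight r kappa k)%:E)%E.
Proof.
have mE j : cmeasurable (flip_kernel f (level_error shift_kernel level_kernel j) a
    : measurableTypeR R -> R[i]).
  apply: mid => d X h1 h2 m1 m2; apply: cmeasurableB; first exact: cmeasurable_shift_kernel.
  by apply: cmeasurable_sum => l _; exact: cmeasurable_level_kernel.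
case: k => [|k].
  apply: le_trans (integral_normcD_le (cmeasurable_flip_shift f a) (mE 0%N) _
    (shift_kernel_integral_le f a) (level_error_integral_le f 0 a)) _.
    move=> s; case: f {mE}; rewrite /flip_kernel level_error_quad /shift_kernel /level_kernel;
    by rewrite opprB addrC subrK.
  have -> : level_weight r kappa 0 = 1 by rewrite /level_weight mulr0 oppr0 powRr0 powR1 mulr1.
  rewrite lee_fin !mulr1 /kernel_const lerD2l ler_peMr//.
    by rewrite pmulr_lge0 ?e_ge0.
  by rewrite lerDr mulr_ge0 ?powR_ge0.
apply: le_trans (integral_normcD_le (mE k) (mE k.+1) _
    (level_error_integral_le f k a) (level_error_integral_le f k.+1 a)) _.
  move=> s; case: f {mE}; rewrite /flip_kernel !level_error_quad /level_kernel;
  by ring.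
rewrite lee_fin -mulrDr.
apply: (@le_trans _ _ (e * 2 * (2 `^ r * 2 `^ kappa + 1) * level_weight r kappa k.+1)).
  rewrite -[leRHS]mulrA; apply: ler_wpM2l; first by rewrite pmulr_lge0 ?e_ge0.
  by rewrite mulrDl mul1r lerD2r; exact: level_weight_step.
by rewrite ler_wpM2r ?level_weight_ge0// lerDr; apply: addr_ge0; rewrite ?mask_bound_ge0 ?tail0.
Qed.

Lemma smolyak_kernel_bound f d M m (x : d.-tuple R) : (m <= M)%N ->
  (\int[torus d]_t (normc (smolyak_error (flip_kernel f shift_kernel)
      (fun k => flip_kernel f (level_kernel k)) M m x t))%:E <=
    (d%:R * kernel_const ^+ d * (level_weight r kappa m * m.+1%:R ^+ d.-1))%:E)%E.
Proof.
move=> mM; apply: smolyak_bound => //.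
- exact: kernel_const_ge0.
- by move=> a; exact: cmeasurable_flip_shift.
- by move=> k a; exact: cmeasurable_flip_level.
- move=> a; apply: (le_trans (shift_kernel_integral_le f a)).
  rewrite lee_fin lerDl; apply: mulr_ge0; first by rewrite pmulr_lge0 ?e_ge0.
  by rewrite addr_ge0// mulr_ge0// powR_ge0.
- by move=> k a; exact: level_kernel_integral_le.
- move=> k a; under eq_integral do rewrite level_error_flip.
  apply: (le_trans (level_error_integral_le f k a)).
  rewrite lee_fin ler_wpM2r ?level_weight_ge0// /kernel_const.
  have := mulr_ge0 (powR_ge0 (2:R) r) (powR_ge0 (2:R) kappa).
  move: (_ `^ r * _) => z z0; have := mulr_ge0 e_ge0 z0; have := tail0.
  by have := mask_bound_ge0; have := e_ge0; lra.
Qed.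

Lemma cmeasurable_smolyak_kernel d M m :
  cmeasurable (fun w : d.-tuple R * d.-tuple R =>
    smolyak_error shift_kernel level_kernel M m w.1 w.2).
Proof.
have m1 (l : 'I_d) : measurable_fun setT (fun w : d.-tuple R * d.-tuple R => tnth w.1 l).
  by apply: (measurableT_comp (measurable_tnth l)); exact: measurable_fst.
have m2 (l : 'I_d) : measurable_fun setT (fun w : d.-tuple R * d.-tuple R => tnth w.2 l).
  by apply: (measurableT_comp (measurable_tnth l)); exact: measurable_snd.
apply: cmeasurableB.
  by apply: cmeasurable_prod => l _; exact: cmeasurable_shift_kernel.
apply: cmeasurable_sum => k _; apply: cmeasurable_prod => l _.
exact: cmeasurable_level_kernel.
Qed.

End LevelKernels.

(** * Lebesgue norms on a probability space *)

Section LnormTools.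
Context {R : realType} d (T : measurableType d) (P : probability T R).
Local Notation normc := (@Normc.normc R).

Lemma Lnorm_le (p : \bar R) (f g : T -> \bar R) : (1 <= p)%E ->
  measurable_fun setT f -> measurable_fun setT g ->
  (forall x, 0 <= f x)%E -> (forall x, f x <= g x)%E ->
  (Lnorm P p f <= Lnorm P p g)%E.
Proof.
move=> p1 mf mg f0 fg.
have g0 x : (0 <= g x)%E by exact: le_trans (f0 x) (fg x).
case: p p1 => [p||//]; last first.
  by move=> _; rewrite !Lnorm_oo; apply: le_ess_sup; apply: aeW => x /=; rewrite !gee0_abs.
rewrite lee_fin => p1; rewrite unlock /=.
have p0 : 0 <= p by exact: le_trans ler01 p1.
have I0 (h : T -> \bar R) : (0 <= \int[P]_x (`|h x| `^ p))%E.
  by apply: integral_ge0 => x _; exact: poweR_ge0.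
apply: gt0_ler_poweR; rewrite ?invr_ge0// ?in_itv/= ?leey ?andbT//.
apply: ge0_le_integral => //.
- by move=> x _; exact: poweR_ge0.
- by apply: (measurableT_comp (measurable_poweR _)); exact: measurableT_comp.
- by apply: (measurableT_comp (measurable_poweR _)); exact: measurableT_comp.
- move=> x _; apply: gt0_ler_poweR => //; rewrite ?in_itv/= ?leey ?andbT//.
  by rewrite !gee0_abs.
Qed.

(** For a non-integrable g the right-hand side is infinite. *)
Lemma normc_cintegral_le (g : T -> R[i]) : cmeasurable g ->
  ((normc (cintegral P g))%:E <= 2%:E * \int[P]_x (normc (g x))%:E)%E.
Proof.
move=> mg; have [goo|goo] := ltP (\int[P]_x (normc (g x))%:E)%E +oo%E.
  by apply: normc_cintegral; exact/cintegrableP.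
by move: goo; rewrite leye_eq => /eqP ->; rewrite gt0_muley ?leey// lte_fin.
Qed.

Lemma Lnorm_cintegrable (p : \bar R) (g : T -> R[i]) : (1 <= p)%E -> cmeasurable g ->
  (Lnorm P p (fun x => (normc (g x))%:E) < +oo)%E -> cintegrable P g.
Proof.
move=> p1 mg goo; apply/cintegrableP; split => //.
have gp : (fun x => normc (g x)) \in Lfun P p.
  by rewrite inE; apply/andP; split; rewrite inE//=; exact: measurable_normc.
have Pfin : P setT \is a fin_num by exact: fin_num_measure.
have := Lfun_subset (lexx 1%E) p1 Pfin p1 gp.
move=> /Lfun1_integrable/integrableP[_]; congr (_ < _)%E.
by apply: eq_integral => x _ /=; rewrite ger0_norm ?normc_ge0.
Qed.

Lemma ae_eq_cintegral (f g : T -> R[i]) : cmeasurable f -> cmeasurable g ->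
  (\forall x \ae P, f x = g x) -> cintegral P f = cintegral P g.
Proof.
move=> [f1 f2] [g1 g2] fg; rewrite /cintegral /Rintegral; congr (fine _ +i* fine _).
- apply: ae_eq_integral => //; [exact/measurable_EFinP|exact/measurable_EFinP|].
  by apply: filterS fg => x -> _.
- apply: ae_eq_integral => //; [exact/measurable_EFinP|exact/measurable_EFinP|].
  by apply: filterS fg => x -> _.
Qed.

End LnormTools.

(** * Fourier coefficients of convolutions *)

Section ConvolutionCoefficients.
Context {R : realType} d (X : measurableType d) (mu : probability X R).
Local Notation circle := (@uniform_prob R 0 (2 * pi) twopi_gt0).
Local Notation normc := (@Normc.normc R).
Variables (r B : R) (b : int -> R).
Hypotheses (r1 : 1 < r) (B0 : 0 <= B).
Hypothesis bB : forall j, `|b j| <= B * `|j|.+1%:R `^ (- r).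
Variables (tau : X -> R) (u : X -> R[i]).
Hypothesis mtau : measurable_fun setT tau.
Hypothesis iu : cintegrable mu u.

(** The map [tau] picks the relevant coordinate: for a source on T it is the only one, for a density
    on T^d it is the i-th, and then this is a coefficient of the marginal. Both cases can thus be
    compared. *)
Definition coef (k : int) : R[i] :=
  cintegral mu (fun t => cexp (- (k%:~R * tau t)) * u t).

Lemma cintegrable_cexpM (h : X -> R) : measurable_fun setT h ->
  cintegrable mu (fun t => cexp (h t) * u t).
Proof.
move=> mh; apply: (@cintegrable_bddM _ _ _ _ _ _ 1) => //; first exact: cmeasurable_cexp.
by move=> x; rewrite normc_cexp.
Qed.

Let mtauk (k : int) (a : R) : measurable_fun setT (fun t => k%:~R * (a - tau t)).
Proof.
apply: measurable_funM; first exact: measurable_cst.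
by apply: measurable_funB => //; exact: measurable_cst.
Qed.

Let mtauN (k : int) : measurable_fun setT (fun t => - (k%:~R * tau t)).
Proof.
by apply: measurableT_comp => //; apply: measurable_funM => //; exact: measurable_cst.
Qed.

Lemma cintegral_fsumM n (a : int -> R) (s : R) :
  cintegral mu (fun t => fsum n a (s - tau t) * u t) =
  symsum n (fun j => (a j)%:C * cexp (j%:~R * s) * coef j).
Proof.
have -> : (fun t => fsum n a (s - tau t) * u t) = (fun t => \sum_(l < n.*2.+1)
    (a (l%:Z - n%:Z))%:C * cexp ((l%:Z - n%:Z)%:~R * s) *
    (cexp (- ((l%:Z - n%:Z)%:~R * tau t)) * u t)).
  apply/funext => t; rewrite /fsum /symsum mulr_suml; apply: eq_bigr => l _.
  by rewrite mulrBr cexpD !mulrA.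
rewrite cintegral_sum => [|l _].
  apply: eq_bigr => l _; rewrite cintegralZ//.
  exact: (cintegrable_cexpM (mtauN _)).
by apply: cintegrableZ; exact: (cintegrable_cexpM (mtauN _)).
Qed.

Let u1 : R := fine (\int[mu]_x (normc (u x))%:E)%E.

Let u1E : (u1%:E = \int[mu]_x (normc (u x))%:E)%E.
Proof.
by rewrite /u1 fineK//; apply: integrable_fin_num => //; exact: cintegrable_integrable_normc.
Qed.

Let u1_ge0 : 0 <= u1.
Proof. by rewrite -lee_fin u1E; apply: integral_ge0 => x _; rewrite lee_fin normc_ge0. Qed.

Let mfour (s : R) : cmeasurable (fun t => fourier b (s - tau t)).
Proof.
apply: (cmeasurable_comp (cmeasurable_fourier r1 B0 bB)).
by apply: measurable_funB => //; exact: measurable_cst.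
Qed.

Let ifour (s : R) : cintegrable mu (fun t => fourier b (s - tau t) * u t).
Proof. exact: (cintegrable_bddM (mfour s) (fun t => fourier_bounded r1 B0 bB _) iu). Qed.

Let conv s := cintegral mu (fun t => fourier b (s - tau t) * u t).

Let cmeasurable_conv : cmeasurable (conv : measurableTypeR R -> R[i]).
Proof.
apply: (@cmeasurable_cintegral2 _ _ _ (measurableTypeR R) X mu
  (fun w => fourier b ((w.1 : R) - tau w.2) * u w.2)).
apply: cmeasurableM.
  apply: (cmeasurable_comp (cmeasurable_fourier r1 B0 bB)).
  apply: measurable_funB; first exact: measurable_fst.
  exact: (measurableT_comp mtau measurable_snd).
exact: (cmeasurable_comp (cintegrable_measurable iu) measurable_snd).
Qed.

Let conv_fsum_le n s :
  normc (conv s - symsum n (fun j => (b j)%:C * cexp (j%:~R * s) * coef j)) <=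
  2 * (fourier_tail r B n * u1).
Proof.
have ifs : cintegrable mu (fun t => fsum n b (s - tau t) * u t).
  apply: cintegrable_bddM => // [|t]; last exact: fsum_norm_le.
  apply: cmeasurable_sum => l _; apply: cmeasurableM; first exact: cmeasurable_cst.
  exact: cmeasurable_cexp.
rewrite -cintegral_fsumM /conv -(cintegralB (ifour s) ifs) -lee_fin.
apply: (le_trans (normc_cintegral (cintegrableB (ifour s) ifs))).
rewrite [leRHS]EFinM lee_wpmul2l ?lee_fin// EFinM u1E.
have inu := cintegrable_integrable_normc iu.
rewrite -ge0_integralZl//; last 3 first.
- exact: measurable_int inu.
- by move=> x _; rewrite lee_fin normc_ge0.
- rewrite lee_fin (le_trans (normc_ge0 _) (fourier_fsum_le r1 B0 bB n 0))//.
apply: ge0_le_integral => //.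
- by move=> x _; rewrite lee_fin normc_ge0.
- by apply: emeasurable_normc; exact: cintegrable_measurable (cintegrableB (ifour s) ifs).
- by apply: measurable_funeM; exact: measurable_int inu.
- move=> x _; rewrite -mulrBl Normc.normcM -EFinM lee_fin ler_wpM2r ?normc_ge0//.
  exact: fourier_fsum_le.
Qed.

(* Truncating the series [fourier b] uniformly avoids exchanging integrals. *)
Lemma convolution_coef k :
  cintegral circle (fun s => cexp (- (k%:~R * (s : R))) *
    cintegral mu (fun t => fourier b ((s : R) - tau t) * u t)) = (b k)%:C * coef k.
Proof.
set L := LHS; suff : forall e, 0 < e -> normc (L - (b k)%:C * coef k) <= e.
  move=> H; apply/eqP; rewrite -subr_eq0; apply/eqP/Normc.eq0_normc/le_anti.
  rewrite normc_ge0 andbT; apply/ler_addgt0Pr => e e0; rewrite add0r; exact: H.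
(* The tail is multiplied by a factor 2 of [normc_cintegral] for each of the two integrals and by
   the mass u1 of |u|; adding 1 keeps the divisor positive. *)
move=> e e0; have u4 : 0 < 4 * (u1 + 1) by rewrite mulr_gt0// ltr_wpDl.
have [n0 Hn] := fourier_tail_small r1 B0 (divr_gt0 e0 u4).
(* The truncation must also contain the frequency k. *)
pose n := maxn n0 `|k|%N.
have tn := Hn n (leq_maxl _ _).
have mj (j : int) : measurable_fun setT (fun s : measurableTypeR R => j%:~R * (s : R)).
  by apply: measurable_funM => //; exact: measurable_cst.
have mc (j : int) : cmeasurable (fun s : measurableTypeR R => cexp (- (j%:~R * (s : R)))).
  by apply: cmeasurable_cexp; apply: measurableT_comp => //; exact: mj.
pose S (s : measurableTypeR R) := symsum n (fun j => (b j)%:C * coef j * cexp (j%:~R * (s : R))).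
have SE s : S s = symsum n (fun j => (b j)%:C * cexp (j%:~R * s) * coef j).
  by apply: eq_bigr => l _; rewrite mulrAC.
have mS : cmeasurable S.
  apply: cmeasurable_sum => l _; apply: cmeasurableM; first exact: cmeasurable_cst.
  by apply: cmeasurable_cexp; exact: mj.
have Sb s : normc (S s) <= symsum n (fun j => normc ((b j)%:C * coef j)).
  apply: (le_trans (normc_symsum _ _)); apply: symsum_le => j _.
  by rewrite Normc.normcM normc_cexp mulr1.
pose D s := conv s - S s.
have mD : cmeasurable (D : measurableTypeR R -> R[i]) by exact: cmeasurableB.
have Db s : normc (D s) <= 2 * (fourier_tail r B n * u1) by rewrite /D SE conv_fsum_le.
have iS : cintegrable circle (fun s => cexp (- (k%:~R * (s : R))) * S s).
  apply: bounded_cintegrable (cmeasurableM (mc k) mS) _ => s.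
  by rewrite Normc.normcM normc_cexp mul1r; exact: Sb.
have iD : cintegrable circle (fun s => cexp (- (k%:~R * (s : R))) * D s).
  apply: bounded_cintegrable (cmeasurableM (mc k) mD) _ => s.
  by rewrite Normc.normcM normc_cexp mul1r; exact: Db.
have -> : L = cintegral circle (fun s => cexp (- (k%:~R * (s : R))) * D s) +
              cintegral circle (fun s => cexp (- (k%:~R * (s : R))) * S s).
  rewrite -cintegralD//; congr cintegral; apply/funext => s.
  by rewrite -mulrDr /D subrK.
rewrite cintegral_trig_coef leq_maxr addrK -lee_fin.
apply: (le_trans (normc_cintegral iD)).
apply: (@le_trans _ _ (2%:E * \int[circle]_s (2 * (fourier_tail r B n * u1))%:E)%E).
  rewrite lee_wpmul2l ?lee_fin//; apply: ge0_le_integral => //.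
  - by move=> x _; rewrite lee_fin normc_ge0.
  - by apply: emeasurable_normc; exact: cintegrable_measurable iD.
  - by move=> s _; rewrite lee_fin Normc.normcM normc_cexp mul1r; exact: Db.
rewrite integral_cst// [X in (_ * (_ * X))%E](@probability_setT _ _ _ circle) mule1.
rewrite -EFinM lee_fin.
have : fourier_tail r B n * u1 <= e / (4 * (u1 + 1)) * u1 by rewrite ler_wpM2r.
move=> h; apply: (@le_trans _ _ (4 * (e / (4 * (u1 + 1)) * u1))); first by lra.
have -> : 4 * (e / (4 * (u1 + 1)) * u1) = e * (u1 / (u1 + 1)).
  by field; rewrite gt_eqF// ltr_wpDl.
apply: ler_piMr; first exact: ltW.
by rewrite ler_pdivrMr ?ltr_wpDl// mul1r lerDl.
Qed.

End ConvolutionCoefficients.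

(** * The operators q_k as integral operators *)
Section Sections.
Context {R : realType}.
Local Notation circle := (@uniform_prob R 0 (2 * pi) twopi_gt0).
Local Notation normc := (@Normc.normc R).
Variables (lam theta : R -> R) (p : \bar R) (r B : R).
Hypotheses (p1 : (1 <= p)%E) (r1 : 1 < r) (B0 : 0 <= B).

Definition mask_coef (j : int) : R := lam j%:~R.
Definition cutoff_coef (m : nat) (j : int) : R := theta (j%:~R / m%:R).

Hypothesis bB : forall j, `|mask_coef j| <= B * `|j|.+1%:R `^ (- r).
Hypothesis lam0 : forall t, lam t != 0.
Hypothesis cutoff : is_cutoff theta.

Lemma phiE d (x : d.-tuple R) : phi lam x = \prod_(l < d) fourier mask_coef (tnth x l).
Proof.
apply: (@trig_series_prod _ _ (fun=> mask_coef) (fun l => fourier mask_coef (tnth x l))).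
by move=> l; exact: (fsum_ccvg r1 B0 bB).
Qed.

Lemma convolution1E (g : 1.-tuple R -> R[i]) (s : R) :
  convolution (@phi R lam 1) g [tuple s] =
  cintegral (torus 1) (fun t => fourier mask_coef (s - tnth t ord0) * g t).
Proof.
congr cintegral; apply/funext => t.
by rewrite phiE big_ord1 tnth_vsub.
Qed.

Section OneSection.
Variables (d : nat) (i : 'I_d) (g u : d.-tuple R -> R[i]) (Bd : R).
Hypotheses (gp : in_Lp p g) (mu : cmeasurable u) (pu : torus_periodic u).
Hypotheses (Bd0 : 0 <= Bd) (ug : forall t, normc (u t) <= Bd * normc (g t)).

Definition section_conv (s : R) : R[i] :=
  cintegral (torus d) (fun t => fourier mask_coef (s - tnth t i) * u t).

(** Coordinate i of t is integrated as well but overwritten, which avoids reindexing to d - 1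
    variables. *)
Definition section_source (y : 1.-tuple R) : R[i] :=
  cintegral (torus d) (fun t => u (vset t i (tnth y ord0))).

Let ig : cintegrable (torus d) g.
Proof. by have [_ mg goo] := gp; exact: Lnorm_cintegrable p1 mg goo. Qed.

Let iu : cintegrable (torus d) u.
Proof.
apply: (cintegrable_normc_le mu _ ug).
exact: (integrableZl measurableT Bd (cintegrable_integrable_normc ig)).
Qed.

Let mvset1 : measurable_fun setT
  (fun w : 1.-tuple R * d.-tuple R => vset w.2 i (tnth w.1 ord0)).
Proof.
have mw : measurable_fun setT (fun w : 1.-tuple R * d.-tuple R =>
    (tnth w.1 ord0 : measurableTypeR R, w.2)).
  apply: measurable_fun_pair; last exact: measurable_snd.
  exact: (measurableT_comp (measurable_tnth ord0) measurable_fst).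
exact: (measurableT_comp (measurable_vset i) mw).
Qed.

Let cmeasurable_section_source : cmeasurable section_source.
Proof.
apply: (@cmeasurable_cintegral2 _ _ _ _ _ (torus d)
  (fun w : 1.-tuple R * d.-tuple R => u (vset w.2 i (tnth w.1 ord0)))).
exact: cmeasurable_comp mu mvset1.
Qed.

Let torus1_vset (v : d.-tuple R -> \bar R) : measurable_fun setT v ->
  (forall t, 0 <= v t)%E ->
  (\int[torus 1]_y \int[torus d]_t v (vset t i (tnth y ord0)) = \int[torus d]_t v t)%E.
Proof.
move=> mv v0; rewrite -(torus_vset i mv v0).
rewrite -(@ge0_torus1 _ (fun y => \int[torus d]_t v (vset t i (tnth y ord0)))%E) => [//||y].
  apply: (@measurable_fun_fubini_tonelli_F _ _ _ _ _ (torus d)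
    (fun w : 1.-tuple R * d.-tuple R => v (vset w.2 i (tnth w.1 ord0)))) => //.
  exact: (measurableT_comp mv mvset1).
by apply: integral_ge0.
Qed.

Let section_source_Lp : (cnorm p section_source < +oo)%E.
Proof.
have [_ mg goo] := gp.
(* The 2 is that of [normc_cintegral_le]; the 1 gives the strict positivity asked for by
   [Lnorm_average], used here with a constant kernel. *)
pose A : R := 2 * (Bd + 1).
have A0 : 0 < A by rewrite mulr_gt0// ltr_wpDl.
have mng := measurable_normc mg.
have mAg : measurable_fun setT (fun w : 1.-tuple R * d.-tuple R =>
    (A * normc (g (vset w.2 i (tnth w.1 ord0))))%:E).
  apply/measurable_EFinP; apply: measurable_funM; first exact: measurable_cst.
  exact: (measurableT_comp mng mvset1).
have Ag0 (w : 1.-tuple R * d.-tuple R) : (0 <= (A * normc (g (vset w.2 i (tnth w.1 ord0))))%:E)%E.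
  by rewrite lee_fin mulr_ge0 ?normc_ge0// ltW.
apply: (@le_lt_trans _ _ (Lnorm (torus 1) p (fun y => \int[torus d]_t
    (A * normc (g (vset t i (tnth y ord0))))%:E)%E)).
  apply: Lnorm_le => //.
  - exact: emeasurable_normc.
  - exact: (@measurable_fun_fubini_tonelli_F _ _ _ _ _ (torus d)
      (fun w : 1.-tuple R * d.-tuple R => (A * normc (g (vset w.2 i (tnth w.1 ord0))))%:E)).
  - by move=> y; rewrite lee_fin normc_ge0.
  - move=> y.
    have muy : cmeasurable (fun t => u (vset t i (tnth y ord0))).
      exact: (cmeasurable_comp mu (measurableT_comp mvset1 (measurable_pair1 y))).
    apply: (le_trans (normc_cintegral_le (torus d) muy)).
    rewrite -ge0_integralZl//; last 2 first.
      exact: emeasurable_normc.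
      by move=> t _; rewrite lee_fin normc_ge0.
    apply: ge0_le_integral => //.
    + by move=> t _; rewrite -EFinM lee_fin mulr_ge0 ?normc_ge0.
    + by apply: measurable_funeM; exact: emeasurable_normc.
    + exact: (measurableT_comp mAg (measurable_pair1 y)).
    + move=> t _; rewrite -EFinM lee_fin /A -mulrA ler_wpM2l//.
      by rewrite (le_trans (ug _))// ler_wpM2r ?normc_ge0// lerDl.
have kpsi (v : d.-tuple R -> \bar R) : measurable_fun setT v -> (forall t, 0 <= v t)%E ->
    (\int[torus 1]_y \int[torus d]_t ((cst A (y, t))%:E * v (vset t i (tnth y ord0))) <=
     A%:E * \int[torus d]_t v t)%E.
  move=> mv v0.
  have mvy (y : 1.-tuple R) : measurable_fun setT (fun t => v (vset t i (tnth y ord0))).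
    exact: (measurableT_comp mv (measurableT_comp mvset1 (measurable_pair1 y))).
  have -> : (\int[torus 1]_y \int[torus d]_t ((cst A (y, t))%:E * v (vset t i (tnth y ord0))) =
     \int[torus 1]_y (A%:E * \int[torus d]_t v (vset t i (tnth y ord0))))%E.
    by apply: eq_integral => y _; rewrite /= ge0_integralZl// lee_fin ltW.
  rewrite ge0_integralZl//.
  - by rewrite torus1_vset.
  - apply: (@measurable_fun_fubini_tonelli_F _ _ _ _ _ (torus d)
      (fun w : 1.-tuple R * d.-tuple R => v (vset w.2 i (tnth w.1 ord0)))) => //.
    exact: (measurableT_comp mv mvset1).
  - by move=> y _; exact: integral_ge0.
  - by rewrite lee_fin ltW.
have kA (y : 1.-tuple R) : (\int[torus d]_t (cst A (y, t))%:E <= A%:E)%E.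
  by rewrite /= integral_cst// [X in (_ * X)%E](@probability_setT _ _ _ (torus d)) mule1.
apply: le_lt_trans (@Lnorm_average _ _ _ _ _ _ _ (torus 1) (torus d) (torus d) (cst A)
  (fun w : 1.-tuple R * d.-tuple R => vset w.2 i (tnth w.1 ord0)) A
  (measurable_cst _) (fun _ => ltW A0) mvset1 A0 kA kpsi p (fun t => normc (g t)) p1 mng
  (fun t => normc_ge0 _)) _.
by apply: lte_mul_pinfty => //; rewrite lee_fin ltW.
Qed.

(** Fubini in the i-th variable: [cintegral_vset] resamples it, and the factor of phi, which depends
    on that variable alone, leaves the inner integral. *)
Lemma section_source_is_source :
  is_source lam p (fun y : 1.-tuple R => section_conv (tnth y ord0)) section_source.
Proof.
split; [split => //|].
- move=> y j; rewrite [j]ord1 /section_source; congr cintegral; apply/funext => t.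
  rewrite tnth_vset eqxx.
  set a := tnth y ord0.
  have -> : vset t i (a + 2 * pi) =
      vset (vset t i a) i (tnth (vset t i a) i + 2 * pi).
    by apply: eq_from_tnth => l; rewrite !tnth_vset eqxx; case: eqP.
  exact: pu.
- apply/funext => y.
  have [s ->] : exists s, y = [tuple s].
    exists (tnth y ord0); apply: eq_from_tnth => l; rewrite [l]ord1.
    by rewrite (tnth_nth 0).
  rewrite convolution1E -cintegral_torus1; last first.
    apply: cmeasurableM => //; apply: (cmeasurable_comp (cmeasurable_fourier r1 B0 bB)).
    by apply: measurable_funB; [exact: measurable_cst|exact: measurable_tnth].
  pose F t := fourier mask_coef (s - tnth t i) * u t.
  have mF : cmeasurable F.
    apply: cmeasurableM => //; apply: (cmeasurable_comp (cmeasurable_fourier r1 B0 bB)).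
    by apply: measurable_funB; [exact: measurable_cst|exact: measurable_tnth].
  have iF : cintegrable (torus d) F.
    apply: (cintegrable_bddM _ (fun t => fourier_bounded r1 B0 bB _) iu).
    apply: (cmeasurable_comp (cmeasurable_fourier r1 B0 bB)).
    by apply: measurable_funB; [exact: measurable_cst|exact: measurable_tnth].
  rewrite /section_conv -/F -(cintegral_vset i iF).
  apply: ae_eq_cintegral.
  + apply: (@cmeasurable_cintegral2 _ _ _ (measurableTypeR R) _ (torus d)
      (fun w => F (vset w.2 i (w.1 : R)))).
    exact: cmeasurable_comp mF (measurable_vset i).
  + apply: cmeasurableM.
      apply: (cmeasurable_comp (cmeasurable_fourier r1 B0 bB)).
      by apply: measurable_funB; [exact: measurable_cst|exact: (@measurable_id _ (measurableTypeR R) setT)].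
    exact: (cmeasurable_comp cmeasurable_section_source measurable_tuple1).
  have mnu := emeasurable_normc mu.
  have mN : measurable_fun setT (fun a : measurableTypeR R =>
      \int[torus d]_t (normc (u (vset t i (a : R))))%:E)%E.
    apply: (@measurable_fun_fubini_tonelli_F _ _ _ _ _ (torus d)
      (fun w : measurableTypeR R * d.-tuple R => (normc (u (vset w.2 i (w.1 : R))))%:E)).
      exact: (measurableT_comp mnu (measurable_vset i)).
    by move=> w; rewrite lee_fin normc_ge0.
  have iN : circle.-integrable setT (fun a : measurableTypeR R =>
      \int[torus d]_t (normc (u (vset t i (a : R))))%:E)%E.
    apply/integrableP; split => //.
    rewrite [X in (X < _)%E](_ : _ = \int[torus d]_t (normc (u t))%:E)%E; last first.
      rewrite -(torus_vset i mnu); last by move=> t; rewrite lee_fin normc_ge0.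
      apply: eq_integral => a _; rewrite gee0_abs//.
      by apply: integral_ge0 => t _; rewrite lee_fin normc_ge0.
    by have /cintegrableP[] := iu.
  (* Only almost every section of [u] is integrable. *)
  apply: filterS (integrable_ae measurableT iN) => a /(_ Logic.I) afin.
  rewrite /section_source -cintegralZ.
    by congr cintegral; apply/funext => t; rewrite /F tnth_vset eqxx.
  apply/cintegrableP; split.
    apply: (cmeasurable_comp mu).
    exact: (measurableT_comp (measurable_vset i) (measurable_pair1 (a : measurableTypeR R))).
  by rewrite -ge0_fin_numE//; apply: integral_ge0 => t _; rewrite lee_fin normc_ge0.
Qed.

(* Uses that [lam] does not vanish, so that its Fourier coefficients can be
   cancelled. *)
Lemma source_coef (g' : 1.-tuple R -> R[i]) (k : int) :
  is_source lam p (fun y : 1.-tuple R => section_conv (tnth y ord0)) g' ->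
  cintegrable (torus 1) g' /\
  coef (torus 1) (fun t => tnth t ord0) g' k = coef (torus d) (fun t => tnth t i) u k.
Proof.
move=> [[_ mg' goo'] fE].
have ig' : cintegrable (torus 1) g' := Lnorm_cintegrable p1 mg' goo'.
split => //.
have c1 := convolution_coef r1 B0 bB (@measurable_tnth _ _ 1 ord0) ig' k.
have c2 := convolution_coef r1 B0 bB (@measurable_tnth _ _ d i) iu k.
have bk : (mask_coef k)%:C != 0 by rewrite eq_complex /= eqxx andbT lam0.
apply: (mulfI bk); rewrite -c1 -c2; congr cintegral; apply/funext => s.
congr (_ * _); rewrite -convolution1E.
by have /(congr1 (fun f => f [tuple s])) := fE.
Qed.

Lemma Qop_section m (x : R) : (0 < m)%N ->
  Qop lam theta p m section_conv x =
  cintegral (torus d) (fun t =>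
    quad_kernel (cutoff_coef m) m (fourier mask_coef) x (tnth t i) * u t).
Proof.
move=> m0; rewrite /Qop; set g' := source _ _ _.
(* [xget] would return 0 if there were no source; the averaged one shows that the chosen function is
   a genuine source. *)
have sg' : is_source lam p (fun y : 1.-tuple R => section_conv (tnth y ord0)) g'.
  by apply: xgetPex; exists section_source; exact: section_source_is_source.
have VE (y : R) : Vop theta m g' [tuple y] =
    cintegral (torus d) (fun t => fsum m (cutoff_coef m) (y - tnth t i) * u t).
  rewrite (cintegral_fsumM (@measurable_tnth _ _ d i) iu).
  have [ig' _] := source_coef 0 sg'.
  transitivity (cintegral (torus 1) (fun t => fsum m (cutoff_coef m) (y - tnth t ord0) * g' t)).
    by congr cintegral; apply/funext => t; rewrite Hker_fsum// tnth_vsub.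
  rewrite (cintegral_fsumM (@measurable_tnth _ _ 1 ord0) ig').
  by apply: eq_bigr => l _; have [_ ->] := source_coef (l%:Z - m%:Z) sg'.
have iV (y : R) : cintegrable (torus d) (fun t => fsum m (cutoff_coef m) (y - tnth t i) * u t).
  apply: (cintegrable_bddM _ (fun t => fsum_norm_le _ _ _) iu).
  apply: cmeasurable_sum => l _; apply: cmeasurableM; first exact: cmeasurable_cst.
  apply: cmeasurable_cexp; apply: measurable_funM; first exact: measurable_cst.
  by apply: measurable_funB; [exact: measurable_cst|exact: measurable_tnth].
have -> : (fun t => quad_kernel (cutoff_coef m) m (fourier mask_coef) x (tnth t i) * u t) =
    (fun t => (2 * m + 1)%N%:R^-1 * \sum_(0 <= k < (2 * m).+1)
      fourier mask_coef (x - node m k) *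
      (fsum m (cutoff_coef m) (node m k - tnth t i) * u t)).
  apply/funext => t; rewrite /quad_kernel -mulrA mulr_suml; congr (_ * _).
  by apply: eq_bigr => k _; rewrite mulrAC mulrC.
rewrite cintegralZ; last by apply: cintegrable_sum => k _; exact: cintegrableZ.
congr (_ * _); rewrite cintegral_sum; last by move=> k _; exact: cintegrableZ.
apply: eq_bigr => k _; rewrite cintegralZ// VE mulrC; congr (_ * _).
by rewrite phiE big_ord1.
Qed.

End OneSection.

(** Closed under passing from phi to a level kernel in one variable: measurability and boundedness
    make products of such factors with g integrable, and periodicity in t makes them densities on
    the torus. *)
Definition admissible (K : R -> R -> R[i]) := [/\
  forall dsp (X : measurableType dsp) (h1 h2 : X -> R),
    measurable_fun setT h1 -> measurable_fun setT h2 ->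
    cmeasurable (fun x => K (h1 x) (h2 x)),
  exists2 Q : R, 0 <= Q & forall x t, normc (K x t) <= Q &
  forall x t, K x (t + 2 * pi) = K x t].

Local Notation shiftK := (shift_kernel mask_coef).
Local Notation levelK := (level_kernel mask_coef cutoff_coef).

Let cexp_per (j : int) (y : R) : cexp (j%:~R * (y - 2 * pi)) = cexp (j%:~R * y).
Proof.
have <- : cexp (j%:~R * (y - 2 * pi) + 2 * pi * j%:~R) = cexp (j%:~R * (y - 2 * pi)).
  by rewrite cexpD cexp_twopi_int mulr1.
by congr cexp; ring.
Qed.

Let fsum_per n a (y : R) : fsum n a (y - 2 * pi) = fsum n a y :> R[i].
Proof. by apply: eq_bigr => l _; rewrite cexp_per. Qed.

Lemma admissible_shift : admissible shiftK.
Proof.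
split.
- move=> dsp X h1 h2 m1 m2; apply: (cmeasurable_comp (cmeasurable_fourier r1 B0 bB)).
  exact: measurable_funB.
- exists (B + fourier_tail r B 0) => [|x t]; last exact: (fourier_bounded r1 B0 bB).
  exact: le_trans (normc_ge0 _) (fourier_bounded r1 B0 bB 0).
- move=> x t; rewrite /shift_kernel opprD addrA /fourier.
  by congr climn; apply/funext => n; rewrite fsum_per.
Qed.

Let admissible_quad m :
  admissible (quad_kernel (cutoff_coef m) m (fourier mask_coef)).
Proof.
split.
- move=> dsp X h1 h2 m1 m2.
  apply: cmeasurableM; first exact: cmeasurable_cst.
  apply: cmeasurable_sum => l _; apply: cmeasurableM.
    apply: cmeasurable_sum => j _; apply: cmeasurableM; first exact: cmeasurable_cst.
    apply: cmeasurable_cexp; apply: measurable_funM; first exact: measurable_cst.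
    by apply: measurable_funB => //; exact: measurable_cst.
  apply: (cmeasurable_comp (cmeasurable_fourier r1 B0 bB)).
  by apply: measurable_funB => //; exact: measurable_cst.
- pose S := symsum m (fun j => `|cutoff_coef m j|).
  pose Q := normc ((2 * m + 1)%N%:R^-1) *
    \sum_(0 <= k < (2 * m).+1) (S * (B + fourier_tail r B 0)).
  suff QP x t : normc (quad_kernel (cutoff_coef m) m (fourier mask_coef) x t) <= Q.
    by exists Q => //; exact: le_trans (normc_ge0 _) (QP 0 0).
  rewrite Normc.normcM ler_wpM2l ?normc_ge0//.
  apply: (le_trans (normc_sum _ _ _)); apply: ler_sum => k _.
  rewrite Normc.normcM ler_pM ?normc_ge0 ?fsum_norm_le//.
  exact: (fourier_bounded r1 B0 bB).
- move=> x t; congr (_ * _); apply: eq_bigr => k _; congr (_ * _).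
  by rewrite opprD addrA fsum_per.
Qed.

Lemma admissible_level k : admissible (levelK k).
Proof.
case: k => [|k]; first exact: admissible_quad.
have [m1 [Q1 Q10 b1] P1] := admissible_quad (2 ^ k.+1).
have [m2 [Q2 Q20 b2] P2] := admissible_quad (2 ^ k).
split.
- by move=> dsp X h1 h2 mh1 mh2; apply: cmeasurableB; [exact: m1|exact: m2].
- exists (Q1 + Q2) => [|x t]; first exact: addr_ge0.
  by apply: (le_trans (normcB _ _)); exact: lerD.
- by move=> x t; rewrite /level_kernel P1 P2.
Qed.

Section TensorOperators.
Variables (d : nat) (g : d.-tuple R -> R[i]).
Hypothesis gp : in_Lp p g.

Definition tensor_conv (K : 'I_d -> R -> R -> R[i]) (x : d.-tuple R) : R[i] :=
  cintegral (torus d) (fun t => \prod_(l < d) K l (tnth x l) (tnth t l) * g t).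

Lemma prod_bounded (K : 'I_d -> R -> R -> R[i]) (D : pred 'I_d) :
  (forall l, admissible (K l)) ->
  exists2 Q, 0 <= Q & forall x t : d.-tuple R,
    normc (\prod_(l < d | D l) K l (tnth x l) (tnth t l)) <= Q.
Proof.
move=> aK.
have /choice[Q HQ] : forall l, exists Q : R, 0 <= Q /\ forall x t, normc (K l x t) <= Q.
  by move=> l; have [_ [Q Q0 HQ] _] := aK l; exists Q.
exists (\prod_(l < d | D l) Q l) => [|x t].
  by apply: prodr_ge0 => l _; have [] := HQ l.
rewrite normc_prod; apply: ler_prod => l _; rewrite normc_ge0/=.
by have [_] := HQ l; exact.
Qed.

Lemma cmeasurable_prod_kernel (K : 'I_d -> R -> R -> R[i]) (D : pred 'I_d) (x : d.-tuple R) :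
  (forall l, admissible (K l)) ->
  cmeasurable (fun t : d.-tuple R => \prod_(l < d | D l) K l (tnth x l) (tnth t l)).
Proof.
move=> aK; apply: cmeasurable_prod => l _; have [mK _ _] := aK l.
by apply: mK; [exact: measurable_cst|exact: measurable_tnth].
Qed.

Lemma cintegrable_tensor (K : 'I_d -> R -> R -> R[i]) (x : d.-tuple R) :
  (forall l, admissible (K l)) ->
  cintegrable (torus d) (fun t => \prod_(l < d) K l (tnth x l) (tnth t l) * g t).
Proof.
move=> aK; have [Q Q0 HQ] := prod_bounded xpredT aK.
have [_ mg goo] := gp.
apply: (cintegrable_bddM (cmeasurable_prod_kernel xpredT x aK) (HQ x)).
exact: Lnorm_cintegrable p1 mg goo.
Qed.

(** Along the i-th variable the function is the convolution of phi with u, the product of g and the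
    other factors. Factor i must still be phi, because q_k acts through a source. *)
Lemma on_var_q1 (K : 'I_d -> R -> R -> R[i]) (i : 'I_d) k :
  (forall l, admissible (K l)) -> K i = shiftK ->
  on_var i (q1 lam theta p k) (tensor_conv K) =
  tensor_conv (fun l => if l == i then levelK k else K l).
Proof.
move=> aK Ki; apply/funext => x; rewrite /on_var.
pose u (t : d.-tuple R) := \prod_(l < d | l != i) K l (tnth x l) (tnth t l) * g t.
have [Q Q0 HQ] := prod_bounded (fun l => l != i) aK.
have [pg mg goo] := gp.
have ug t : normc (u t) <= Q * normc (g t).
  by rewrite Normc.normcM ler_wpM2r ?normc_ge0.
have mu : cmeasurable u by apply: cmeasurableM => //; exact: cmeasurable_prod_kernel.
have pu : torus_periodic u.
  move=> t j; rewrite /u pg; congr (_ * _); apply: eq_bigr => l _.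
  by rewrite tnth_vset; case: eqP => // ->; have [_ _ ->] := aK j.
have iu : cintegrable (torus d) u.
  apply: (cintegrable_normc_le mu _ ug).
  exact: (integrableZl measurableT Q
    (cintegrable_integrable_normc (Lnorm_cintegrable p1 mg goo))).
have -> : (fun s => tensor_conv K (vset x i s)) = section_conv i u.
  apply/funext => s; congr cintegral; apply/funext => t.
  rewrite (bigD1 i)//= tnth_vset eqxx Ki -mulrA; congr (_ * (_ * _)).
  by apply: eq_bigr => l li; rewrite tnth_vset (negbTE li).
have -> : tensor_conv (fun l => if l == i then levelK k else K l) x =
    cintegral (torus d) (fun t => levelK k (tnth x i) (tnth t i) * u t).
  congr cintegral; apply/funext => t.
  rewrite (bigD1 i)//= eqxx -mulrA; congr (_ * (_ * _)).
  by apply: eq_bigr => l li; rewrite (negbTE li).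
have QS m := @Qop_section d i g u Q gp mu pu Q0 ug m (tnth x i).
have iq m : cintegrable (torus d) (fun t => quad_kernel (cutoff_coef m) m
    (fourier mask_coef) (tnth x i) (tnth t i) * u t).
  have [mK [Q' Q0' bK] _] := admissible_quad m.
  apply: (cintegrable_bddM _ (fun t => bK _ _) iu).
  by apply: mK; [exact: measurable_cst|exact: measurable_tnth].
case: k => [|k]; first by rewrite /q1 QS.
rewrite /q1 !QS ?expn_gt0// -cintegralB//.
by congr cintegral; apply/funext => t; rewrite /level_kernel mulrBl.
Qed.

(** Variables are treated one at a time along a duplicate-free list, so factor j is still phi when
    its operator acts. *)
Lemma qop_tensor (k : 'I_d -> nat) :
  qop lam theta p k (tensor_conv (fun=> shiftK)) = tensor_conv (fun l => levelK (k l)).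
Proof.
rewrite /qop; have : uniq (index_enum 'I_d) := index_enum_uniq _.
have -> : tensor_conv (fun l => levelK (k l)) =
    tensor_conv (fun l => if l \in index_enum 'I_d then levelK (k l) else shiftK).
  by congr tensor_conv; apply/funext => l; rewrite mem_index_enum.
elim: (index_enum 'I_d) => [|j s IH] /=; first by rewrite big_nil.
move=> /andP[js us]; rewrite big_cons /= IH// on_var_q1.
- congr tensor_conv; apply/funext => l; rewrite in_cons.
  by case: eqP => [->|].
- by move=> l; case: ifP => _; [exact: admissible_level|exact: admissible_shift].
- by rewrite (negbTE js).
Qed.

Lemma convolution_tensor : convolution (@phi R lam d) g = tensor_conv (fun=> shiftK).
Proof.
apply/funext => x; congr cintegral; apply/funext => t.
by rewrite phiE; congr (_ * _); apply: eq_bigr => l _; rewrite tnth_vsub.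
Qed.

Lemma Pop_error m (x : d.-tuple R) :
  convolution (@phi R lam d) g x - Pop lam theta p m (convolution (@phi R lam d) g) x =
  cintegral (torus d) (fun t => smolyak_error shiftK levelK m m x t * g t).
Proof.
rewrite /Pop convolution_tensor.
under eq_bigr do rewrite qop_tensor.
pose F (k : {ffun 'I_d -> 'I_m.+1}) (t : d.-tuple R) :=
  \prod_(l < d) levelK (k l) (tnth x l) (tnth t l) * g t.
have iF k : cintegrable (torus d) (F k).
  by apply: (@cintegrable_tensor (fun l => levelK (k l))) => l; exact: admissible_level.
have iS := @cintegrable_tensor (fun=> shiftK) x (fun=> admissible_shift).
rewrite [X in _ - X](_ : _ = \sum_(k : {ffun 'I_d -> 'I_m.+1} | (\sum_(j < d) k j <= m)%N)
  cintegral (torus d) (F k))// -cintegral_sum// /tensor_conv -cintegralB//.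
  by congr cintegral; apply/funext => t; rewrite mulrBl mulr_suml.
exact: cintegrable_sum.
Qed.

End TensorOperators.

End Sections.

Lemma cutoff_coef1 {R : realType} (theta : R -> R) m j : is_cutoff theta ->
  (0 < m)%N -> (2 * `|j| <= m)%N -> cutoff_coef theta m j = 1.
Proof.
move=> [_ th1 _] m0 jm; apply: th1; have m0' : 0 < m%:R :> R by rewrite ltr0n.
rewrite -ler_norml normrM normfV (gtr0_norm m0') ler_pdivrMr// -intr_norm.
rewrite ler_pdivlMl// -abszE -natrM ler_nat//.
Qed.

Lemma cutoff_coef0 {R : realType} (theta : R -> R) m j : is_cutoff theta ->
  (0 < m)%N -> (m <= `|j|)%N -> cutoff_coef theta m j = 0.
Proof.
move=> [_ _ th0] m0 jm; apply: th0; have m0' : 0 < m%:R :> R by rewrite ltr0n.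
rewrite -ltr_norml normrM normfV (gtr0_norm m0') ltr_pdivrMr// -intr_norm.
by rewrite mul1r -abszE ltr_nat -leqNgt.
Qed.

(** The logarithmic factor is monotone in the right direction; the polynomial one uses m + 1 <= 2m,
    valid as m > 0. *)
Lemma level_weight_mono {R : realType} (r kappa : R) (d m : nat) :
  0 <= kappa -> (0 < d)%N -> (0 < m)%N ->
  level_weight r kappa m * m.+1%:R ^+ d.-1 <=
  2 ^+ d.-1 * 2 `^ (- (r * m%:R)) * m%:R `^ (d%:R - 1 - kappa).
Proof.
move=> k0 d0 m0; have m0' : 0 < m%:R :> R by rewrite ltr0n.
have -> : m%:R `^ (d%:R - 1 - kappa) = m%:R ^+ d.-1 * m%:R `^ (- kappa).
  rewrite powRD; last by rewrite (gt_eqF m0') implybT.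
  by rewrite -[in d%:R](prednK d0) -natr1 addrK powR_mulrn// ltW.
rewrite /level_weight.
have -> : 2 ^+ d.-1 * 2 `^ (- (r * m%:R)) * (m%:R ^+ d.-1 * m%:R `^ (- kappa)) =
    2 `^ (- (r * m%:R)) * m%:R `^ (- kappa) * (2 * m%:R) ^+ d.-1 :> R.
  by rewrite exprMn; ring.
apply: ler_pM; rewrite ?mulr_ge0 ?powR_ge0 ?exprn_ge0//.
  by rewrite ler_wpM2l ?powR_ge0// powR_antimono// ler_nat.
rewrite lerXn2r ?nnegrE ?mulr_ge0// -natrM ler_nat; clear -m0; lia.
Qed.

(** * The Schur test applied to the error kernel *)

Section ErrorNorm.
Context {R : realType}.
Local Notation normc := (@Normc.normc R).
Variables (lam theta : R -> R) (p : \bar R) (r kappa A T : R).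
Hypotheses (p1 : (1 <= p)%E) (r1 : 1 < r) (k0 : 0 <= kappa) (A0 : 0 <= A) (T0 : 0 <= T).
Hypothesis bA : mask_differences r kappa A (mask_coef lam).
Hypothesis cT : forall m, (0 < m)%N -> cutoff_differences T m (cutoff_coef theta m).
Hypothesis lam0 : forall t, lam t != 0.
Hypothesis cutoff : is_cutoff theta.

Lemma Pop_error_norm d m (f : d.-tuple R -> R[i]) : in_H lam p f ->
  (cnorm p (fun x => f x - Pop lam theta p m f x)%R <=
   (2 * ((d%:R * kernel_const r kappa A T ^+ d + 1) *
      (level_weight r kappa m * m.+1%:R ^+ d.-1)))%:E * Hnorm lam p f)%E.
Proof.
move=> fH; rewrite /Hnorm; set g := source lam p f.
have [gp fE] : is_source lam p f g by exact: xgetPex.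
have [_ mg goo] := gp; have mng := measurable_normc mg.
have ig := Lnorm_cintegrable p1 mg goo.
set W := level_weight r kappa m * m.+1%:R ^+ d.-1.
have W0 : 0 < W by rewrite !mulr_gt0 ?powR_gt0 ?exprn_gt0.
have c1 m' j := @cutoff_coef1 R theta m' j cutoff.
have c0 m' j := @cutoff_coef0 R theta m' j cutoff.
set D := d%:R * _; have D0 : 0 <= D.
  by rewrite mulr_ge0 ?exprn_ge0//; exact: kernel_const_ge0.
(* The 2 pays for complex integrals; the 1 added to D makes the bound positive, as the Schur test
   requires. *)
set E := 2 * _; have E0 : 0 < E by rewrite mulr_gt0// mulr_gt0// ltr_wpDl.
pose K (w : d.-tuple R * d.-tuple R) :=
  smolyak_error (shift_kernel (mask_coef lam)) (level_kernel (mask_coef lam) (cutoff_coef theta))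
    m m w.1 w.2.
have mK : cmeasurable K := cmeasurable_smolyak_kernel (cutoff_coef theta) r1 k0 A0 bA d m m.
have DE : 2 * (D * W) <= E.
  by rewrite /E ler_pM2l// ler_pM2r// lerDl.
pose k w := 2 * normc (K w).
have mk : measurable_fun setT k.
  by apply: measurable_funM; [exact: measurable_cst|exact: measurable_normc].
have kk0 w : 0 <= k w by rewrite mulr_ge0 ?normc_ge0.
have two_le (F : d.-tuple R -> R[i]) : cmeasurable F ->
    (\int[torus d]_t (normc (F t))%:E <= (D * W)%:E)%E ->
    (\int[torus d]_t (2 * normc (F t))%:E <= E%:E)%E.
  move=> mF FD; under eq_integral do rewrite EFinM.
  rewrite ge0_integralZl//; last 2 first.
    exact: emeasurable_normc.
    by move=> t _; rewrite lee_fin normc_ge0.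
  apply: (@le_trans _ _ (2%:E * (D * W)%:E)%E); first by rewrite lee_wpmul2l ?lee_fin.
  by rewrite -EFinM lee_fin.
have kE x : (\int[torus d]_t (k (x, t))%:E <= E%:E)%E.
  apply: two_le; first exact: (cmeasurable_comp mK (measurable_pair1 x)).
  exact: (smolyak_kernel_bound r1 k0 A0 T0 bA cT c1 c0 false x (leqnn m)).
(* Columns of K are rows of the kernel built from the flipped factors, to which K is convertible. *)
have kE' t : (\int[torus d]_x (k (x, t))%:E <= E%:E)%E.
  apply: (two_le (fun x => K (x, t))); first exact: (cmeasurable_comp mK (measurable_pair2 t)).
  exact: (smolyak_kernel_bound r1 k0 A0 T0 bA cT c1 c0 true t (leqnn m)).
have kpsi (v : d.-tuple R -> \bar R) : measurable_fun setT v -> (forall t, 0 <= v t)%E ->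
    (\int[torus d]_x \int[torus d]_t ((k (x, t))%:E * v (snd (x, t))) <=
     E%:E * \int[torus d]_t v t)%E.
  move=> mv v0.
  have mkv : measurable_fun setT (fun w : d.-tuple R * d.-tuple R => (k w)%:E * v w.2)%E.
    apply: emeasurable_funM; first exact/measurable_EFinP.
    exact: (measurableT_comp mv measurable_snd).
  rewrite (@fubini_tonelli _ _ _ _ _ (torus d) (torus d)
    (fun w : d.-tuple R * d.-tuple R => (k w)%:E * v w.2)%E)//; last first.
    by move=> w; rewrite mule_ge0// lee_fin.
  have EE : (0 <= E%:E)%E by rewrite lee_fin ltW.
  rewrite -ge0_integralZl//.
  apply: ge0_le_integral => //.
  - by move=> t _; apply: integral_ge0 => x _; rewrite mule_ge0// lee_fin.
  - apply: (@measurable_fun_fubini_tonelli_G _ _ _ _ _ (torus d)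
      (fun w : d.-tuple R * d.-tuple R => (k w)%:E * v w.2)%E) => //.
    by move=> w; rewrite mule_ge0// lee_fin.
  - exact: measurable_funeM.
  - move=> t _ /=; under eq_integral do rewrite muleC.
    rewrite ge0_integralZl//.
    + by rewrite muleC lee_wpmul2r.
    + by apply/measurable_EFinP; exact: (measurableT_comp mk (measurable_pair2 t)).
    + by move=> x _; rewrite lee_fin.
have mkg : measurable_fun setT (fun w : d.-tuple R * d.-tuple R =>
    (k w * normc (g w.2))%:E).
  apply/measurable_EFinP; apply: measurable_funM => //.
  exact: (measurableT_comp mng measurable_snd).
apply: le_trans (@Lnorm_average _ _ _ _ _ _ _ (torus d) (torus d) (torus d) k snd E
  mk kk0 measurable_snd E0 kE kpsi p (fun t => normc (g t)) p1 mng (fun t => normc_ge0 _)).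
have B0 := mask_bound_ge0 kappa A0.
have bB := mask_differences_bound k0 A0 bA.
have -> : (fun x => f x - Pop lam theta p m f x) =
    (fun x => cintegral (torus d) (fun t => K (x, t) * g t)).
  by apply/funext => x; rewrite fE (Pop_error p1 r1 B0 bB lam0 cutoff gp).
have mKg : cmeasurable (fun w : d.-tuple R * d.-tuple R => K w * g w.2).
  by apply: cmeasurableM => //; exact: (cmeasurable_comp mg measurable_snd).
apply: Lnorm_le => //.
- apply: emeasurable_normc.
  exact: (@cmeasurable_cintegral2 _ _ _ _ _ (torus d) (fun w => K w * g w.2)).
- apply: (@measurable_fun_fubini_tonelli_F _ _ _ _ _ (torus d)
    (fun w : d.-tuple R * d.-tuple R => (k w * normc (g w.2))%:E)) => //.
  by move=> w; rewrite lee_fin mulr_ge0 ?normc_ge0.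
- by move=> x; rewrite lee_fin normc_ge0.
- move=> x.
  have mKx : cmeasurable (fun t => K (x, t) * g t).
    exact: (cmeasurable_comp mKg (measurable_pair1 x)).
  apply: (le_trans (normc_cintegral_le (torus d) mKx)).
  rewrite -ge0_integralZl//; last 2 first.
    exact: emeasurable_normc.
    by move=> t _; rewrite lee_fin normc_ge0.
  rewrite le_eqVlt; apply/orP; left; apply/eqP; apply: eq_integral => t _.
  by rewrite -EFinM Normc.normcM mulrA.
Qed.

End ErrorNorm.

Theorem theorem3p3 (R : realType) (d : nat) (p : \bar R) (r kappa : R)
    (lam theta : R -> R) :
  (0 < d)%N -> (1 <= p)%E -> 1 < r -> 0 <= kappa ->
  (forall t : R, lam t != 0) -> (exists M : R, forall t : R, `|lam t| <= M) ->
  is_mask r kappa lam -> is_cutoff theta ->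
  exists C : R, forall (m : nat) (f : d.-tuple R -> R[i]),
    (0 < m)%N -> in_H lam p f ->
    (cnorm p (fun x => f x - Pop lam theta p m f x)%R
     <= (C * 2 `^ (- (r * m%:R)) * m%:R `^ (d%:R - 1 - kappa))%R%:E
        * Hnorm lam p f)%E.
Proof.
move=> d0 p1 r1 k0 lam0 lamM mask cutoff.
have r0 : 0 <= r by exact: ltW (lt_trans ltr01 r1).
have [A A0 bA] := mask_differencesP r0 k0 lamM mask.
have [T T0 cT] := cutoff_differencesP cutoff.
set D := d%:R * kernel_const r kappa A T ^+ d.
have D0 : 0 <= D by rewrite mulr_ge0 ?exprn_ge0//; exact: kernel_const_ge0.
(* The constant of [Pop_error_norm] times 2^(d-1), the cost of replacing (m+1)^(d-1) by m^(d-1). *)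
exists (2 * ((D + 1) * 2 ^+ d.-1)) => m f m0 fH.
apply: (le_trans (Pop_error_norm p1 r1 k0 A0 T0 bA cT lam0 cutoff m fH)).
apply: lee_wpmul2r; first exact: Lnorm_ge0.
rewrite lee_fin -/D -!mulrA ler_pM2l// ler_pM2l ?ltr_wpDl// mulrA.
by rewrite [leRHS]mulrA; exact: level_weight_mono.
Qed.
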